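(* Let $\alpha>0$, $\varphi(z)=\alpha(\log^+|z|)^2$, let $p\in\{2,\infty\}$, and let $\Lambda\subset\mathbb{C}$ be a $d_\rho$-separated sequence. Then: (i) if $D^+(\Lambda)<2\alpha$, then $\Lambda$ is a subset of some complete interpolating sequence for $\mathcal{F}^p_\varphi$; (ii) if $D^-(\Lambda)>2\alpha$, then $\Lambda$ contains a complete interpolating sequence for $\mathcal{F}^p_\varphi$.
   Context: Here $\log^+ t=\max(\log t,0)$ and $m$ is planar Lebesgue measure. Sequences $\Lambda\subset\mathbb{C}$ are (countable) sets of distinct points. Put $d_\rho(z,w)=\sqrt{2\alpha}\,\frac{|z-w|}{\sqrt{2\alpha}+\min(|z|,|w|)}$; $\Lambda$ is $d_\rho$-separated if $\inf\{d_\rho(z,w):z,w\in\Lambda,\ z\neq w\}>0$. With $\mathcal{A}(r,R)=\{z: r\le|z|<R\}$, the lower and upper densities are $$D^-(\Lambda)=\liminf_{R\to+\infty}\liminf_{r\to+\infty}\frac{\operatorname{Card}(\Lambda\cap\mathcal{A}(r,Rr))}{\log R},\quad D^+(\Lambda)=\limsup_{R\to+\infty}\limsup_{r\to+\infty}\frac{\operatorname{Card}(\Lambda\cap\mathcal{A}(r,Rr))}{\log R}.$$ $\mathcal{F}^2_\varphi$ is the Hilbert space of entire functions $f$ with $\|f\|_{\varphi,2}^2=\int_{\mathbb{C}}|f|^2e^{-2\varphi}\,dm<\infty$; $\mathbf{k}_z$ is its reproducing kernel at $z$. For $v=(v_\lambda)_{\lambda\in\Lambda}$ put $\|v\|_{\varphi,2,\Lambda}^2=\sum_{\lambda\in\Lambda}|v_\lambda|^2/\mathbf{k}_\lambda(\lambda)$.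 $\Lambda$ is sampling for $\mathcal{F}^2_\varphi$ if there is $C>0$ with $C^{-1}\|f\|_{\varphi,2}\le\|f|_\Lambda\|_{\varphi,2,\Lambda}\le C\|f\|_{\varphi,2}$ for all $f\in\mathcal{F}^2_\varphi$; it is interpolating for $\mathcal{F}^2_\varphi$ if for every $v$ with $\|v\|_{\varphi,2,\Lambda}<\infty$ there is $f\in\mathcal{F}^2_\varphi$ with $f|_\Lambda=v$. $\mathcal{F}^\infty_\varphi$ is the space of entire functions $f$ with $\|f\|_{\varphi,\infty}=\sup_{z\in\mathbb{C}}|f(z)|e^{-\varphi(z)}<\infty$. For $v=(v_\lambda)_{\lambda\in\Lambda}$ put $\|v\|_{\varphi,\infty,\Lambda}=\sup_{\lambda\in\Lambda}|v_\lambda|e^{-\varphi(\lambda)}$. $\Lambda$ is sampling for $\mathcal{F}^\infty_\varphi$ if there is $L>0$ with $\|f\|_{\varphi,\infty}\le L\|f|_\Lambda\|_{\varphi,\infty,\Lambda}$ for all $f\in\mathcal{F}^\infty_\varphi$; it is interpolating for $\mathcal{F}^\infty_\varphi$ if for every $v$ with $\|v\|_{\varphi,\infty,\Lambda}<\infty$ there is $f\in\mathcal{F}^\infty_\varphi$ with $f|_\Lambda=v$. In each space, a complete interpolating sequence is one that is both sampling and interpolating. *)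

(* Defs.v *)
(* The complex plane is [R[i]] over an arbitrary [R : realType]. *)
From HB Require Import structures.
From mathcomp Require Import all_boot all_order all_algebra.
From mathcomp Require Import complex.
From mathcomp Require Import all_classical all_reals all_analysis.

Set Implicit Arguments.
Unset Strict Implicit.
Unset Printing Implicit Defensive.

Import Order.TTheory GRing.Theory Num.Theory.
Import numFieldNormedType.Exports.

Local Open Scope classical_set_scope.
Local Open Scope complex_scope.
Local Open Scope ring_scope.

Definition cabs (R : realType) (z : R[i]) : R := complex.Re `|z|.

(* Since [ln x = 0] for [x <= 0], this is also log^+ at [t = 0]. *)
Definition logp (R : realType) (t : R) : R := Num.max (ln t) 0.

Definition weight (R : realType) (alpha : R) (z : R[i]) : R :=
  alpha * logp (cabs z) ^+ 2.

Definition d_rho (R : realType) (alpha : R) (z w : R[i]) : R :=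
  Num.sqrt (2 * alpha) * (cabs (z - w) /
    (Num.sqrt (2 * alpha) + Num.min (cabs z) (cabs w))).

(* The infimum is taken in the extended reals, so it is +oo when [Lambda] has
   at most one point. *)
Definition d_rho_separated (R : realType) (alpha : R) (Lambda : set R[i]) :
    Prop :=
  (0 < ereal_inf [set x : \bar R | exists z w, [/\ Lambda z, Lambda w, z != w
                    & x = (d_rho alpha z w)%:E]])%E.

Definition annulus (R : realType) (r s : R) : set R[i] :=
  [set z | r <= cabs z < s].

(* [counting] is +oo on infinite sets. *)
Definition annulus_ratio (R : realType) (Lambda : set R[i]) (S r : R) :
    \bar R :=
  (counting (Lambda `&` annulus r (S * r)) * ((ln S)^-1)%:E)%E.

Definition lower_density (R : realType) (Lambda : set R[i]) : \bar R :=
  limf_einf (fun S : R =>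
    limf_einf (fun r : R => annulus_ratio Lambda S r) (pinfty_nbhs R))
    (pinfty_nbhs R).

Definition upper_density (R : realType) (Lambda : set R[i]) : \bar R :=
  limf_esup (fun S : R =>
    limf_esup (fun r : R => annulus_ratio Lambda S r) (pinfty_nbhs R))
    (pinfty_nbhs R).

(* [R[i]^o] is [R[i]] as a normed space over itself, so the derivative here is
   the complex one. *)
Definition entire (R : realType) (f : R[i] -> R[i]) : Prop :=
  forall z : R[i], derivable (f : R[i]^o -> R[i]^o) z 1.

(* Planar Lebesgue measure, carried by [R * R] and transported by [plane]. *)
Definition planar_measure (R : realType) :
    {measure set (measurableTypeR R * measurableTypeR R) -> \bar R} :=
  (@lebesgue_measure R \x @lebesgue_measure R)%E.
Arguments planar_measure R : clear implicits.

Definition plane (R : realType) (x : R * R) : R[i] := x.1 +i* x.2.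

(* The two admissible values, 2 and infinity, of the exponent p. *)
Variant exponent := exp_two | exp_infty.

(* Supremum of a nonnegative function, computed in [0, +oo]: it is 0 on the
   empty set, where [ereal_sup] alone would give -oo. *)
Definition sup_nonneg (R : realType) (A : set R[i]) (g : R[i] -> R) : \bar R :=
  maxe 0%E (ereal_sup [set (g z)%:E | z in A]).

Definition fock_norm (R : realType) (alpha : R) (p : exponent)
    (f : R[i] -> R[i]) : \bar R :=
  match p with
  | exp_two =>
      sqrte (\int[planar_measure R]_(x in setT)
        (cabs (f (plane x)) ^+ 2 * expR (- (2 * weight alpha (plane x))))%:E)
  | exp_infty => sup_nonneg setT (fun z => cabs (f z) * expR (- weight alpha z))
  end.

Definition fock (R : realType) (alpha : R) (p : exponent) : set (R[i] -> R[i]) :=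
  [set f | entire f /\ (fock_norm alpha p f < +oo)%E].

Definition fock_dot (R : realType) (alpha : R) (f g : R[i] -> R[i]) : R[i] :=
  let h := fun x : R * R =>
    f (plane x) * (g (plane x))^*%C *
      (expR (- (2 * weight alpha (plane x))))%:C in
  Rintegral (planar_measure R) setT (fun x => complex.Re (h x)) +i*
  Rintegral (planar_measure R) setT (fun x => complex.Im (h x)).

(* The element of the Hilbert space [fock alpha exp_two] representing
   evaluation at [z]. *)
Definition fock_kernel (R : realType) (alpha : R) (z : R[i]) : R[i] -> R[i] :=
  xget (fun=> 0) [set k | fock alpha exp_two k /\
    forall f, fock alpha exp_two f -> f z = fock_dot alpha f k].

(* Only the values of [v] on [Lambda] matter.  The diagonal value of the kernel
   is a complex number which is real and positive, hence the real part. *)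
Definition seq_norm (R : realType) (alpha : R) (p : exponent)
    (Lambda : set R[i]) (v : R[i] -> R[i]) : \bar R :=
  match p with
  | exp_two =>
      sqrte (\esum_(l in Lambda)
        (cabs (v l) ^+ 2 / complex.Re (fock_kernel alpha l l))%:E)
  | exp_infty =>
      sup_nonneg Lambda (fun l => cabs (v l) * expR (- weight alpha l))
  end.

Definition sampling (R : realType) (alpha : R) (p : exponent)
    (Lambda : set R[i]) : Prop :=
  match p with
  | exp_two =>
      exists2 C : R, 0 < C & forall f, fock alpha exp_two f ->
        (C^-1%:E * fock_norm alpha exp_two f <= seq_norm alpha exp_two Lambda f)%E
        /\
        (seq_norm alpha exp_two Lambda f <= C%:E * fock_norm alpha exp_two f)%E
  | exp_infty =>
      exists2 L : R, 0 < L & forall f, fock alpha exp_infty f ->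
        (fock_norm alpha exp_infty f <= L%:E * seq_norm alpha exp_infty Lambda f)%E
  end.

Definition interpolating (R : realType) (alpha : R) (p : exponent)
    (Lambda : set R[i]) : Prop :=
  forall v : R[i] -> R[i], (seq_norm alpha p Lambda v < +oo)%E ->
    exists2 f, fock alpha p f & forall l, Lambda l -> f l = v l.

Definition complete_interpolating (R : realType) (alpha : R) (p : exponent)
    (Lambda : set R[i]) : Prop :=
  [/\ countable Lambda, sampling alpha p Lambda & interpolating alpha p Lambda].

(* Main.v *)
(* Write mx z = max(1, |z|) and cut the plane into the shells
   q^k <= mx z < q^(k+1).  Let Gamma have boundedly many points in each shell,
   with mutual distances at least delta * mx z.  If, up to constants, the
   product of rho / mx g over the points g of Gamma with modulus below rho is
   exp(alpha (ln rho)^2 - (kap - 1/2) ln rho), with kap = 0 for p = infinity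
   and kap = 1 for p = 2, then the infinite products G_g over the points of
   Gamma other than g converge, and the functions G_g / G_g(g), weighted by
   exp(- phi), decay geometrically away from the shell of g.  Lagrange
   interpolation then solves the interpolation problem (by Schur's test when
   p = 2).  A function of the space vanishing on Gamma is zero: divide it by a
   partial product and apply the maximum principle on a square whose boundary
   avoids Gamma.  Hence the interpolation formula reproduces every function of
   the space, which is the sampling inequality.

   Given F contained in A, where F has at most (2 alpha - eps) ln q and A at
   least (2 alpha + eps) ln q points in every distant shell, a feedback rule
   chooses in each shell the points of F or those of A so that the product
   stays comparable with its target: the deviation is governed by two
   quantities, the excess of points D and its discrete integral I, and a
   switching control keeps both bounded.  Part (i) takes F = Lambda and A the
   union of Lambda with the points of a dense geometric progression which are
   far from Lambda; part (ii) takes F empty and A = Lambda. *)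
Require Import Defs.
From HB Require Import structures.
From mathcomp Require Import all_boot all_order all_algebra.
From mathcomp Require Import complex.
From mathcomp Require Import all_classical all_reals all_analysis measurable_realfun.
From mathcomp Require Import ring lra zify.

Import Order.TTheory GRing.Theory Num.Theory.
Import numFieldNormedType.Exports.

Local Open Scope classical_set_scope.
Local Open Scope complex_scope.
Local Open Scope ring_scope.

Set Implicit Arguments.
Unset Strict Implicit.
Unset Printing Implicit Defensive.

(** The target contains [1/2] because, weighted by [expR (- phi)] times [mx z ^ kap], the full
    product grows like the square root of [mx z]. Leaving out the factor at [h] divides it by [mx z]
    beyond the shell of [h], so the weighted function falls off at the same rate, exponent 1/2, on
    both sides. The power [kap = 1] for p = 2 comes from the size of the kernel diagonal,
    [expR (2 phi) / mx z ^ 2].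

    Only the number of points in each shell matters, not their arguments: between different shells a
    factor is [mx z / mx g] or 1 up to errors that decay geometrically.

    The difficulty of the selection is that the deviation is the integral of the excess, up to
    bounded noise. Reacting to the sign of the deviation alone gives no bound on the excess, so
    thresholds are imposed on the excess; they must be wide enough that an excess at the threshold
    overcomes the noise.

    All contour integrals are taken over rectangles with sides parallel to the axes. The kernel is
    compared with its expected size at points of Gamma only, where the interpolating functions
    themselves serve as test functions for the lower bound. *)

Local Notation Re := (@complex.Re _).
Local Notation Im := (@complex.Im _).

(** * Modulus, real and imaginary part *)

Section Modulus.
Variable R : realType.
Implicit Types (z w : R[i]) (x y : R).

Lemma cabs_normc z : cabs z = Normc.normc z. Proof. by []. Qed.

Lemma norm_cabs z : `|z| = (cabs z)%:C. Proof. by []. Qed.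

Lemma cabs_ge0 z : 0 <= cabs z.
Proof. by rewrite -lecR -norm_cabs normr_ge0. Qed.

Lemma cabs0 : cabs (0 : R[i]) = 0.
Proof. exact: Normc.normc0. Qed.

Lemma cabs1 : cabs (1 : R[i]) = 1.
Proof. exact: Normc.normc1. Qed.

Lemma cabs_eq0 z : (cabs z == 0) = (z == 0).
Proof. by apply/eqP/eqP => [/Normc.eq0_normc //|->]; exact: cabs0. Qed.

Lemma cabs_gt0 z : (0 < cabs z) = (z != 0).
Proof. by rewrite lt_def cabs_eq0 cabs_ge0 andbT. Qed.

Lemma cabsM z w : cabs (z * w) = cabs z * cabs w.
Proof. exact: Normc.normcM. Qed.

Lemma cabsV z : cabs z^-1 = (cabs z)^-1.
Proof. exact: Normc.normcV. Qed.

Lemma cabsf z w : cabs (z / w) = cabs z / cabs w.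
Proof. by rewrite cabsM cabsV. Qed.

Lemma cabsN z : cabs (- z) = cabs z.
Proof. exact: normcN. Qed.

Lemma cabsC z w : cabs (z - w) = cabs (w - z).
Proof. by rewrite -opprB cabsN. Qed.

Lemma cabsD z w : cabs (z + w) <= cabs z + cabs w.
Proof. exact: le_normcD. Qed.

Lemma cabsB z w : cabs (z - w) <= cabs z + cabs w.
Proof. by rewrite -(cabsN w) cabsD. Qed.

Lemma cabsBD z w : cabs z - cabs w <= cabs (z - w).
Proof. by rewrite lerBlDr -{1}(subrK w z) cabsD. Qed.

Lemma cabsX z n : cabs (z ^+ n) = cabs z ^+ n.
Proof. by elim: n => [|n IH]; rewrite ?expr0 ?cabs1 // !exprS cabsM IH. Qed.

Lemma cabs_sum (I : Type) (s : seq I) (P : pred I) (F : I -> R[i]) :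
  cabs (\sum_(i <- s | P i) F i) <= \sum_(i <- s | P i) cabs (F i).
Proof.
elim/big_rec2: _ => [|i y1 y2 _ le]; first by rewrite cabs0.
by rewrite (le_trans (cabsD _ _))// lerD2l.
Qed.

Lemma cabs_prod (I : Type) (s : seq I) (P : pred I) (F : I -> R[i]) :
  cabs (\prod_(i <- s | P i) F i) = \prod_(i <- s | P i) cabs (F i).
Proof. by elim/big_rec2: _ => [|i y1 y2 _ le]; rewrite ?cabs1 ?cabsM ?le. Qed.

Lemma cabsR x : cabs (x%:C) = `|x|.
Proof. by rewrite cabs_normc /= expr0n addr0 sqrtr_sqr. Qed.

Lemma cabsE z : cabs z = Num.sqrt (Re z ^+ 2 + Im z ^+ 2).
Proof. by case: z. Qed.

Lemma cabs_i : cabs ('i%C : R[i]) = 1.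
Proof. by rewrite cabsE /= expr0n add0r expr1n sqrtr1. Qed.

Lemma sqr_cabs z : cabs z ^+ 2 = Re z ^+ 2 + Im z ^+ 2.
Proof. by rewrite cabsE sqr_sqrtr// addr_ge0 ?sqr_ge0. Qed.

Lemma Re_le_cabs z : `|Re z| <= cabs z.
Proof.
by rewrite cabsE -sqrtr_sqr ler_sqrt ?lerDl ?sqr_ge0// addr_ge0 ?sqr_ge0.
Qed.

Lemma Im_le_cabs z : `|Im z| <= cabs z.
Proof.
by rewrite cabsE -sqrtr_sqr ler_sqrt ?lerDr ?sqr_ge0// addr_ge0 ?sqr_ge0.
Qed.

Lemma cabs_le_ReIm z : cabs z <= `|Re z| + `|Im z|.
Proof.
rewrite [in leLHS](complexE z); apply: (le_trans (cabsD _ _)).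
by rewrite cabsM cabs_i mul1r !cabsR.
Qed.

Lemma cReD z w : Re (z + w) = Re z + Re w. Proof. by case: z w => ? ? []. Qed.
Lemma cImD z w : Im (z + w) = Im z + Im w. Proof. by case: z w => ? ? []. Qed.
Lemma cReN z : Re (- z) = - Re z. Proof. by case: z. Qed.
Lemma cImN z : Im (- z) = - Im z. Proof. by case: z. Qed.
Lemma cReB z w : Re (z - w) = Re z - Re w. Proof. by rewrite cReD cReN. Qed.
Lemma cImB z w : Im (z - w) = Im z - Im w. Proof. by rewrite cImD cImN. Qed.
Lemma cReM z w : Re (z * w) = Re z * Re w - Im z * Im w.
Proof. by case: z w => ? ? []. Qed.
Lemma cImM z w : Im (z * w) = Re z * Im w + Im z * Re w.
Proof. by case: z w => a b [c d] /=. Qed.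

Lemma complexP z w : Re z = Re w -> Im z = Im w -> z = w.
Proof. by case: z w => ? ? [? ?] /= -> ->. Qed.

End Modulus.

(** * Continuity and differentiability in one complex variable *)

Section Derivative.
Variable R : realType.
Implicit Types (f g : R[i] -> R[i]) (z w : R[i]).

(** Stated through the real number [cabs], so that every estimate takes place in [R] rather than
    among the real elements of [R[i]]. *)
Definition ccont f z := forall e : R, 0 < e -> exists2 d : R, 0 < d &
  forall w, cabs (w - z) < d -> cabs (f w - f z) < e.

Definition has_cderiv f z (a : R[i]) := forall e : R, 0 < e ->
  exists2 d : R, 0 < d & forall h, cabs h < d ->
    cabs (f (z + h) - f z - a * h) <= e * cabs h.

(** The difference quotient of [derivable] runs over complex [h], and a positive element of [R[i]]
    is real; hence the two notions differ only by multiplying the inequality by [cabs h], which also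
    admits [h = 0]. *)
Lemma has_cderivP f z :
  derivable (f : R[i]^o -> R[i]^o) z 1 <-> exists a, has_cderiv f z a.
Proof.
split=> [/cvg_ex[l /cvgrPdist_le H]|[a H]].
  exists l => e e0; have /H : 0 < e%:C by rewrite ltcR.
  rewrite /= => /nbhs_ballP[d /= d0 Hd].
  have dR : d = (Re d)%:C by rewrite RRe_real// gtr0_real.
  move: d0; rewrite {1}dR ltcR => d0; exists (Re d) => // h hd.
  have [->|h0] := eqVneq h 0; first by rewrite addr0 subrr mulr0 subr0 cabs0 mulr0.
  have := Hd h; rewrite /ball/= sub0r normrN norm_cabs {1}dR ltcR => /(_ hd h0).
  rewrite norm_cabs lecR => {}Hd.
  have -> : f (z + h) - f z - l * h = - (l - h^-1 *: (f (h *: (1 : R[i]^o) + z) - f z)) * h.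
    rewrite /GRing.scale/= mulr1 (addrC h z) mulNr mulrBl.
    by rewrite mulrAC mulVf// mul1r opprB.
  by rewrite cabsM cabsN ler_wpM2r ?cabs_ge0.
apply/cvg_ex; exists a; apply/cvgrPdist_le => e e0.
have eR : e = (Re e)%:C by rewrite RRe_real// gtr0_real.
move: (e0); rewrite eR ltcR => e0'.
have [d d0 Hd] := H _ e0'.
apply/nbhs_ballP; exists d%:C => /=; first by rewrite ltcR.
move=> h; rewrite /ball/= sub0r normrN norm_cabs ltcR => hd h0.
rewrite norm_cabs lecR.
have -> : a - h^-1 *: (f (h *: (1 : R[i]^o) + z) - f z) = - (f (z + h) - f z - a * h) / h.
  rewrite /GRing.scale/= mulr1 (addrC h z) mulNr mulrBl mulrK ?unitfE// opprB.
  by rewrite (mulrC h^-1).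
by rewrite cabsf cabsN ler_pdivrMr ?cabs_gt0// Hd.
Qed.

Definition cderivable f z := exists a, has_cderiv f z a.

Lemma entireP f : entire f <-> forall z, cderivable f z.
Proof. by split=> H z; apply/has_cderivP; exact: H. Qed.

Lemma has_cderiv_ccont f z a : has_cderiv f z a -> ccont f z.
Proof.
move=> H e e0; have [d d0 Hd] := H 1 ltr01.
pose k := 1 + cabs a + 1; have k0 : 0 < k by rewrite /k; have := cabs_ge0 a; lra.
exists (Num.min d (e / k)); first by rewrite lt_min d0 divr_gt0.
move=> w; rewrite lt_min => /andP[wd we].
have := Hd _ wd; rewrite subrKC mul1r => {}Hd.
rewrite -(subrK (a * (w - z)) (f w - f z)).
apply: (le_lt_trans (cabsD _ _)); rewrite cabsM.
move: we; rewrite ltr_pdivlMr// => we.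
have := cabs_ge0 (w - z); have := cabs_ge0 a; rewrite /k in we; nra.
Qed.

Lemma cderivable_ccont f z : cderivable f z -> ccont f z.
Proof. by case=> a /has_cderiv_ccont. Qed.

Lemma ccont_cst (c : R[i]) z : ccont (fun=> c) z.
Proof. by move=> e e0; exists 1 => // w _; rewrite subrr cabs0. Qed.

Lemma ccont_id z : ccont id z.
Proof. by move=> e e0; exists e. Qed.

Lemma ccontD f g z : ccont f z -> ccont g z -> ccont (fun x => f x + g x) z.
Proof.
move=> Hf Hg e e0; have e2 : 0 < e / 2 by rewrite divr_gt0.
have [d d0 Hd] := Hf _ e2; have [d' d0' Hd'] := Hg _ e2.
exists (Num.min d d'); first by rewrite lt_min d0.
move=> w; rewrite lt_min => /andP[/Hd ? /Hd' ?]; rewrite opprD addrACA.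
by apply: (le_lt_trans (cabsD _ _)); lra.
Qed.

Lemma ccontN f z : ccont f z -> ccont (fun x => - f x) z.
Proof.
by move=> H e /H[d d0 Hd]; exists d => // w /Hd; rewrite -opprD cabsN.
Qed.

Lemma ccontB f g z : ccont f z -> ccont g z -> ccont (fun x => f x - g x) z.
Proof. by move=> Hf Hg; apply: ccontD => //; exact: ccontN. Qed.

Lemma ccont_bound f z : ccont f z ->
  exists2 d : R, 0 < d & forall w, cabs (w - z) < d -> cabs (f w) < cabs (f z) + 1.
Proof.
move=> /(_ 1 ltr01)[d d0 Hd]; exists d => // w /Hd H.
by have := cabsBD (f w) (f z); lra.
Qed.

Lemma ccontM f g z : ccont f z -> ccont g z -> ccont (fun x => f x * g x) z.
Proof.
move=> Hf Hg e e0; have [d1 d10 Hd1] := ccont_bound Hf.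
pose k := cabs (f z) + 1 + (cabs (g z) + 1).
have k0 : 0 < k by rewrite /k; have := cabs_ge0 (f z); have := cabs_ge0 (g z); lra.
have ek : 0 < e / k by rewrite divr_gt0.
have [d d0 Hd] := Hf _ ek; have [d' d0' Hd'] := Hg _ ek.
exists (Num.min d1 (Num.min d d')); first by rewrite !lt_min d10 d0.
move=> w; rewrite !lt_min => /andP[/Hd1 h1 /andP[/Hd h2 /Hd' h3]].
have -> : f w * g w - f z * g z = f w * (g w - g z) + (f w - f z) * g z by ring.
apply: (le_lt_trans (cabsD _ _)); rewrite !cabsM.
have -> : e = e / k * (cabs (f z) + 1) + e / k * (cabs (g z) + 1).
  by rewrite -mulrDr -/k divfK// gt_eqF.
have := cabs_ge0 (f w); have := cabs_ge0 (g z); have := cabs_ge0 (g w - g z).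
have := cabs_ge0 (f w - f z); set u := e / k in ek h2 h3 *; move=> *.
apply: ltr_leD; last by nra.
apply: (@le_lt_trans _ _ (cabs (f w) * u)); first by rewrite ler_wpM2l// ltW.
by rewrite mulrC ltr_pM2l.
Qed.

Lemma ccontV f z : f z != 0 -> ccont f z -> ccont (fun x => (f x)^-1) z.
Proof.
move=> fz Hf e e0; have c0 : 0 < cabs (f z) by rewrite cabs_gt0.
set c := cabs (f z) in c0.
have e1 : 0 < Num.min (c / 2) (e * c ^+ 2 / 2).
  by rewrite lt_min !divr_gt0// mulr_gt0// exprn_gt0.
have [d d0 Hd] := Hf _ e1; exists d => // w /Hd; rewrite lt_min => /andP[h1 h2].
have h3 : c / 2 <= cabs (f w) by have := cabsBD (f z) (f w); rewrite cabsC -/c; lra.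
have fw : f w != 0 by rewrite -cabs_gt0 (lt_le_trans _ h3)// divr_gt0.
have -> : (f w)^-1 - (f z)^-1 = (f z - f w) / (f w * f z) by field; apply/andP.
rewrite cabsf cabsC ltr_pdivrMr ?cabs_gt0 ?mulf_neq0// cabsM -/c.
apply: (lt_le_trans h2); rewrite -mulrA ler_pM2l//.
by rewrite expr2 mulrAC ler_pM2r// .
Qed.

Lemma has_cderiv_cst (c : R[i]) z : has_cderiv (fun=> c) z 0.
Proof.
by move=> e e0; exists 1 => // h _; rewrite subrr mul0r subr0 cabs0 mulr_ge0 ?cabs_ge0// ltW.
Qed.

Lemma has_cderiv_id z : has_cderiv id z 1.
Proof.
move=> e e0; exists 1 => // h _.
have -> : id (z + h) - id z - 1 * h = 0 by rewrite /=; ring.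
by rewrite cabs0 mulr_ge0 ?cabs_ge0// ltW.
Qed.

Lemma has_cderivD f g z a b : has_cderiv f z a -> has_cderiv g z b ->
  has_cderiv (fun x => f x + g x) z (a + b).
Proof.
move=> Hf Hg e e0; have e2 : 0 < e / 2 by rewrite divr_gt0.
have [d d0 Hd] := Hf _ e2; have [d' d0' Hd'] := Hg _ e2.
exists (Num.min d d'); first by rewrite lt_min d0.
move=> h; rewrite lt_min => /andP[/Hd h1 /Hd' h2].
have -> : f (z + h) + g (z + h) - (f z + g z) - (a + b) * h =
  (f (z + h) - f z - a * h) + (g (z + h) - g z - b * h) by ring.
by apply: (le_trans (cabsD _ _)); lra.
Qed.

(** Caratheodory's form of differentiability: the difference quotient extends continuously. It
    reduces products and inverses, and later the division by a zero, to statements about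
    continuity. *)
Lemma has_cderiv_caratheodory f z a :
  has_cderiv f z a <->
  exists q : R[i] -> R[i], [/\ q z = a, ccont q z &
    forall w, f w - f z = q w * (w - z)].
Proof.
split=> [H|[q [qz qc fq]]].
  exists (fun w => if w == z then a else (f w - f z) / (w - z)).
  rewrite eqxx; split=> //; last first.
    move=> w; case: eqVneq => [->|wz]; first by rewrite !subrr mulr0.
    by rewrite divfK// subr_eq0.
  move=> e e0; have e2 : 0 < e / 2 by rewrite divr_gt0.
  have [d d0 Hd] := H _ e2; exists d => // w /Hd.
  rewrite subrKC eqxx; case: eqVneq => [->|wz]; first by move=> _; rewrite subrr cabs0.
  move=> h; have wz' : 0 < cabs (w - z) by rewrite cabs_gt0 subr_eq0.
  have -> : (f w - f z) / (w - z) - a = (f w - f z - a * (w - z)) / (w - z).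
    by rewrite [RHS]mulrBl mulfK// subr_eq0.
  by rewrite cabsf ltr_pdivrMr//; nra.
move=> e /qc[d d0 Hd]; exists d => // h hd.
have := Hd (z + h); rewrite addrC addKr => /(_ hd).
rewrite fq (addrC z h) addrK -mulrBl cabsM qz => /ltW ?.
by rewrite ler_wpM2r ?cabs_ge0.
Qed.

Lemma has_cderivM f g z a b : has_cderiv f z a -> has_cderiv g z b ->
  has_cderiv (fun x => f x * g x) z (a * g z + f z * b).
Proof.
move=> Hf /[dup] /has_cderiv_ccont gc Hg.
move: Hf Hg => /has_cderiv_caratheodory[q [<- qc fq]] /has_cderiv_caratheodory[p [<- pc gp]].
apply/has_cderiv_caratheodory; exists (fun w => q w * g w + f z * p w); split=> //.
- by apply: ccontD; apply: ccontM => //; exact: ccont_cst.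
- move=> w; rewrite mulrDl mulrAC -fq -mulrA -gp; ring.
Qed.

Lemma has_cderivV f z a : f z != 0 -> has_cderiv f z a ->
  cderivable (fun x => (f x)^-1) z.
Proof.
move=> fz /[dup] /has_cderiv_ccont fc /has_cderiv_caratheodory[q [_ qc fq]].
have [d d0 Hd] : exists2 d : R, 0 < d & forall w, cabs (w - z) < d -> f w != 0.
  have [|d d0 Hd] := fc (cabs (f z)); first by rewrite cabs_gt0.
  by exists d => // w /Hd; apply: contraTneq => ->; rewrite sub0r cabsN ltxx.
exists (- q z / (f z * f z)); apply/has_cderiv_caratheodory.
(* The factorisation is required for every [w], including zeros of [f], where the quotient is taken
   as it stands. Such [w] stay at distance at least [d] from [z] and do not affect continuity at
   [z]. *)
exists (fun w => if f w == 0 then ((f w)^-1 - (f z)^-1) / (w - z)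
                 else - q w / (f w * f z)).
rewrite (negbTE fz); split=> //.
  have : ccont (fun w => - q w / (f w * f z)) z.
    apply: ccontM; first exact: ccontN.
    by apply: ccontV; [rewrite mulf_neq0|apply: ccontM => //; exact: ccont_cst].
  move=> H e /H[d' d0' Hd']; exists (Num.min d d'); first by rewrite lt_min d0.
  move=> w; rewrite lt_min => /andP[/Hd fw /Hd'].
  by rewrite (negbTE fw) (negbTE fz).
move=> w; case: ifPn => [/eqP fw|fw].
  have wz : w - z != 0.
    by rewrite subr_eq0; apply: contra_eqN fw => /eqP ->.
  by rewrite divfK.
have -> : - q w / (f w * f z) * (w - z) = - (q w * (w - z)) / (f w * f z) by ring.
by rewrite -fq; field; apply/andP.
Qed.

Lemma cderivable_cst (c : R[i]) z : cderivable (fun=> c) z.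
Proof. by exists 0; exact: has_cderiv_cst. Qed.

Lemma cderivable_id z : cderivable id z.
Proof. by exists 1; exact: has_cderiv_id. Qed.

Lemma cderivableD f g z : cderivable f z -> cderivable g z ->
  cderivable (fun x => f x + g x) z.
Proof. by move=> [a ?] [b ?]; exists (a + b); exact: has_cderivD. Qed.

Lemma cderivableM f g z : cderivable f z -> cderivable g z ->
  cderivable (fun x => f x * g x) z.
Proof. by move=> [a ?] [b ?]; exists (a * g z + f z * b); exact: has_cderivM. Qed.

Lemma cderivableN f z : cderivable f z -> cderivable (fun x => - f x) z.
Proof.
move=> H; have := cderivableM (cderivable_cst (- 1) z) H.
by under eq_fun do rewrite mulN1r.
Qed.

Lemma cderivableB f g z : cderivable f z -> cderivable g z ->
  cderivable (fun x => f x - g x) z.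
Proof. by move=> Hf Hg; apply: cderivableD => //; exact: cderivableN. Qed.

Lemma cderivableV f z : f z != 0 -> cderivable f z ->
  cderivable (fun x => (f x)^-1) z.
Proof. by move=> fz [a /(has_cderivV fz)]. Qed.

Lemma cderivableX f n z : cderivable f z -> cderivable (fun x => f x ^+ n) z.
Proof.
move=> H; elim: n => [|n IH]; first exact: (cderivable_cst 1).
by under eq_fun do rewrite exprS; exact: cderivableM.
Qed.

Lemma cderivable_near f g z (d : R) : 0 < d ->
  (forall w, cabs (w - z) < d -> f w = g w) -> cderivable f z -> cderivable g z.
Proof.
move=> d0 fg [a H]; exists a => e /H[d' d0' Hd].
exists (Num.min d d'); first by rewrite lt_min d0.
move=> h; rewrite lt_min => /andP[h1 h2]; rewrite -!fg ?Hd//.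
  by rewrite subrr cabs0.
by rewrite addrC addKr.
Qed.

End Derivative.

(** * Integrals along segments *)

Section SegmentIntegral.
Variable R : realType.
Notation mu := (@lebesgue_measure R).
Implicit Types (a b c : R) (f g : R -> R) (u v : R -> R[i]).

Definition segint a b f : R := \int[mu]_(x in `[a, b]) f x.

(** Two-sided continuity, at the end points as well; it is available because the integrands are
    restrictions of functions defined on the whole plane. *)
Definition rcont_on a b f := forall x, a <= x <= b -> {for x, continuous f}.

Lemma rcont_integrable a b f : rcont_on a b f ->
  mu.-integrable `[a, b] (EFin \o f).
Proof.
move=> H; apply: continuous_compact_integrable; first exact: segment_compact.
by apply: continuous_in_subspaceT => x; rewrite inE/= in_itv/= => /H.
Qed.

Lemma rcont_sub a b c d f : a <= c -> d <= b -> rcont_on a b f -> rcont_on c d f.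
Proof.
move=> ac db H x /andP[cx xd]; apply: H.
by rewrite (le_trans ac cx) (le_trans xd db).
Qed.

Lemma segint_split a b c f : a <= c -> c <= b -> rcont_on a b f ->
  segint a b f = segint a c f + segint c b f.
Proof.
move=> ac cb H; apply/eqP; rewrite addrC -subr_eq; apply/eqP.
rewrite /segint Rintegral_itvB ?bnd_simp//; last exact: rcont_integrable.
rewrite Rintegral_itv_obnd_cbnd//.
apply: integrableS (rcont_integrable H) => //.
by apply: subset_itvr; rewrite bnd_simp.
Qed.

Lemma segint_cst a b c : a <= b -> segint a b (fun=> c) = c * (b - a).
Proof.
move=> ab; rewrite /segint Rintegral_cst//= lebesgue_measure_itv/= lte_fin.
by case: (ltgtP a b) ab => // [-> _]; rewrite ?subrr ?mulr0.
Qed.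

Lemma segintD a b f g : rcont_on a b f -> rcont_on a b g ->
  segint a b (fun x => f x + g x) = segint a b f + segint a b g.
Proof. by move=> Hf Hg; rewrite /segint RintegralD//; exact: rcont_integrable. Qed.

Lemma segintZ a b f c : rcont_on a b f ->
  segint a b (fun x => c * f x) = c * segint a b f.
Proof. by move=> Hf; rewrite /segint RintegralZl//; exact: rcont_integrable. Qed.

Lemma segint_le a b f g : rcont_on a b f -> rcont_on a b g ->
  (forall x, a <= x <= b -> f x <= g x) -> segint a b f <= segint a b g.
Proof.
move=> /rcont_integrable Hf /rcont_integrable Hg fg; exact: le_Rintegral.
Qed.

Lemma segint_eq a b f g : (forall x, a <= x <= b -> f x = g x) ->
  segint a b f = segint a b g.
Proof. by move=> fg; apply: eq_Rintegral => x; rewrite inE/= in_itv/= => /fg. Qed.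

Lemma rcont_cst a b c : rcont_on a b (fun=> c).
Proof. by move=> x _; exact: cvg_cst. Qed.

Lemma segint_norm a b f : rcont_on a b f ->
  `|segint a b f| <= segint a b (fun x => `|f x|).
Proof. by move=> H; apply: le_normr_Rintegral => //; exact: rcont_integrable. Qed.

Definition ucont_on a b u := forall x, a <= x <= b -> forall e : R, 0 < e ->
  exists2 d : R, 0 < d & forall y, `|y - x| < d -> cabs (u y - u x) < e.

Definition csegint a b u : R[i] :=
  segint a b (fun x => Re (u x)) +i* segint a b (fun x => Im (u x)).

Lemma ucont_part (phi : R[i] -> R) a b u :
  (forall z w, `|phi z - phi w| <= cabs (z - w)) ->
  ucont_on a b u -> rcont_on a b (fun x => phi (u x)).
Proof.
move=> phiP H x /H{}H; apply/cvgrPdist_lt => e /H[d d0 Hd].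
apply/nbhs_ballP; exists d => //= y; rewrite /ball/= distrC => /Hd h.
by rewrite distrC (le_lt_trans (phiP _ _)).
Qed.

Lemma ucont_Re a b u : ucont_on a b u -> rcont_on a b (fun x => Re (u x)).
Proof. by apply: ucont_part => z w; rewrite -cReB Re_le_cabs. Qed.

Lemma ucont_Im a b u : ucont_on a b u -> rcont_on a b (fun x => Im (u x)).
Proof. by apply: ucont_part => z w; rewrite -cImB Im_le_cabs. Qed.

Lemma ucont_cabs a b u : ucont_on a b u -> rcont_on a b (fun x => cabs (u x)).
Proof.
apply: ucont_part => z w; rewrite ler_norml lerNl opprB.
by rewrite !cabsBD (cabsC z w) cabsBD.
Qed.

Lemma csegint_split a b c u : a <= c -> c <= b -> ucont_on a b u ->
  csegint a b u = csegint a c u + csegint c b u.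
Proof.
move=> ac cb H; apply: complexP; rewrite ?cReD ?cImD /=; apply: segint_split => //.
  exact: ucont_Re. exact: ucont_Im.
Qed.

Lemma csegintD a b u v : ucont_on a b u -> ucont_on a b v ->
  csegint a b (fun x => u x + v x) = csegint a b u + csegint a b v.
Proof.
move=> Hu Hv; apply: complexP; rewrite ?cReD ?cImD /=.
  rewrite -segintD; [|exact: ucont_Re..].
  by apply: segint_eq => x _; rewrite cReD.
rewrite -segintD; [|exact: ucont_Im..].
by apply: segint_eq => x _; rewrite cImD.
Qed.

Lemma rcontZ a b c f : rcont_on a b f -> rcont_on a b (fun x => c * f x).
Proof. by move=> H x /H; exact: cvgMr. Qed.

Lemma csegintZ a b (c : R[i]) u : ucont_on a b u ->
  csegint a b (fun x => c * u x) = c * csegint a b u.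
Proof.
move=> Hu; have [Hr Hi] := (ucont_Re Hu, ucont_Im Hu).
apply: complexP; rewrite ?cReM ?cImM /=.
  under [LHS]segint_eq do rewrite cReM -mulNr.
  by rewrite segintD ?segintZ ?mulNr//; exact: rcontZ.
under [LHS]segint_eq do rewrite cImM.
by rewrite segintD ?segintZ//; exact: rcontZ.
Qed.

Lemma csegint_cst a b (c : R[i]) : a <= b ->
  csegint a b (fun=> c) = c * (b - a)%:C.
Proof.
move=> ab; apply: complexP; rewrite ?cReM ?cImM /= segint_cst//; ring.
Qed.

Lemma csegint_eq a b u v : (forall x, a <= x <= b -> u x = v x) ->
  csegint a b u = csegint a b v.
Proof.
by move=> uv; rewrite /csegint; congr (_ +i* _);
   apply: segint_eq => x /uv ->.
Qed.

(** The factor 2 comes from estimating the real and the imaginary part separately. *)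
Lemma csegint_norm a b u : ucont_on a b u ->
  cabs (csegint a b u) <= 2 * segint a b (fun x => cabs (u x)).
Proof.
move=> Hu; rewrite (le_trans (cabs_le_ReIm _))//= mulr_natl mulr2n.
have [Hr Hi] := (ucont_Re Hu, ucont_Im Hu); have Hc := ucont_cabs Hu.
have normc f : rcont_on a b f -> rcont_on a b (fun x => `|f x|).
  by move=> H x /H; exact: cvg_norm.
apply: lerD; apply: (le_trans (segint_norm _)) => //; apply: segint_le => //.
- exact: normc.
- by move=> x _; exact: Re_le_cabs.
- exact: normc.
- by move=> x _; exact: Im_le_cabs.
Qed.

Lemma csegint_bound a b u (M : R) : a <= b -> ucont_on a b u ->
  (forall x, a <= x <= b -> cabs (u x) <= M) ->
  cabs (csegint a b u) <= 2 * (M * (b - a)).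
Proof.
move=> ab Hu HM; rewrite (le_trans (csegint_norm Hu))// ler_pM2l//.
rewrite -segint_cst//; apply: segint_le => //; first exact: ucont_cabs.
exact: rcont_cst.
Qed.

End SegmentIntegral.

(** * Boundary integrals of rectangles *)

Section Goursat.
Variable R : realType.
Implicit Types (f g : R[i] -> R[i]) (x y : R).

Definition hsection f y := fun x : R => f (x +i* y).
Definition vsection f x := fun y : R => f (x +i* y).

Definition in_rect x1 x2 y1 y2 (z : R[i]) :=
  (x1 <= Re z <= x2) && (y1 <= Im z <= y2).

Definition ccont_rect f x1 x2 y1 y2 :=
  forall z, in_rect x1 x2 y1 y2 z -> ccont f z.

Lemma hsection_ucont f x1 x2 y :
  (forall x, x1 <= x <= x2 -> ccont f (x +i* y)) -> ucont_on x1 x2 (hsection f y).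
Proof.
move=> H x /H fc e /fc[d d0 Hd]; exists d => // t tx; apply: Hd.
have -> : t +i* y - x +i* y = (t - x)%:C.
  by apply: complexP => //=; rewrite subrr.
by rewrite cabsR.
Qed.

Lemma vsection_ucont f x y1 y2 :
  (forall y, y1 <= y <= y2 -> ccont f (x +i* y)) -> ucont_on y1 y2 (vsection f x).
Proof.
move=> H y /H fc e /fc[d d0 Hd]; exists d => // t ty; apply: Hd.
rewrite (le_lt_trans (cabs_le_ReIm _))//= subrr normr0 add0r//.
Qed.

(** The counterclockwise contour integral, each pair of opposite sides being merged into a single
    integral. *)
Definition rectint f x1 x2 y1 y2 : R[i] :=
  csegint x1 x2 (fun x => hsection f y1 x - hsection f y2 x) +
  'i%C * csegint y1 y2 (fun y => vsection f x2 y - vsection f x1 y).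

Lemma ucontN a b (u : R -> R[i]) : ucont_on a b u -> ucont_on a b (fun x => - u x).
Proof.
by move=> H x /H{}H e /H[d d0 Hd]; exists d => // y /Hd; rewrite -opprD cabsN.
Qed.

Lemma ucontD a b (u v : R -> R[i]) : ucont_on a b u -> ucont_on a b v ->
  ucont_on a b (fun x => u x + v x).
Proof.
move=> Hu Hv x xab e e0; have e2 : 0 < e / 2 by rewrite divr_gt0.
have [d d0 Hd] := Hu _ xab _ e2; have [d' d0' Hd'] := Hv _ xab _ e2.
exists (Num.min d d'); first by rewrite lt_min d0.
move=> w; rewrite lt_min => /andP[/Hd ? /Hd' ?]; rewrite opprD addrACA.
by apply: (le_lt_trans (cabsD _ _)); lra.
Qed.

Lemma ucontB a b (u v : R -> R[i]) : ucont_on a b u -> ucont_on a b v ->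
  ucont_on a b (fun x => u x - v x).
Proof. by move=> Hu Hv; apply: ucontD => //; exact: ucontN. Qed.

Definition hcont_rect f x1 x2 y1 y2 :=
  [/\ ucont_on x1 x2 (hsection f y1), ucont_on x1 x2 (hsection f y2),
      ucont_on y1 y2 (vsection f x1) & ucont_on y1 y2 (vsection f x2)].

Let side_congr (a a' b b' : R[i]) : a = a' -> b = b' ->
  a + 'i%C * b = a' + 'i%C * b'.
Proof. by move=> -> ->. Qed.

Lemma rectintD f g x1 x2 y1 y2 :
  hcont_rect f x1 x2 y1 y2 -> hcont_rect g x1 x2 y1 y2 ->
  rectint (fun z => f z + g z) x1 x2 y1 y2 =
  rectint f x1 x2 y1 y2 + rectint g x1 x2 y1 y2.
Proof.
move=> [f1 f2 f3 f4] [g1 g2 g3 g4]; rewrite /rectint addrACA -mulrDr.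
rewrite -!csegintD; try exact: ucontB.
by apply: side_congr; apply: csegint_eq => t _; rewrite /hsection /vsection; ring.
Qed.

Lemma rectintZ f (c : R[i]) x1 x2 y1 y2 : hcont_rect f x1 x2 y1 y2 ->
  rectint (fun z => c * f z) x1 x2 y1 y2 = c * rectint f x1 x2 y1 y2.
Proof.
move=> [f1 f2 f3 f4]; rewrite /rectint mulrDr [c * ('i%C * _)]mulrCA.
rewrite -(csegintZ c (ucontB f1 f2)) -(csegintZ c (ucontB f4 f3)).
by apply: side_congr; apply: csegint_eq => t _; rewrite /hsection /vsection mulrBr.
Qed.

Definition rect_bnd x1 x2 y1 y2 (z : R[i]) := in_rect x1 x2 y1 y2 z &&
  [|| Re z == x1, Re z == x2, Im z == y1 | Im z == y2].

Lemma rect_bndW x1 x2 y1 y2 z : rect_bnd x1 x2 y1 y2 z -> in_rect x1 x2 y1 y2 z.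
Proof. by case/andP. Qed.

Lemma rect_bnd_sides (P : R[i] -> Prop) x1 x2 y1 y2 : x1 <= x2 -> y1 <= y2 ->
  (forall z, rect_bnd x1 x2 y1 y2 z -> P z) ->
  [/\ forall x, x1 <= x <= x2 -> P (x +i* y1),
      forall x, x1 <= x <= x2 -> P (x +i* y2),
      forall y, y1 <= y <= y2 -> P (x1 +i* y) &
      forall y, y1 <= y <= y2 -> P (x2 +i* y)].
Proof.
move=> x12 y12 H; split=> t tt; apply: H; rewrite /rect_bnd /in_rect/=;
  by rewrite tt ?lexx ?x12 ?y12/= eqxx ?orbT.
Qed.

Lemma ccont_bnd f x1 x2 y1 y2 : x1 <= x2 -> y1 <= y2 ->
  (forall z, rect_bnd x1 x2 y1 y2 z -> ccont f z) -> hcont_rect f x1 x2 y1 y2.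
Proof.
move=> x12 y12 /(rect_bnd_sides x12 y12)[h1 h2 h3 h4].
by split; [exact: hsection_ucont..|exact: vsection_ucont|exact: vsection_ucont].
Qed.

Lemma ccont_rect_bnd f x1 x2 y1 y2 : x1 <= x2 -> y1 <= y2 ->
  ccont_rect f x1 x2 y1 y2 -> hcont_rect f x1 x2 y1 y2.
Proof. by move=> x12 y12 H; apply: ccont_bnd => // z /rect_bndW; exact: H. Qed.

Lemma rectint_eq f g x1 x2 y1 y2 : x1 <= x2 -> y1 <= y2 ->
  (forall z, rect_bnd x1 x2 y1 y2 z -> f z = g z) ->
  rectint f x1 x2 y1 y2 = rectint g x1 x2 y1 y2.
Proof.
move=> x12 y12 /(rect_bnd_sides x12 y12)[h1 h2 h3 h4].
by rewrite /rectint; apply: side_congr;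
  apply: csegint_eq => t tt; rewrite /hsection /vsection ?h1 ?h2 ?h3 ?h4.
Qed.

(** Both merged integrands are constant: [d] times [- i] times the height, and [d] times the width.
    Their contributions cancel. *)
Lemma rectint_affine (c d : R[i]) x1 x2 y1 y2 : x1 <= x2 -> y1 <= y2 ->
  rectint (fun z => c + d * z) x1 x2 y1 y2 = 0.
Proof.
move=> x12 y12.
transitivity (csegint x1 x2 (fun=> d * (0 +i* (y1 - y2))) +
              'i%C * csegint y1 y2 (fun=> d * (x2 - x1)%:C)).
  apply: side_congr; apply: csegint_eq => t _; rewrite /hsection /vsection;
    rewrite opprD addrACA subrr add0r -mulrBr; congr (_ * _);
    by apply: complexP => /=; rewrite ?subrr.
rewrite !csegint_cst// mulrCA -!mulrA -mulrDr; apply/eqP; rewrite mulf_eq0.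
apply/orP; right; apply/eqP; apply: complexP; rewrite ?(cReM, cImM, cReD, cImD) /=; ring.
Qed.

Lemma rectint_bound f x1 x2 y1 y2 (M : R) : x1 <= x2 -> y1 <= y2 ->
  hcont_rect f x1 x2 y1 y2 ->
  (forall z, rect_bnd x1 x2 y1 y2 z -> cabs (f z) <= M) ->
  cabs (rectint f x1 x2 y1 y2) <= 4 * M * ((x2 - x1) + (y2 - y1)).
Proof.
move=> x12 y12 [f1 f2 f3 f4] /(rect_bnd_sides x12 y12)[h1 h2 h3 h4].
rewrite /rectint (le_trans (cabsD _ _))//.
rewrite mulrDr cabsM cabs_i mul1r; apply: lerD.
  have -> : 4 * M * (x2 - x1) = 2 * ((M + M) * (x2 - x1)) by ring.
  apply: csegint_bound => //; first exact: ucontB.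
  by move=> x xx; rewrite (le_trans (cabsB _ _))// lerD// ?h1 ?h2.
have -> : 4 * M * (y2 - y1) = 2 * ((M + M) * (y2 - y1)) by ring.
apply: csegint_bound => //; first exact: ucontB.
by move=> x xx; rewrite (le_trans (cabsB _ _))// lerD// ?h3 ?h4.
Qed.

Lemma rectint_vsplit f x1 x x2 y1 y2 : x1 <= x -> x <= x2 ->
  hcont_rect f x1 x2 y1 y2 -> ucont_on y1 y2 (vsection f x) ->
  rectint f x1 x2 y1 y2 = rectint f x1 x y1 y2 + rectint f x x2 y1 y2.
Proof.
move=> h1 h2 [f1 f2 f3 f4] fx.
rewrite /rectint (csegint_split h1 h2); last exact: ucontB.
rewrite addrACA -mulrDr -csegintD; [|exact: ucontB..].
by apply: side_congr => //; apply: csegint_eq => t _; ring.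
Qed.

Lemma rectint_hsplit f x1 x2 y1 y y2 : y1 <= y -> y <= y2 ->
  hcont_rect f x1 x2 y1 y2 -> ucont_on x1 x2 (hsection f y) ->
  rectint f x1 x2 y1 y2 = rectint f x1 x2 y1 y + rectint f x1 x2 y y2.
Proof.
move=> h1 h2 [f1 f2 f3 f4] fx.
rewrite /rectint (csegint_split h1 h2); last exact: ucontB.
rewrite addrACA -mulrDr -csegintD; [|exact: ucontB..].
by apply: side_congr => //; apply: csegint_eq => t _; ring.
Qed.

End Goursat.

(** * Goursat's theorem by bisection *)

Section GoursatTheorem.
Variable R : realType.
Implicit Types (f g : R[i] -> R[i]) (x y w h : R).

Lemma expn_gt_real (x b : R) : 1 < b -> exists n, x < b ^+ n.
Proof.
move=> b1; have d0 : 0 < b - 1 by lra.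
have H n : 1 + n%:R * (b - 1) <= b ^+ n.
  elim: n => [|n IH]; first by rewrite mul0r addr0 expr0.
  rewrite exprS -natr1.
  have : 0 <= n%:R * (b - 1) by rewrite mulr_ge0// ltW.
  have : 0 <= (b - 1) * (n%:R * (b - 1)) by rewrite !mulr_ge0// ltW.
  set u := n%:R * (b - 1) in IH *; move=> *.
  have -> : 1 + (n%:R + 1) * (b - 1) = u + b by rewrite /u; ring.
  nra.
exists (Num.bound (`|x| / (b - 1))).
rewrite (lt_le_trans _ (H _))//.
have := archi_boundP (divr_ge0 (normr_ge0 x) (ltW d0)).
by rewrite ltr_pdivrMr// => h; have := ler_norm x; lra.
Qed.

Lemma in_rect_sub x1 x2 y1 y2 a1 a2 b1 b2 (z : R[i]) : a1 <= x1 -> x2 <= a2 ->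
  b1 <= y1 -> y2 <= b2 -> in_rect x1 x2 y1 y2 z -> in_rect a1 a2 b1 b2 z.
Proof. by rewrite /in_rect => ? ? ? ? /andP[/andP[? ?] /andP[? ?]]; lra. Qed.

Lemma rectint_quarter f x y w h : 0 <= w -> 0 <= h ->
  ccont_rect f x (x + w) y (y + h) ->
  exists x' y', [/\ x <= x' <= x + w / 2, y <= y' <= y + h / 2 &
    cabs (rectint f x (x + w) y (y + h)) <=
    4 * cabs (rectint f x' (x' + w / 2) y' (y' + h / 2))].
Proof.
move=> w0 h0 Hf.
have sub a1 a2 b1 b2 : x <= a1 -> a1 <= a2 -> a2 <= x + w -> y <= b1 ->
    b1 <= b2 -> b2 <= y + h -> hcont_rect f a1 a2 b1 b2.
  move=> *; apply: ccont_rect_bnd => // z Hz; apply: Hf.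
  by apply: in_rect_sub Hz.
have subv a b1 b2 : x <= a <= x + w -> y <= b1 -> b2 <= y + h ->
    ucont_on b1 b2 (vsection f a).
  move=> ? ? ?; apply: vsection_ucont => t /andP[? ?]; apply: Hf.
  by rewrite /in_rect/=; lra.
have subh b a1 a2 : y <= b <= y + h -> x <= a1 -> a2 <= x + w ->
    ucont_on a1 a2 (hsection f b).
  move=> ? ? ?; apply: hsection_ucont => t /andP[? ?]; apply: Hf.
  by rewrite /in_rect/=; lra.
have e1 : x + w = (x + w / 2) + w / 2 by field.
have e2 : y + h = (y + h / 2) + h / 2 by field.
pose I a b := rectint f a (a + w / 2) b (b + h / 2).
have E : rectint f x (x + w) y (y + h) =
    I x y + I x (y + h / 2) + (I (x + w / 2) y + I (x + w / 2) (y + h / 2)).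
  rewrite (@rectint_vsplit _ _ _ (x + w / 2));
    [|lra|lra|by apply: sub; lra|by apply: subv; lra].
  rewrite (@rectint_hsplit _ _ _ _ _ (y + h / 2));
    [|lra|lra|by apply: sub; lra|by apply: subh; lra].
  rewrite (@rectint_hsplit _ _ (x + w / 2) _ _ (y + h / 2));
    [|lra|lra|by apply: sub; lra|by apply: subh; lra].
  by rewrite /I -e1 -e2.
have : cabs (rectint f x (x + w) y (y + h)) <=
    cabs (I x y) + cabs (I x (y + h / 2)) +
    (cabs (I (x + w / 2) y) + cabs (I (x + w / 2) (y + h / 2))).
  by rewrite E (le_trans (cabsD _ _))// lerD// cabsD.
set J := cabs (rectint f x (x + w) y (y + h)).
set a1 := cabs (I x y); set a2 := cabs (I x (y + h / 2)).
set a3 := cabs (I (x + w / 2) y); set a4 := cabs (I (x + w / 2) (y + h / 2)) => HJ.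
have [h1|h1] := lerP J (4 * a1); first by exists x, y; split => // {h1 HJ}; lra.
have [h2|h2] := lerP J (4 * a2).
  by exists x, (y + h / 2); split => // {h1 h2 HJ}; lra.
have [h3|h3] := lerP J (4 * a3).
  by exists (x + w / 2), y; split => // {h1 h2 h3 HJ}; lra.
have h4 : J <= 4 * a4 by move: HJ h1 h2 h3; move: J a1 a2 a3 a4 => *; lra.
by exists (x + w / 2), (y + h / 2); split => // {h1 h2 h3 h4 HJ}; lra.
Qed.

Let nested_limit (u : nat -> R) (w : R) : 0 <= w ->
  (forall n, u n <= u n.+1 <= u n + w / 2 ^+ n / 2) ->
  exists l, forall n, u n <= l <= u n + w / 2 ^+ n.
Proof.
move=> w0 Hu.
have up n k : u n <= u (n + k)%N /\ u (n + k)%N + w / 2 ^+ (n + k) <= u n + w / 2 ^+ n.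
  elim: k => [|k [IH1 IH2]]; first by rewrite addn0.
  rewrite addnS; have /andP[h1 h2] := Hu (n + k)%N; split; first exact: le_trans h1.
  have -> : w / 2 ^+ (n + k).+1 = w / 2 ^+ (n + k) / 2.
    by rewrite exprSr invfM mulrA.
  lra.
have pos n : 0 <= w / 2 ^+ n by rewrite divr_ge0// exprn_ge0.
have bnd n m : u m <= u n + w / 2 ^+ n.
  have [/subnKC <-|/ltnW/subnKC <-] := leqP n m.
    by have [_ h] := up n (m - n)%N; have := pos (n + (m - n))%N; lra.
  by have [h _] := up m (n - m)%N; have := pos (m + (n - m))%N; lra.
exists (sup (range u)) => n; apply/andP; split.
  apply: ub_le_sup; last by exists n.
  by exists (u 0%N + w / 2 ^+ 0) => _ [m _ <-].
apply: ge_sup; first by exists (u 0%N), 0%N.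
by move=> _ [m _ <-].
Qed.

Theorem goursat f x1 x2 y1 y2 : x1 <= x2 -> y1 <= y2 ->
  (forall z, in_rect x1 x2 y1 y2 z -> cderivable f z) ->
  rectint f x1 x2 y1 y2 = 0.
Proof.
move=> x12 y12 Hd; pose w := x2 - x1; pose h := y2 - y1.
have w0 : 0 <= w by rewrite subr_ge0.
have h0 : 0 <= h by rewrite subr_ge0.
have wE : x2 = x1 + w by rewrite /w; ring.
have hE : y2 = y1 + h by rewrite /h; ring.
pose I (n : nat) (p : R * R) :=
  rectint f p.1 (p.1 + w / 2 ^+ n) p.2 (p.2 + h / 2 ^+ n).
pose good n (p q : R * R) := [/\ p.1 <= q.1 <= p.1 + w / 2 ^+ n / 2,
  p.2 <= q.2 <= p.2 + h / 2 ^+ n / 2 & cabs (I n p) <= 4 * cabs (I n.+1 q)].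
(* The corners of the chosen quarters. The default of [xget] is never taken: [inv] keeps every
   rectangle inside the original one, so that a good quarter exists. *)
pose fix P n : R * R := if n is m.+1 then xget (0, 0) [set q | good m (P m) q]
  else (x1, y1).
have pos (v : R) n : 0 <= v -> 0 <= v / 2 ^+ n by move=> ?; rewrite divr_ge0// exprn_ge0.
have halve (v : R) n : v / 2 ^+ n.+1 = v / 2 ^+ n / 2 by rewrite exprSr invfM mulrA.
have step n : x1 <= (P n).1 -> (P n).1 + w / 2 ^+ n <= x2 ->
    y1 <= (P n).2 -> (P n).2 + h / 2 ^+ n <= y2 -> good n (P n) (P n.+1).
  move=> a1 a2 b1 b2.
  have [|x' [y' [H1 H2 H3]]] :=
      @rectint_quarter f (P n).1 (P n).2 _ _ (pos w n w0) (pos h n h0).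
    move=> z Hz; apply/cderivable_ccont/Hd; exact: in_rect_sub Hz.
  have G : good n (P n) (x', y') by split => //; rewrite /I /= !halve.
  exact: (@xgetPex (R * R)%type (0, 0) [set q | good n (P n) q]
    (ex_intro _ (x', y') G)).
have inv n : [/\ x1 <= (P n).1, (P n).1 + w / 2 ^+ n <= x2,
    y1 <= (P n).2 & (P n).2 + h / 2 ^+ n <= y2].
  elim: n => [|n [a1 a2 b1 b2]].
    by rewrite expr0 !divr1 /= -wE -hE !lexx.
  have [/andP[c1 c2] /andP[d1 d2] _] := step _ a1 a2 b1 b2.
  rewrite !halve; split; try lra.
have {}step n : good n (P n) (P n.+1) by have [? ? ? ?] := inv n; exact: step.
have [X HX] := @nested_limit (fun n => (P n).1) w w0 (fun n => let: And3 a _ _ := step n in a).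
have [Y HY] := @nested_limit (fun n => (P n).2) h h0 (fun n => let: And3 _ a _ := step n in a).
have grow n : cabs (I 0%N (P 0%N)) <= 4 ^+ n * cabs (I n (P n)).
  elim: n => [|n IH]; first by rewrite expr0 mul1r.
  rewrite (le_trans IH)// exprSr -mulrA ler_pM2l ?exprn_gt0//.
  by have [] := step n.
have -> : rectint f x1 x2 y1 y2 = I 0%N (P 0%N) by rewrite /I /= expr0 !divr1 -wE -hE.
have [a Ha] : cderivable f (X +i* Y).
  apply: Hd; rewrite /in_rect/=.
  have := HX 0%N; have := HY 0%N; rewrite /= expr0 !divr1 -wE -hE => -> ->//.
apply/eqP; rewrite -cabs_eq0 eq_le cabs_ge0 andbT.
set D := w + h; have D0 : 0 <= D by rewrite addr_ge0.
apply/ler_addgt0Pl => e e0; rewrite addr0.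
(* The error is [e / k] times a distance at most [D / 2 ^+ n], integrated over sides of total order
   [D / 2 ^+ n]; the factor [4 ^+ n] restores [e * (4 * D * D / k)], and [k] makes this at most
   [e]. *)
pose k := 4 * (1 + D * D).
have k0 : 0 < k by rewrite /k; nra.
have [d d0 Hd'] := Ha _ (divr_gt0 e0 k0).
have [n Hn] : exists n, D / d < 2 ^+ n by apply: expn_gt_real; rewrite ltr1n.
rewrite (le_trans (grow n))//.
have q0 : 0 < (2 ^+ n : R) by rewrite exprn_gt0.
have [i1 i2 i3 i4] := inv n.
(* Subtracting the first-order expansion at the limit point leaves the integral unchanged, since
   affine functions integrate to zero. *)
pose c0 := f (X +i* Y) - a * (X +i* Y).
have IE : I n (P n) = rectint (fun z => f z - (c0 + a * z))
    (P n).1 ((P n).1 + w / 2 ^+ n) (P n).2 ((P n).2 + h / 2 ^+ n).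
  have wn := pos w n w0; have hn := pos h n h0.
  rewrite /I -[LHS]subr0.
  rewrite -(@rectint_affine _ c0 a (P n).1 ((P n).1 + w / 2 ^+ n) (P n).2
     ((P n).2 + h / 2 ^+ n)) ?lerDl//.
  have caff z : ccont (fun z => c0 + a * z) z.
    apply: ccontD; first exact: ccont_cst.
    by apply: ccontM; [exact: ccont_cst|exact: ccont_id].
  have fc : hcont_rect f (P n).1 ((P n).1 + w / 2 ^+ n) (P n).2 ((P n).2 + h / 2 ^+ n).
    apply: ccont_rect_bnd; rewrite ?lerDl// => z Hz; apply/cderivable_ccont/Hd.
    exact: in_rect_sub Hz.
  apply/eqP; rewrite subr_eq -rectintD//.
  - by apply/eqP; apply: rectint_eq; rewrite ?lerDl// => z _; rewrite subrK.
  - apply: ccont_rect_bnd; rewrite ?lerDl// => z Hz; apply: ccontB => //.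
    by apply/cderivable_ccont/Hd; exact: in_rect_sub Hz.
  - by apply: ccont_rect_bnd; rewrite ?lerDl.
rewrite IE.
have DnE : w / 2 ^+ n + h / 2 ^+ n = D / 2 ^+ n by rewrite -mulrDl.
have /(_ (e / k * (D / 2 ^+ n))) := @rectint_bound R (fun z => f z - (c0 + a * z))
    (P n).1 ((P n).1 + w / 2 ^+ n) (P n).2 ((P n).2 + h / 2 ^+ n).
have wn := pos w n w0; have hn := pos h n h0.
rewrite !lerDl => /(_ wn hn) B.
have {}B := B _ _; rewrite ![_ + _ / _ - _]addrAC !subrr !add0r DnE in B.
have : cabs (rectint (fun z => f z - (c0 + a * z)) (P n).1 ((P n).1 + w / 2 ^+ n)
    (P n).2 ((P n).2 + h / 2 ^+ n)) <= 4 * (e / k * (D / 2 ^+ n)) * (D / 2 ^+ n).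
  apply: B.
    apply: ccont_rect_bnd; rewrite ?lerDl// => z Hz; apply: ccontB.
      by apply/cderivable_ccont/Hd; exact: in_rect_sub Hz.
    apply: ccontD; first exact: ccont_cst.
    by apply: ccontM; [exact: ccont_cst|exact: ccont_id].
  move=> z /rect_bndW/andP[/andP[z1 z2] /andP[z3 z4]].
  have zn : cabs (z - (X +i* Y)) <= D / 2 ^+ n.
    rewrite (le_trans (cabs_le_ReIm _))// cReB cImB /= -DnE.
    have /andP[? ?] := HX n; have /andP[? ?] := HY n.
    by rewrite lerD// ler_norml; apply/andP; split; lra.
  have zd : cabs (z - (X +i* Y)) < d.
    by rewrite (le_lt_trans zn)// ltr_pdivrMr// mulrC -ltr_pdivrMr.
  have := Hd' _ zd; rewrite subrKC => Hz.
  have -> : f z - (c0 + a * z) = f z - f (X +i* Y) - a * (z - X +i* Y).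
    by rewrite /c0; ring.
  by rewrite (le_trans Hz)// ler_pM2l// divr_gt0.
move=> H; rewrite (le_trans (ler_wpM2l _ H)) ?exprn_ge0//.
have -> : 4 ^+ n = 2 ^+ n * 2 ^+ n :> R by rewrite -exprMn; congr (_ ^+ _); ring.
have -> : 2 ^+ n * 2 ^+ n * (4 * (e / k * (D / 2 ^+ n)) * (D / 2 ^+ n)) =
    e * (4 * D * D / k).
  by field; rewrite !gt_eqF.
by rewrite -[leRHS]mulr1 ler_pM2l// ler_pdivrMr// /k; nra.
Qed.

End GoursatTheorem.

(** * Cauchy's formula on rectangles *)

Section CauchyFormula.
Variable R : realType.
Implicit Types (f g : R[i] -> R[i]) (x y : R) (z w s : R[i]).

Lemma rectint_thinx f x y1 y2 : y1 <= y2 -> rectint f x x y1 y2 = 0.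
Proof.
move=> y12; rewrite /rectint /csegint /segint set_itv1 !Rintegral_set1.
under eq_Rintegral do rewrite subrr /=.
rewrite (_ : Rintegral _ _ _ = 0); last first.
  by rewrite -[LHS]/(segint _ _ (fun=> 0)) segint_cst// mul0r.
under eq_Rintegral do rewrite subrr /=.
rewrite (_ : Rintegral _ _ _ = 0); last first.
  by rewrite -[LHS]/(segint _ _ (fun=> 0)) segint_cst// mul0r.
by apply: complexP; rewrite /= ?(mulr0, mul0r, subrr, addr0).
Qed.

Lemma rectint_thiny f x1 x2 y : x1 <= x2 -> rectint f x1 x2 y y = 0.
Proof.
move=> x12; rewrite /rectint /csegint /segint set_itv1 !Rintegral_set1.
under eq_Rintegral do rewrite subrr /=.
rewrite (_ : Rintegral _ _ _ = 0); last first.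
  by rewrite -[LHS]/(segint _ _ (fun=> 0)) segint_cst// mul0r.
under eq_Rintegral do rewrite subrr /=.
rewrite (_ : Rintegral _ _ _ = 0); last first.
  by rewrite -[LHS]/(segint _ _ (fun=> 0)) segint_cst// mul0r.
by apply: complexP; rewrite /= ?(mulr0, mul0r, subrr, addr0).
Qed.

Let subrect_cont f x1 x2 y1 y2 p p' q q' : ccont_rect f x1 x2 y1 y2 ->
  x1 <= p -> p <= p' -> p' <= x2 -> y1 <= q -> q <= q' -> q' <= y2 ->
  hcont_rect f p p' q q'.
Proof.
move=> fc *; apply: ccont_rect_bnd => // z Hz; apply: fc; exact: in_rect_sub Hz.
Qed.

Let subv_cont f x1 x2 y1 y2 p q q' : ccont_rect f x1 x2 y1 y2 ->
  x1 <= p -> p <= x2 -> y1 <= q -> q' <= y2 -> ucont_on q q' (vsection f p).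
Proof.
move=> fc h1 h2 h3 h4; apply: vsection_ucont => t /andP[t1 t2]; apply: fc.
by rewrite /in_rect/= h1 h2 (le_trans h3 t1) (le_trans t2 h4).
Qed.

Let subh_cont f x1 x2 y1 y2 q p p' : ccont_rect f x1 x2 y1 y2 ->
  y1 <= q -> q <= y2 -> x1 <= p -> p' <= x2 -> ucont_on p p' (hsection f q).
Proof.
move=> fc h1 h2 h3 h4; apply: hsection_ucont => t /andP[t1 t2]; apply: fc.
by rewrite /in_rect/= h1 h2 (le_trans h3 t1) (le_trans t2 h4).
Qed.

(** The rectangle is cut into a left and a right strip of full height, a lower and an upper piece
    between them, and the middle; only the middle contributes. *)
Let rectint_grid f x1 x2 y1 y2 a1 a2 b1 b2 : ccont_rect f x1 x2 y1 y2 ->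
  x1 <= a1 -> a1 <= a2 -> a2 <= x2 -> y1 <= b1 -> b1 <= b2 -> b2 <= y2 ->
  rectint f x1 a1 y1 y2 = 0 -> rectint f a2 x2 y1 y2 = 0 ->
  rectint f a1 a2 y1 b1 = 0 -> rectint f a1 a2 b2 y2 = 0 ->
  rectint f x1 x2 y1 y2 = rectint f a1 a2 b1 b2.
Proof.
move=> fc h1 h2 h3 h4 h5 h6 e1 e2 e3 e4.
have hx := le_trans h2 h3; have hy := le_trans h5 h6.
have hx1 := le_trans h1 h2; have hy1 := le_trans h4 h5.
have x12 := le_trans h1 hx; have y12 := le_trans h4 hy.
rewrite (@rectint_vsplit _ f x1 a1 x2) //; first last.
- exact: (subv_cont fc).
- exact: (subrect_cont fc).
rewrite (@rectint_vsplit _ f a1 a2 x2) //; first last.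
- exact: (subv_cont fc).
- exact: (subrect_cont fc).
rewrite (@rectint_hsplit _ f a1 a2 y1 b1 y2) //; first last.
- exact: (subh_cont fc).
- exact: (subrect_cont fc).
rewrite (@rectint_hsplit _ f a1 a2 b1 b2 y2) //; first last.
- exact: (subh_cont fc).
- exact: (subrect_cont fc).
by rewrite e1 e2 e3 e4 !(add0r, addr0).
Qed.

(** The small square is clipped at the sides of the big rectangle. In that case the adjacent strip
    is degenerate; otherwise the strip misses [s]. This is the final alternative. *)
Let cut_left (a s r : R) : a <= s -> 0 < r ->
  exists c, [/\ a <= c, c <= s, s - r <= c & c = a \/ c < s].
Proof.
move=> h r0; have [h1|h1] := lerP (s - r) a.
  by exists a; split => //; left.
by exists (s - r); split; [lra|lra|lra|right; lra].
Qed.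

Let cut_right (s b r : R) : s <= b -> 0 < r ->
  exists c, [/\ s <= c, c <= b, c <= s + r & c = b \/ s < c].
Proof.
move=> h r0; have [h1|h1] := lerP b (s + r).
  by exists b; split => //; left.
by exists (s + r); split; [lra|lra|lra|right; lra].
Qed.

(* An exceptional point is enclosed in a small square, whose boundary integral
   is negligible by continuity. *)
Lemma goursat_exc f (S : seq R[i]) x1 x2 y1 y2 : x1 <= x2 -> y1 <= y2 ->
  ccont_rect f x1 x2 y1 y2 ->
  (forall z, in_rect x1 x2 y1 y2 z -> z \notin S -> cderivable f z) ->
  rectint f x1 x2 y1 y2 = 0.
Proof.
elim: S x1 x2 y1 y2 => [|s S IH] x1 x2 y1 y2 x12 y12 fc fd.
  by apply: goursat => // z /fd; apply.
have zero p p' q q' : x1 <= p -> p <= p' -> p' <= x2 -> y1 <= q -> q <= q' ->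
    q' <= y2 -> ~~ in_rect p p' q q' s -> rectint f p p' q q' = 0.
  move=> h1 h2 h3 h4 h5 h6 sN; apply: IH => // z Hz.
    by apply: fc; exact: in_rect_sub Hz.
  move=> zS; apply: fd; first exact: in_rect_sub Hz.
  by rewrite inE negb_or zS andbT; apply: contraNneq sN => <-.
have [sQ|sN] := boolP (in_rect x1 x2 y1 y2 s); last by apply: zero.
have /andP[/andP[s1 s2] /andP[s3 s4]] := sQ.
have [d d0 Hd] := ccont_bound (fc _ sQ).
set M := cabs (f s) + 1 in Hd; have M0 : 0 < M by rewrite ltr_wpDl ?cabs_ge0.
apply/eqP; rewrite -cabs_eq0 eq_le cabs_ge0 andbT.
apply/ler_addgt0Pl => e e0; rewrite addr0.
(* The quarter of [d] keeps the square in the disc where [cabs (f z) <= M]; its sides have length at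
   most [2 * r], which gives the bound [16 * M * r]. *)
pose r := Num.min (d / 4) (e / (16 * M)).
have r0 : 0 < r by rewrite lt_min !divr_gt0// mulr_gt0.
have rd : r <= d / 4 by rewrite ge_min lexx.
have re : 16 * M * r <= e by rewrite mulrC -ler_pdivlMr ?mulr_gt0// ge_min lexx orbT.
have [a1 [a11 a12 a13 a14]] := cut_left s1 r0.
have [a2 [a21 a22 a23 a24]] := cut_right s2 r0.
have [b1 [b11 b12 b13 b14]] := cut_left s3 r0.
have [b2 [b21 b22 b23 b24]] := cut_right s4 r0.
have a1a2 := le_trans a12 a21; have b1b2 := le_trans b12 b21.
have a1x2 := le_trans a1a2 a22; have b1y2 := le_trans b1b2 b22.
have x1a2 := le_trans a11 a1a2; have y1b2 := le_trans b11 b1b2.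
rewrite (rectint_grid fc a11 a1a2 a22 b11 b1b2 b22).
- have hM z : rect_bnd a1 a2 b1 b2 z -> cabs (f z) <= M.
    move=> /rect_bndW/andP[/andP[z1 z2] /andP[z3 z4]]; apply/ltW/Hd.
    rewrite (le_lt_trans (cabs_le_ReIm _))// cReB cImB.
    have : `|Re z - Re s| <= r.
      by move: z1 z2 a13 a23; clear; rewrite ler_norml => *; apply/andP; split; lra.
    have : `|Im z - Im s| <= r.
      by move: z3 z4 b13 b23; clear; rewrite ler_norml => *; apply/andP; split; lra.
    by move: rd r0; clear; move=> *; lra.
  have := @rectint_bound _ f a1 a2 b1 b2 M a1a2 b1b2
    (subrect_cont fc a11 a1a2 a22 b11 b1b2 b22) hM.
  move/le_trans; apply; move: re M0 a13 a23 b13 b23; clear => *; nra.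
- have [->|h] := a14; first exact: rectint_thinx.
  by apply: zero => //; rewrite /in_rect [Re s <= _]leNgt h andbF.
- have [->|h] := a24; first exact: rectint_thinx.
  by apply: zero => //; rewrite /in_rect leNgt h.
- have [->|h] := b14; first exact: rectint_thiny.
  by apply: zero => //; rewrite /in_rect [Im s <= _]leNgt h !andbF.
- have [->|h] := b24; first exact: rectint_thiny.
  by apply: zero => //; rewrite /in_rect [b2 <= _]leNgt h !andbF.
Qed.

Definition in_rect_by (r : R) x1 x2 y1 y2 w :=
  [&& x1 + r <= Re w, Re w <= x2 - r, y1 + r <= Im w & Im w <= y2 - r].

Lemma rect_bnd_dist (r : R) x1 x2 y1 y2 z w : in_rect_by r x1 x2 y1 y2 w ->
  rect_bnd x1 x2 y1 y2 z -> r <= cabs (z - w).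
Proof.
move=> /and4P[h1 h2 h3 h4] /andP[_ /or4P[]/eqP zE].
- by rewrite (le_trans _ (Re_le_cabs _))// ler_normr cReB; apply/orP; right; lra.
- by rewrite (le_trans _ (Re_le_cabs _))// ler_normr cReB; apply/orP; left; lra.
- by rewrite (le_trans _ (Im_le_cabs _))// ler_normr cImB; apply/orP; right; lra.
- by rewrite (le_trans _ (Im_le_cabs _))// ler_normr cImB; apply/orP; left; lra.
Qed.

Lemma in_rect_by_le (r : R) x1 x2 y1 y2 w : 0 < r -> in_rect_by r x1 x2 y1 y2 w ->
  [/\ x1 <= x2, y1 <= y2 & in_rect x1 x2 y1 y2 w].
Proof. by move=> r0 /and4P[? ? ? ?]; rewrite /in_rect; split; lra. Qed.

Lemma ccont_invsub w z : z != w -> ccont (fun z => (z - w)^-1) z.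
Proof.
move=> zw; apply: ccontV; first by rewrite subr_eq0.
by apply: ccontB; [exact: ccont_id|exact: ccont_cst].
Qed.

(** Classically the number [2 pi i]. Cauchy's formula keeps it as a factor of [f w]; what enters is
    that its modulus is bounded below and that it is differentiable in [w]. *)
Definition rectwind w x1 x2 y1 y2 := rectint (fun z => (z - w)^-1) x1 x2 y1 y2.

Lemma hcont_mul_invsub (r : R) f x1 x2 y1 y2 w : 0 < r ->
  in_rect_by r x1 x2 y1 y2 w ->
  (forall z, rect_bnd x1 x2 y1 y2 z -> ccont f z) ->
  hcont_rect (fun z => f z / (z - w)) x1 x2 y1 y2.
Proof.
move=> r0 wQ fc; have [x12 y12 _] := in_rect_by_le r0 wQ.
apply: ccont_bnd => // z Hz; apply: ccontM; first exact: fc.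
apply: ccont_invsub; rewrite -subr_eq0 -cabs_gt0.
exact: lt_le_trans (rect_bnd_dist wQ Hz).
Qed.

(** The Caratheodory quotient of [f] at [w] is continuous on the rectangle and differentiable off
    [S] and [w], so its boundary integral vanishes by [goursat_exc], with [w] as one more
    exceptional point. *)
Lemma cauchy_exc f (S : seq R[i]) (r : R) x1 x2 y1 y2 w : 0 < r ->
  in_rect_by r x1 x2 y1 y2 w ->
  ccont_rect f x1 x2 y1 y2 ->
  (forall z, in_rect x1 x2 y1 y2 z -> z \notin S -> cderivable f z) ->
  cderivable f w ->
  f w * rectwind w x1 x2 y1 y2 = rectint (fun z => f z / (z - w)) x1 x2 y1 y2.
Proof.
move=> r0 wQ fc fd [a /has_cderiv_caratheodory[q [qw qc fq]]].
have [x12 y12 wR] := in_rect_by_le r0 wQ.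
have qE z : z != w -> q z = (f z - f w) / (z - w).
  by move=> zw; rewrite fq mulfK// subr_eq0.
have bw z : rect_bnd x1 x2 y1 y2 z -> z != w.
  move=> /(rect_bnd_dist wQ) h; rewrite -subr_eq0 -cabs_gt0; exact: lt_le_trans h.
have near (P : (R[i] -> R[i]) -> Prop) z : z != w -> exists2 d : R, 0 < d &
    forall t, cabs (t - z) < d -> (f t - f w) / (t - w) = q t.
  move=> zw; exists (cabs (z - w)); first by rewrite cabs_gt0 subr_eq0.
  move=> t tz; rewrite qE//; apply: contraTneq tz => ->.
  by rewrite cabsC ltxx.
have q0 : rectint q x1 x2 y1 y2 = 0.
  apply: (goursat_exc (S := w :: S)) => // z Hz; last first.
    rewrite inE negb_or => /andP[zw zS].
    have [d d0 Hd] := near (fun=> True) _ zw; apply: (cderivable_near d0 Hd).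
    apply: cderivableM.
      by apply: cderivableB; [exact: fd|exact: cderivable_cst].
    apply: cderivableV; first by rewrite subr_eq0.
    by apply: cderivableB; [exact: cderivable_id|exact: cderivable_cst].
  have [->//|zw] := eqVneq z w.
  have [d d0 Hd] := near (fun=> True) _ zw.
  have : ccont (fun z => (f z - f w) / (z - w)) z.
    apply: ccontM; last exact: ccont_invsub.
    by apply: ccontB; [exact: fc|exact: ccont_cst].
  move=> H e /H[d' d0' Hd']; exists (Num.min d d'); first by rewrite lt_min d0.
  move=> t; rewrite lt_min => /andP[t1 t2]; rewrite -!Hd//; first exact: Hd'.
  by rewrite subrr cabs0.
have fcb z : rect_bnd x1 x2 y1 y2 z -> ccont f z by move=> /rect_bndW/fc.
apply/eqP; rewrite eq_sym -subr_eq0 -q0 /rectwind -mulNr; apply/eqP.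
have hw : hcont_rect (fun z => (z - w)^-1) x1 x2 y1 y2.
  by apply: ccont_bnd => // z /bw; exact: ccont_invsub.
rewrite -rectintZ// -rectintD//; last first.
- apply: ccont_bnd => // z Hz; apply: ccontM; first exact: ccont_cst.
  by apply: ccont_invsub; exact: bw.
- exact: hcont_mul_invsub r0 wQ fcb.
by apply: rectint_eq => // z /bw zw; rewrite qE// mulrBl mulNr.
Qed.

Lemma cinvE (u v : R) : (u +i* v)^-1 =
  (u / (u ^+ 2 + v ^+ 2)) +i* (- v / (u ^+ 2 + v ^+ 2)).
Proof. by apply: complexP => //=; rewrite mulNr. Qed.

(** Every side contributes a positive amount to the imaginary part: the integrand there is
    [u / (u ^+ 2 + v ^+ 2)], where [u >= r] is the distance from [w] to the line of the side. Four
    sides of length at least [2 * r], with integrand at least [r / (2 * L ^+ 2)], give the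
    constant. *)
Lemma rectwind_ge (r L : R) x1 x2 y1 y2 w : 0 < r ->
  in_rect_by r x1 x2 y1 y2 w -> x2 - x1 <= L -> y2 - y1 <= L ->
  4 * r ^+ 2 / L ^+ 2 <= cabs (rectwind w x1 x2 y1 y2).
Proof.
move=> r0 wQ xL yL; have [x12 y12 wR] := in_rect_by_le r0 wQ.
have fcb z : rect_bnd x1 x2 y1 y2 z -> ccont (fun z => (z - w)^-1) z.
  move=> /(rect_bnd_dist wQ) h; apply: ccont_invsub.
  by rewrite -subr_eq0 -cabs_gt0; exact: lt_le_trans h.
have [c1 c2 c3 c4] := ccont_bnd x12 y12 fcb.
rewrite (le_trans _ (Im_le_cabs _))// ler_normr; apply/orP; left.
move: wQ => /and4P[h1 h2 h3 h4].
have L0 : 0 < L by lra.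
set a := Re w in h1 h2; set b := Im w in h3 h4.
have pt (u v : R) : `|u| <= L -> `|v| <= L -> r <= u -> r / (2 * L ^+ 2) <= u / (u ^+ 2 + v ^+ 2).
  move=> uL vL ru; have u0 : 0 < u by lra.
  rewrite ler_pdivrMr; last by rewrite mulr_gt0// exprn_gt0.
  rewrite mulrAC ler_pdivlMr; last by rewrite ltr_wpDr ?sqr_ge0// exprn_gt0.
  apply: ler_pM => //; [exact: ltW|by rewrite addr_ge0 ?sqr_ge0|].
  have := lerXn2r 2 (normr_ge0 u) (ltW L0) uL; rewrite real_normK ?num_real//.
  have := lerXn2r 2 (normr_ge0 v) (ltW L0) vL; rewrite real_normK ?num_real//.
  lra.
rewrite /rectwind /rectint cImD cImM /= mul0r mul1r add0r.
have -> : 4 * r ^+ 2 / L ^+ 2 = 2 * r / (2 * L ^+ 2) * (2 * r) + 2 * r / (2 * L ^+ 2) * (2 * r).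
  by field; rewrite gt_eqF.
have k0 : 0 <= 2 * r / (2 * L ^+ 2) by rewrite divr_ge0 ?mulr_ge0 ?exprn_ge0// ltW.
have subE (s t : R) : (s +i* t) - w = (s - a) +i* (t - b).
  by apply: complexP; rewrite ?cReB ?cImB.
apply: lerD.
  apply: (@le_trans _ _ (segint x1 x2 (fun=> 2 * r / (2 * L ^+ 2)))).
    by rewrite segint_cst// ler_wpM2l//; lra.
  apply: segint_le; [exact: rcont_cst|by apply: ucont_Im; exact: ucontB|].
  move=> x /andP[xx1 xx2]; rewrite cImB /hsection !subE !cinvE /=.
  have := @pt (b - y1) (x - a); have := @pt (y2 - b) (x - a).
  have xa : `|x - a| <= L by rewrite ler_norml; apply/andP; split; lra.
  have -> : `|y2 - b| <= L by rewrite ler_norml; apply/andP; split; lra.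
  have -> : `|b - y1| <= L by rewrite ler_norml; apply/andP; split; lra.
  have r1 : r <= y2 - b by lra.
  have r2 : r <= b - y1 by lra.
  move=> /(_ isT xa r1) p1 /(_ isT xa r2).
  have -> : - (y1 - b) = b - y1 by ring.
  rewrite mulNr opprK (addrC ((x - a) ^+ 2) ((y1 - b) ^+ 2)).
  rewrite (addrC ((x - a) ^+ 2) ((y2 - b) ^+ 2)).
  by rewrite -(sqrrN (b - y1)) opprB -mulrA; lra.
apply: (@le_trans _ _ (segint y1 y2 (fun=> 2 * r / (2 * L ^+ 2)))).
  by rewrite segint_cst// ler_wpM2l//; lra.
apply: segint_le; [exact: rcont_cst|by apply: ucont_Re; exact: ucontB|].
move=> y /andP[yy1 yy2]; rewrite cReB /vsection !subE !cinvE /=.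
have := @pt (a - x1) (y - b); have := @pt (x2 - a) (y - b).
have yb : `|y - b| <= L by rewrite ler_norml; apply/andP; split; lra.
have -> : `|x2 - a| <= L by rewrite ler_norml; apply/andP; split; lra.
have -> : `|a - x1| <= L by rewrite ler_norml; apply/andP; split; lra.
have r1 : r <= x2 - a by lra.
have r2 : r <= a - x1 by lra.
move=> /(_ isT yb r1) p1 /(_ isT yb r2).
have -> : (x1 - a) / ((x1 - a) ^+ 2 + (y - b) ^+ 2) =
  - ((a - x1) / ((a - x1) ^+ 2 + (y - b) ^+ 2)).
  by rewrite -(sqrrN (a - x1)) opprB -[a - x1]opprB mulNr opprK.
by rewrite opprK -mulrA; lra.
Qed.

Lemma rectwind_neq0 (r : R) x1 x2 y1 y2 w : 0 < r ->
  in_rect_by r x1 x2 y1 y2 w -> rectwind w x1 x2 y1 y2 != 0.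
Proof.
move=> r0 wQ; rewrite -cabs_gt0; pose L := (x2 - x1) + (y2 - y1).
have [h1 h2 _] := in_rect_by_le r0 wQ.
apply: (lt_le_trans _ (@rectwind_ge r L _ _ _ _ _ r0 wQ _ _)); rewrite /L; try lra.
move: wQ => /and4P[? ? ? ?].
by rewrite divr_gt0 ?mulr_gt0 ?exprn_gt0//; lra.
Qed.

Lemma hcont_bounded f x1 x2 y1 y2 : x1 <= x2 -> y1 <= y2 ->
  hcont_rect f x1 x2 y1 y2 ->
  exists2 M : R, 0 <= M & forall z, rect_bnd x1 x2 y1 y2 z -> cabs (f z) <= M.
Proof.
move=> x12 y12 [f1 f2 f3 f4].
have bnd a b (u : R -> R[i]) : a <= b -> ucont_on a b u ->
    exists2 M : R, 0 <= M & forall x, a <= x <= b -> cabs (u x) <= M.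
  move=> ab /ucont_cabs Hu.
  have [c _ Hc] : exists2 c, c \in `[a, b] & forall t, t \in `[a, b] ->
      cabs (u t) <= cabs (u c).
    apply: EVT_max => //; apply: continuous_in_subspaceT => x.
    by rewrite inE/= in_itv/=; exact: Hu.
  by exists (cabs (u c)) => [|x xab]; [exact: cabs_ge0|apply: Hc; rewrite in_itv].
have [M1 M10 H1] := bnd _ _ _ x12 f1; have [M2 M20 H2] := bnd _ _ _ x12 f2.
have [M3 M30 H3] := bnd _ _ _ y12 f3; have [M4 M40 H4] := bnd _ _ _ y12 f4.
exists (M1 + M2 + M3 + M4); first by rewrite !addr_ge0.
move=> [x y] /andP[/andP[/= xx yy] /or4P[]/eqP zE]; rewrite zE.
- by have := H3 _ yy; rewrite /vsection; lra.
- by have := H4 _ yy; rewrite /vsection; lra.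
- by have := H1 _ xx; rewrite /hsection; lra.
- by have := H2 _ xx; rewrite /hsection; lra.
Qed.

(* The kernel satisfies
   1/(z-w-h) - 1/(z-w) - h/(z-w)^2 = h^2/((z-w)^2 (z-w-h)). *)
Lemma cauchy_integral_derivable g (r : R) x1 x2 y1 y2 w : 0 < r ->
  in_rect_by r x1 x2 y1 y2 w ->
  (forall z, rect_bnd x1 x2 y1 y2 z -> ccont g z) ->
  cderivable (fun w => rectint (fun z => g z / (z - w)) x1 x2 y1 y2) w.
Proof.
move=> r0 wQ gc; have [x12 y12 _] := in_rect_by_le r0 wQ.
have [M M0 HM] := hcont_bounded x12 y12 (ccont_bnd x12 y12 gc).
exists (rectint (fun z => g z / (z - w) / (z - w)) x1 x2 y1 y2) => e e0.
pose D := (x2 - x1) + (y2 - y1); have D0 : 0 <= D by rewrite addr_ge0// subr_ge0.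
(* [rectint_bound] will yield [(k - 1) * cabs h ^+ 2]; the added 1 makes [k] positive. *)
pose k := 4 * (M * 2 / r ^+ 3) * D + 1.
have k0 : 0 < k by rewrite ltr_wpDl// !mulr_ge0// invr_ge0 exprn_ge0// ltW.
exists (Num.min (r / 2) (e / k)); first by rewrite lt_min !divr_gt0.
move=> h; rewrite lt_min => /andP[hr hk].
have bz z : rect_bnd x1 x2 y1 y2 z -> r <= cabs (z - w) := rect_bnd_dist wQ.
have bzh z : rect_bnd x1 x2 y1 y2 z -> r / 2 <= cabs (z - (w + h)).
  move=> /bz; rewrite opprD addrA; have := cabsBD (z - w) h; lra.
have nz z : rect_bnd x1 x2 y1 y2 z -> z != w.
  by move=> /bz zw; rewrite -subr_eq0 -cabs_gt0; lra.
have nzh z : rect_bnd x1 x2 y1 y2 z -> z != w + h.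
  by move=> /bzh zw; rewrite -subr_eq0 -cabs_gt0; lra.
have c1 z : rect_bnd x1 x2 y1 y2 z -> ccont (fun z => g z / (z - w)) z.
  by move=> Hz; apply: ccontM; [exact: gc|apply: ccont_invsub; exact: nz].
have c2 z : rect_bnd x1 x2 y1 y2 z -> ccont (fun z => g z / (z - (w + h))) z.
  by move=> Hz; apply: ccontM; [exact: gc|apply: ccont_invsub; exact: nzh].
have c3 z : rect_bnd x1 x2 y1 y2 z -> ccont (fun z => g z / (z - w) / (z - w)) z.
  by move=> Hz; apply: ccontM; [exact: c1|apply: ccont_invsub; exact: nz].
have hc c : hcont_rect (fun z => c * (g z / (z - w))) x1 x2 y1 y2.
  by apply: ccont_bnd => // z Hz; apply: ccontM; [exact: ccont_cst|exact: c1].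
have hc' c : hcont_rect (fun z => c * (g z / (z - w) / (z - w))) x1 x2 y1 y2.
  by apply: ccont_bnd => // z Hz; apply: ccontM; [exact: ccont_cst|exact: c3].
have -> : rectint (fun z => g z / (z - (w + h))) x1 x2 y1 y2 -
    rectint (fun z => g z / (z - w)) x1 x2 y1 y2 -
    rectint (fun z => g z / (z - w) / (z - w)) x1 x2 y1 y2 * h =
  rectint (fun z => h ^+ 2 * (g z / (z - w) / (z - w) / (z - (w + h)))) x1 x2 y1 y2.
  rewrite (mulrC _ h) -mulNr -[X in _ + X + _]mulN1r.
  rewrite -!rectintZ; [|exact: ccont_bnd c3|exact: ccont_bnd c1].
  rewrite -!rectintD //; try exact: ccont_bnd c2; last first.
    apply: ccont_bnd => // z Hz; apply: ccontD; first exact: c2.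
    by apply: ccontM; [exact: ccont_cst|exact: c1].
  by apply: rectint_eq => // z Hz; field; rewrite !subr_eq0 nz// nzh.
have hcq : hcont_rect (fun z => h ^+ 2 * (g z / (z - w) / (z - w) / (z - (w + h)))) x1 x2 y1 y2.
  apply: ccont_bnd => // z Hz; apply: ccontM; first exact: ccont_cst.
  by apply: ccontM; [exact: c3|apply: ccont_invsub; exact: nzh].
have hb z : rect_bnd x1 x2 y1 y2 z ->
    cabs (h ^+ 2 * (g z / (z - w) / (z - w) / (z - (w + h)))) <=
    cabs h ^+ 2 * (M * 2 / r ^+ 3).
  move=> Hz; rewrite cabsM cabsX !cabsf ler_wpM2l ?exprn_ge0 ?cabs_ge0//.
  have -> : M * 2 / r ^+ 3 = M / r / r / (r / 2) by field; rewrite gt_eqF.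
  have inv (a b : R) : 0 < a -> a <= b -> b^-1 <= a^-1.
    by move=> a0 ab; rewrite lef_pV2// posrE//; exact: lt_le_trans ab.
  have i1 := inv _ _ r0 (bz _ Hz).
  have i2 : (cabs (z - (w + h)))^-1 <= (r / 2)^-1.
    by apply: inv; [rewrite divr_gt0|exact: bzh].
  by rewrite !ler_pM ?mulr_ge0 ?invr_ge0 ?cabs_ge0 ?HM.
apply: (le_trans (rectint_bound x12 y12 hcq hb)).
rewrite -/D; have h0 := cabs_ge0 h.
have -> : 4 * (cabs h ^+ 2 * (M * 2 / r ^+ 3)) * D = (k - 1) * cabs h * cabs h.
  by rewrite /k; ring.
rewrite ler_wpM2r//; move: hk; rewrite ltr_pdivlMr//.
by move: h0 k0; clear; set t := cabs h; move=> *; nra.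
Qed.

End CauchyFormula.

(** * Measurability of continuous functions on the plane *)

Section PlaneMeasurability.
Variable R : realType.
Implicit Types (f : R[i] -> R[i]) (g : R[i] -> R).

Definition rccont g := forall z (e : R), 0 < e -> exists2 d : R, 0 < d &
  forall w, cabs (w - z) < d -> `|g w - g z| < e.

Lemma rat_near (t e : R) : 0 < e -> exists q : rat, t - e < ratr q /\ ratr q < t + e.
Proof.
move=> e0; have [|q] := @rat_in_itvoo R (t - e) (t + e); first by lra.
by rewrite in_itv => /andP[]; exists q.
Qed.

(** The plane carries the product sigma-algebra, so the preimage of an open ray is exhibited as a
    countable union of rectangles: the boxes with rational centre and half side [1 / (n + 1)] that
    it contains. *)
Lemma rccont_measurable g : rccont g ->
  measurable_fun [set: (measurableTypeR R * measurableTypeR R)%type]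
    (fun x => g (plane x) : measurableTypeR R).
Proof.
move=> gc; apply: (measurability _ (RGenOInfty.measurableE R)).
move=> _ [_ [c ->] <-]; rewrite setTI.
pose box (u : rat * rat * nat) : set (measurableTypeR R * measurableTypeR R) :=
  `]ratr u.1.1 - u.2.+1%:R^-1, ratr u.1.1 + u.2.+1%:R^-1[%classic `*`
  `]ratr u.1.2 - u.2.+1%:R^-1, ratr u.1.2 + u.2.+1%:R^-1[%classic.
pose U := (fun x : measurableTypeR R * measurableTypeR R => g (plane x)) @^-1`
  `]c, +oo[%classic.
pose F u := if pselect (box u `<=` U) then box u else set0.
have -> : (fun x : measurableTypeR R * measurableTypeR R => g (plane x)) @^-1`
    `]c, +oo[%classic = \bigcup_u F u.
  apply/seteqP; split=> [[x0 y0]|p [u _]]; last first.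
    by rewrite /F; case: pselect => // H /H.
  rewrite /= in_itv/= andbT; pose x : R := x0; pose y : R := y0.
  rewrite -[(x0, y0)]/(x, y); move: x y => x y {x0 y0} cg.
  have [|d d0 Hd] := gc (plane (x, y)) (g (plane (x, y)) - c).
    by rewrite subr_gt0.
  (* A point of the box differs from [(x, y)] by less than [2 / (n + 1)] in each coordinate, whence
     the quarter of [d]. *)
  have [n nd] : exists n, (n.+1%:R : R)^-1 < d / 4.
    have /archi_boundP := ltW (divr_gt0 (ltr0n _ 4 : 0 < 4%:R :> R) d0).
    set n := Num.bound _ => nb; exists n.
    rewrite -(invf_div 4 d) ltf_pV2 ?posrE ?divr_gt0//.
    by rewrite (lt_le_trans nb)// ler_nat.
  have n0 : 0 < (n.+1%:R : R)^-1 by rewrite invr_gt0.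
  have [q1 [h1 h2]] := rat_near x n0; have [q2 [h3 h4]] := rat_near y n0.
  exists (q1, q2, n) => //; rewrite /F; case: pselect => [boxU|[]].
    by split; rewrite /= in_itv/=; apply/andP; split; rewrite ?ltrBlDr// -ltrBlDr.
  move=> [x' y'] [] /=; rewrite !in_itv/= => /andP[a1 a2] /andP[b1 b2].
  rewrite /U /= in_itv/= andbT.
  have /Hd : cabs (plane (x', y') - plane (x, y)) < d.
    rewrite (le_lt_trans (cabs_le_ReIm _))// /plane cReB cImB /=.
    have tri (s t q k : R) : q - k < s -> s < q + k -> t - k < q -> q < t + k ->
        `|s - t| < 2 * k.
      by move=> *; rewrite ltr_norml; apply/andP; split; lra.
    have := tri _ _ _ _ a1 a2 h1 h2; have := tri _ _ _ _ b1 b2 h3 h4.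
    move: nd; set k := n.+1%:R^-1; clear => *; lra.
  by rewrite ltr_norml opprB => /andP[+ _]; rewrite ltrD2r.
apply: countable_bigcupT_measurable; first exact: countableP.
move=> u; rewrite /F; case: pselect => boxU; last exact: measurable0.
by apply: measurableX; exact: measurable_itv.
Qed.

Lemma ccont_rccont (phi : R[i] -> R) f :
  (forall z w, `|phi z - phi w| <= cabs (z - w)) ->
  (forall z, ccont f z) -> rccont (fun z => phi (f z)).
Proof.
move=> phiP fc z e /(fc z)[d d0 Hd]; exists d => // w /Hd.
exact: le_lt_trans (phiP _ _).
Qed.

Lemma cabs_lip (z w : R[i]) : `|cabs z - cabs w| <= cabs (z - w).
Proof.
by rewrite ler_norml lerNl opprB (cabsBD z w) (cabsC z w) (cabsBD w z).
Qed.

Lemma Re_lip (z w : R[i]) : `|Re z - Re w| <= cabs (z - w).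
Proof. by rewrite -cReB Re_le_cabs. Qed.

Lemma Im_lip (z w : R[i]) : `|Im z - Im w| <= cabs (z - w).
Proof. by rewrite -cImB Im_le_cabs. Qed.

Lemma measurable_cabs f : (forall z, ccont f z) ->
  measurable_fun [set: (measurableTypeR R * measurableTypeR R)%type]
    (fun x => cabs (f (plane x)) : measurableTypeR R).
Proof.
move=> fc; have := rccont_measurable (ccont_rccont cabs_lip fc); exact.
Qed.

Lemma measurable_Re f : (forall z, ccont f z) ->
  measurable_fun [set: (measurableTypeR R * measurableTypeR R)%type]
    (fun x => Re (f (plane x)) : measurableTypeR R).
Proof.
move=> fc; have := rccont_measurable (ccont_rccont Re_lip fc); exact.
Qed.

Lemma measurable_Im f : (forall z, ccont f z) ->
  measurable_fun [set: (measurableTypeR R * measurableTypeR R)%type]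
    (fun x => Im (f (plane x)) : measurableTypeR R).
Proof.
move=> fc; have := rccont_measurable (ccont_rccont Im_lip fc); exact.
Qed.

Lemma measurable_weight (alpha : R) :
  measurable_fun [set: (measurableTypeR R * measurableTypeR R)%type]
    (fun x => weight alpha (plane x) : measurableTypeR R).
Proof.
have mc := measurable_cabs (fun z => @ccont_id R z).
apply: measurable_funM => //; apply: measurable_funX.
have h : measurable_fun [set: (measurableTypeR R * measurableTypeR R)%type]
    (fun x => ln (cabs (plane x)) : measurableTypeR R).
  exact: (measurableT_comp (@measurable_ln R) mc).
have := measurable_maxr h (@measurable_cst _ _ _ _ _ (0 : R)).
by apply: eq_measurable_fun => x _.
Qed.

End PlaneMeasurability.

(** * A mean value inequality over squares *)

Section AreaMeanValue.
Variable R : realType.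
Notation mu := (@lebesgue_measure R).
Implicit Types (F : R[i] -> R[i]) (h : R * R -> \bar R).

Definition sqr (w : R[i]) (r : R) : set (R * R) :=
  `[Re w - r, Re w + r]%classic `*` `[Im w - r, Im w + r]%classic.

Lemma measurable_sqr w r :
  measurable (sqr w r : set (measurableTypeR R * measurableTypeR R)).
Proof. by apply: measurableX; exact: measurable_itv. Qed.

Lemma segint_ereal a b (u : R -> R) : rcont_on a b u ->
  (forall x, a <= x <= b -> 0 <= u x) ->
  (segint a b u)%:E = (\int[mu]_(x in `[a, b]) (u x)%:E)%E.
Proof.
move=> uc u0; rewrite /segint /Rintegral fineK//.
exact: integrable_fin_num (rcont_integrable uc).
Qed.

Lemma segint_mono a b c d (u : R -> R) : a <= c -> d <= b -> c <= d ->
  rcont_on a b u -> (forall x, a <= x <= b -> 0 <= u x) ->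
  segint c d u <= segint a b u.
Proof.
move=> ac db cd uc u0.
rewrite (@segint_split R a b c)//; last exact: le_trans db.
rewrite (@segint_split R c b d)//; last exact: rcont_sub uc.
have nn x y : a <= x -> y <= b -> 0 <= segint x y u.
  move=> ax yb; apply: Rintegral_ge0 => t /=; rewrite in_itv/= => /andP[? ?].
  by apply: u0; lra.
rewrite addrCA lerDl addr_ge0//; apply: nn => //.
- exact: le_trans cd db.
- exact: le_trans ac cd.
Qed.

(* The Cauchy formula on the rectangles with sides at distance between [r] and
   [2r] of [w]; each of the four sides is moved independently. *)
Lemma mean_value_sides F w (r : R) (x1 x2 y1 y2 : R) : 0 < r ->
  ccont_rect F (Re w - 2 * r) (Re w + 2 * r) (Im w - 2 * r) (Im w + 2 * r) ->
  (forall z, in_rect (Re w - 2 * r) (Re w + 2 * r) (Im w - 2 * r) (Im w + 2 * r) z ->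
     cderivable F z) ->
  Re w - 2 * r <= x1 <= Re w - r -> Re w + r <= x2 <= Re w + 2 * r ->
  Im w - 2 * r <= y1 <= Im w - r -> Im w + r <= y2 <= Im w + 2 * r ->
  forall gx gy,
  gx = (fun x => segint (Im w - 2 * r) (Im w + 2 * r) (fun y => cabs (F (x +i* y)))) ->
  gy = (fun y => segint (Re w - 2 * r) (Re w + 2 * r) (fun x => cabs (F (x +i* y)))) ->
  r * cabs (F w) <= 8 * (gx x1 + gx x2 + (gy y1 + gy y2)).
Proof.
move=> r0 Fc Fd /andP[hx1 hx1'] /andP[hx2 hx2'] /andP[hy1 hy1'] /andP[hy2 hy2'] gx gy gxE gyE.
have x12 : x1 <= x2 by move: r0 hx1' hx2; clear; lra.
have y12 : y1 <= y2 by move: r0 hy1' hy2; clear; lra.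
have wQ : in_rect_by r x1 x2 y1 y2 w.
  by move: hx1' hx2 hy1' hy2; clear => *; apply/and4P; split; lra.
have wR : in_rect (Re w - 2 * r) (Re w + 2 * r) (Im w - 2 * r) (Im w + 2 * r) w.
  by move: r0; clear => *; rewrite /in_rect; lra.
have sub z : in_rect x1 x2 y1 y2 z ->
    in_rect (Re w - 2 * r) (Re w + 2 * r) (Im w - 2 * r) (Im w + 2 * r) z.
  exact: in_rect_sub.
have E := @cauchy_exc R F [::] r x1 x2 y1 y2 w r0 wQ (fun z Hz => Fc z (sub z Hz))
   (fun z Hz _ => Fd z (sub z Hz)) (Fd w wR).
have J : 1 / 4 <= cabs (rectwind w x1 x2 y1 y2).
  rewrite (le_trans _ (@rectwind_ge R r (4 * r) x1 x2 y1 y2 w r0 wQ _ _))//.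
  - have -> : 4 * r ^+ 2 / (4 * r) ^+ 2 = 1 / 4 by field; rewrite gt_eqF.
    by [].
  - by move: hx1 hx2'; clear; lra.
  - by move: hy1 hy2'; clear; lra.
have {}E : cabs (F w) <= 4 * cabs (rectint (fun z => F z / (z - w)) x1 x2 y1 y2).
  rewrite -E cabsM mulrCA -[leLHS]mulr1 ler_wpM2l ?cabs_ge0//.
  by move: J; clear; lra.
have cF z : rect_bnd x1 x2 y1 y2 z -> ccont F z by move=> /rect_bndW/sub/Fc.
have cK z : rect_bnd x1 x2 y1 y2 z -> ccont (fun z => F z / (z - w)) z.
  move=> Hz; apply: ccontM; first exact: cF.
  apply: ccont_invsub; rewrite -subr_eq0 -cabs_gt0.
  exact: lt_le_trans (rect_bnd_dist wQ Hz).
have [k1 k2 k3 k4] := ccont_bnd x12 y12 cK.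
have hb z : rect_bnd x1 x2 y1 y2 z -> cabs (F z / (z - w)) <= r^-1 * cabs (F z).
  move=> /(rect_bnd_dist wQ) rz; rewrite cabsf mulrC ler_wpM2r ?cabs_ge0//.
  by rewrite lef_pV2// posrE//; exact: lt_le_trans rz.
have [b1 b2 b3 b4] := rect_bnd_sides x12 y12 hb.
have Vc x : Re w - 2 * r <= x -> x <= Re w + 2 * r ->
    rcont_on (Im w - 2 * r) (Im w + 2 * r) (fun y => cabs (F (x +i* y))).
  move=> h1 h2; apply: ucont_cabs; apply: vsection_ucont => y yy; apply: Fc.
  by rewrite /in_rect/= h1 h2 yy.
have Hc y : Im w - 2 * r <= y -> y <= Im w + 2 * r ->
    rcont_on (Re w - 2 * r) (Re w + 2 * r) (fun x => cabs (F (x +i* y))).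
  move=> h1 h2; apply: ucont_cabs; apply: hsection_ucont => x xx; apply: Fc.
  by rewrite /in_rect/= h1 h2 xx.
have gxP x : Re w - 2 * r <= x -> x <= Re w + 2 * r ->
    (forall y, y1 <= y <= y2 -> cabs (F (x +i* y) / (x +i* y - w)) <= r^-1 * cabs (F (x +i* y))) ->
    ucont_on y1 y2 (vsection (fun z => F z / (z - w)) x) ->
    cabs (csegint y1 y2 (vsection (fun z => F z / (z - w)) x)) <= 2 * (r^-1 * gx x).
  move=> h1 h2 hle uc; rewrite (le_trans (csegint_norm uc))// ler_pM2l//.
  have Vs : rcont_on y1 y2 (fun y => cabs (F (x +i* y))) by apply: rcont_sub (Vc _ h1 h2).
  apply: (@le_trans _ _ (segint y1 y2 (fun y => r^-1 * cabs (F (x +i* y))))).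
    by apply: segint_le => //; [exact: ucont_cabs|exact: rcontZ].
  rewrite segintZ// ler_pM2l ?invr_gt0// gxE; apply: segint_mono => //; first exact: Vc.
  by move=> *; exact: cabs_ge0.
have gyP y : Im w - 2 * r <= y -> y <= Im w + 2 * r ->
    (forall x, x1 <= x <= x2 -> cabs (F (x +i* y) / (x +i* y - w)) <= r^-1 * cabs (F (x +i* y))) ->
    ucont_on x1 x2 (hsection (fun z => F z / (z - w)) y) ->
    cabs (csegint x1 x2 (hsection (fun z => F z / (z - w)) y)) <= 2 * (r^-1 * gy y).
  move=> h1 h2 hle uc; rewrite (le_trans (csegint_norm uc))// ler_pM2l//.
  have Vs : rcont_on x1 x2 (fun x => cabs (F (x +i* y))) by apply: rcont_sub (Hc _ h1 h2).
  apply: (@le_trans _ _ (segint x1 x2 (fun x => r^-1 * cabs (F (x +i* y))))).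
    by apply: segint_le => //; [exact: ucont_cabs|exact: rcontZ].
  rewrite segintZ// ler_pM2l ?invr_gt0// gyE; apply: segint_mono => //; first exact: Hc.
  by move=> *; exact: cabs_ge0.
have hx12 : x1 <= Re w + 2 * r by exact: le_trans hx2'.
have hx21 : Re w - 2 * r <= x2 by exact: le_trans x12.
have hy12 : y1 <= Im w + 2 * r by exact: le_trans hy2'.
have hy21 : Im w - 2 * r <= y2 by exact: le_trans y12.
have := gxP _ hx1 hx12 b3 k3; have := gxP _ hx21 hx2' b4 k4.
have := gyP _ hy1 hy12 b1 k1; have := gyP _ hy21 hy2' b2 k2.
have NE a b (u : R -> R[i]) : ucont_on a b u ->
    csegint a b (fun x => - u x) = - csegint a b u.
  by move=> uc; rewrite -mulN1r -csegintZ//; apply: csegint_eq => t _; rewrite mulN1r.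
have {}E : cabs (F w) <= 4 * (
    cabs (csegint x1 x2 (hsection (fun z => F z / (z - w)) y1)) +
    cabs (csegint x1 x2 (hsection (fun z => F z / (z - w)) y2)) +
    (cabs (csegint y1 y2 (vsection (fun z => F z / (z - w)) x1)) +
    cabs (csegint y1 y2 (vsection (fun z => F z / (z - w)) x2)))).
  rewrite (le_trans E)// ler_pM2l// /rectint.
  rewrite csegintD//; last exact: ucontN.
  rewrite csegintD//; last exact: ucontN.
  rewrite !NE// (le_trans (cabsD _ _))// cabsM cabs_i mul1r lerD//.
    exact: cabsB.
  by rewrite [leRHS]addrC cabsB.
move: E; set c1 := cabs (csegint _ _ _); set c2 := cabs (csegint _ _ _).
set c3 := cabs (csegint _ _ _); set c4 := cabs (csegint _ _ _).
set g1 := gx x1; set g2 := gx x2; set g3 := gy y1; set g4 := gy y2.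
move: r0; clear => r0 E h1 h2 h3 h4.
rewrite mulrC -ler_pdivlMr//; rewrite (le_trans E)//.
have -> : 8 * (g1 + g2 + (g3 + g4)) / r =
  4 * (2 * (r^-1 * g1) + 2 * (r^-1 * g2) + (2 * (r^-1 * g3) + 2 * (r^-1 * g4))) by field; rewrite gt_eqF.
move: h1 h2 h3 h4 {E}; move: (r^-1 * g1) (r^-1 * g2) (r^-1 * g3) (r^-1 * g4) c1 c2 c3 c4.
by move=> *; lra.
Qed.

(** Instead of averaging Cauchy's formula over a family of rectangles, each side is chosen by
    itself. Either every one of the four families of segments contains one on which the integral of
    [cabs F] is below [t], which contradicts [mean_value_sides], or some family has all its
    integrals at least [t], and then Tonelli over an interval of length [r] gives the bound. The
    majorant [h] provides a function measurable on the whole plane, [F] being controlled near the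
    square only. *)
Lemma area_mean_value F w (r : R) h : 0 < r ->
  (forall z, in_rect (Re w - 2 * r) (Re w + 2 * r) (Im w - 2 * r) (Im w + 2 * r) z ->
     cderivable F z) ->
  measurable_fun [set: (measurableTypeR R * measurableTypeR R)%type] h ->
  (forall x, 0 <= h x)%E ->
  (forall x, sqr w (2 * r) x -> (cabs (F (plane x)))%:E <= h x)%E ->
  ((r ^+ 2 * cabs (F w))%:E <= 32%:E * \int[planar_measure R]_(x in sqr w (2 * r)) h x)%E.
Proof.
move=> r0 Fd mh h0 Fh; have Fc z Hz := cderivable_ccont (Fd z Hz).
set m := cabs (F w).
set gx := fun x => segint (Im w - 2 * r) (Im w + 2 * r) (fun y => cabs (F (x +i* y))).
set gy := fun y => segint (Re w - 2 * r) (Re w + 2 * r) (fun x => cabs (F (x +i* y))).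
have Vc x : Re w - 2 * r <= x -> x <= Re w + 2 * r ->
    rcont_on (Im w - 2 * r) (Im w + 2 * r) (fun y => cabs (F (x +i* y))).
  move=> h1 h2; apply: ucont_cabs; apply: vsection_ucont => y yy; apply: Fc.
  by rewrite /in_rect/= h1 h2 yy.
have Hc y : Im w - 2 * r <= y -> y <= Im w + 2 * r ->
    rcont_on (Re w - 2 * r) (Re w + 2 * r) (fun x => cabs (F (x +i* y))).
  move=> h1 h2; apply: ucont_cabs; apply: hsection_ucont => x xx; apply: Fc.
  by rewrite /in_rect/= h1 h2 xx.
set Q := sqr w (2 * r); pose hQ := (h \_ Q)%E.
have hQ0 x : (0 <= hQ x)%E by rewrite /hQ patchE; case: ifP.
have mhQ : measurable_fun [set: (measurableTypeR R * measurableTypeR R)%type] hQ.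
  apply/(measurable_restrictT h (measurable_sqr w (2 * r))).
  exact: measurable_funTS.
have gxE x : Re w - 2 * r <= x -> x <= Re w + 2 * r ->
    ((gx x)%:E <= fubini_F mu hQ x)%E.
  move=> h1 h2; rewrite /gx segint_ereal//; [|exact: Vc|by move=> *; exact: cabs_ge0].
  rewrite integral_mkcond /fubini_F; apply: ge0_le_integral => //.
  - by move=> y _; rewrite patchE; case: ifP => // _; rewrite lee_fin cabs_ge0.
  - apply/(measurable_restrictT _ (measurable_itv _)).
    exact: measurable_int (rcont_integrable (Vc _ h1 h2)).
  - exact: measurableT_comp mhQ (pair1_measurable _).
  move=> y _; rewrite patchE; case: ifPn => yQ; last exact: hQ0.
  rewrite /hQ patchE mem_set; first by apply: Fh; split => //=; rewrite ?in_itv/= ?h1 ?h2//; move: yQ; rewrite inE/= in_itv.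
  by split => //=; rewrite ?in_itv/= ?h1 ?h2//; move: yQ; rewrite inE/= in_itv.
have gyE y : Im w - 2 * r <= y -> y <= Im w + 2 * r ->
    ((gy y)%:E <= fubini_G mu hQ y)%E.
  move=> h1 h2; rewrite /gy segint_ereal//; [|exact: Hc|by move=> *; exact: cabs_ge0].
  rewrite integral_mkcond /fubini_G; apply: ge0_le_integral => //.
  - by move=> x _; rewrite patchE; case: ifP => // _; rewrite lee_fin cabs_ge0.
  - apply/(measurable_restrictT _ (measurable_itv _)).
    exact: measurable_int (rcont_integrable (Hc _ h1 h2)).
  - exact: measurableT_comp mhQ (pair2_measurable _).
  move=> x _; rewrite patchE; case: ifPn => xQ; last exact: hQ0.
  rewrite /hQ patchE mem_set; first by apply: Fh; split => //=; rewrite ?in_itv/= ?h1 ?h2//; move: xQ; rewrite inE/= in_itv.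
  by split => //=; rewrite ?in_itv/= ?h1 ?h2//; move: xQ; rewrite inE/= in_itv.
have FE : (\int[planar_measure R]_(x in Q) h x = \int[mu]_x fubini_F mu hQ x)%E.
  by rewrite integral_mkcond; apply: fubini_tonelli1.
have GE : (\int[planar_measure R]_(x in Q) h x = \int[mu]_y fubini_G mu hQ y)%E.
  by rewrite integral_mkcond; apply: fubini_tonelli2.
have mF : measurable_fun [set: measurableTypeR R] (fubini_F mu hQ).
  exact: measurable_fun_fubini_tonelli_F.
have mG : measurable_fun [set: measurableTypeR R] (fubini_G mu hQ).
  exact: measurable_fun_fubini_tonelli_G.
have F0 x : (0 <= fubini_F mu hQ x)%E by apply: integral_ge0.
have G0 x : (0 <= fubini_G mu hQ x)%E by apply: integral_ge0.
(* Four sides below [t] would give less than [8 * 4 * t = r * m] in [mean_value_sides]. *)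
pose t := r * m / 32; have t0 : 0 <= t by rewrite divr_ge0// mulr_ge0 ?cabs_ge0// ltW.
have key (K : R -> \bar R) (g : R -> R) c : measurable_fun [set: measurableTypeR R] K ->
    (forall x, 0 <= K x)%E ->
    (forall x, c <= x <= c + r -> ((g x)%:E <= K x)%E) ->
    (\int[planar_measure R]_(x in Q) h x = \int[mu]_x K x)%E ->
    (exists2 x, c <= x <= c + r & g x < t) \/
    ((r ^+ 2 * m)%:E <= 32%:E * \int[planar_measure R]_(x in Q) h x)%E.
  move=> mK K0 gK IE.
  have [H|/forallNP H] := pselect (exists x, c <= x <= c + r /\ g x < t).
    by case: H => x [? ?]; left; exists x.
  right; have {}H x : c <= x <= c + r -> t <= g x.
    by move=> xx; rewrite leNgt; apply/negP => ?; apply: (H x).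
  have -> : r ^+ 2 * m = 32 * (t * r) by rewrite /t; field.
  rewrite EFinM lee_pmul2l// IE.
  have sub : (\int[mu]_(x in `[c, (c + r)%R]) K x <= \int[mu]_x K x)%E.
    by apply: ge0_subset_integral => //; exact: measurable_itv.
  apply: le_trans sub.
  have := @segint_cst R c (c + r) t; rewrite lerDl => /(_ (ltW r0)).
  rewrite addrAC subrr add0r => <-.
  rewrite segint_ereal//; last exact: rcont_cst.
  apply: ge0_le_integral => //; first exact: measurable_funTS.
  move=> x /=; rewrite in_itv/= => xx; apply: (le_trans _ (gK _ xx)).
  by rewrite lee_fin H.
have [//|[x1 /andP[x11 x12] gx1]|//] := @key (fubini_F mu hQ) gx (Re w - 2 * r) mF F0 _ FE.
  by move=> x /andP[h1 h2]; apply: gxE => //; move: r0 h2; clear; lra.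
have [//|[x2 /andP[x21 x22] gx2]|//] := @key (fubini_F mu hQ) gx (Re w + r) mF F0 _ FE.
  by move=> x /andP[h1 h2]; apply: gxE => //; move: r0 h1 h2; clear; lra.
have [//|[y1 /andP[y11 y12] gy1]|//] := @key (fubini_G mu hQ) gy (Im w - 2 * r) mG G0 _ GE.
  by move=> x /andP[h1 h2]; apply: gyE => //; move: r0 h2; clear; lra.
have [//|[y2 /andP[y21 y22] gy2]|//] := @key (fubini_G mu hQ) gy (Im w + r) mG G0 _ GE.
  by move=> x /andP[h1 h2]; apply: gyE => //; move: r0 h1 h2; clear; lra.
have := @mean_value_sides F w r x1 x2 y1 y2 r0 Fc Fd.
rewrite -/m x11 x21 y11 y21 /=.
have -> : x1 <= Re w - r by move: x12; clear; lra.
have -> : x2 <= Re w + 2 * r by move: x22; clear; lra.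
have -> : y1 <= Im w - r by move: y12; clear; lra.
have -> : y2 <= Im w + 2 * r by move: y22; clear; lra.
move=> /(_ isT isT isT isT gx gy erefl erefl).
have tE : 32 * t = r * m by rewrite /t; field.
move=> hh; exfalso; move: tE hh.
by move: gx1 gx2 gy1 gy2; clear; lra.
Qed.

End AreaMeanValue.

(** * Removable singularities, division by zeros, maximum principle, limits *)

Section EntireFunctions.
Variable R : realType.
Implicit Types (f g : R[i] -> R[i]) (z w s : R[i]) (F : nat -> R[i] -> R[i]).

Definition centire f := forall z, cderivable f z.

Let near_square s w : cabs (w - s) < 1 / 2 ->
  in_rect_by (1 / 2) (Re s - 1) (Re s + 1) (Im s - 1) (Im s + 1) w.
Proof.
move=> ws; have := le_lt_trans (Re_le_cabs (w - s)) ws.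
have := le_lt_trans (Im_le_cabs (w - s)) ws.
rewrite cReB cImB !ltr_norml => /andP[? ?] /andP[? ?].
by apply/and4P; split; lra.
Qed.

(* On a square around [s] the function agrees, off [s], with the quotient of
   its Cauchy integral by the winding integral, which is differentiable. *)
Lemma removable f s : (forall z, ccont f z) ->
  (forall z, z != s -> cderivable f z) -> centire f.
Proof.
move=> fc fd z; have [->|/fd//] := eqVneq z s; move=> {z}.
have h2 : (0 : R) < 1 / 2 by rewrite divr_gt0.
have cst1 (z : R[i]) : ccont (fun=> 1 : R[i]) z by exact: ccont_cst.
pose J w := rectwind w (Re s - 1) (Re s + 1) (Im s - 1) (Im s + 1).
pose K w := rectint (fun z => f z / (z - w)) (Re s - 1) (Re s + 1) (Im s - 1) (Im s + 1).
have JE w : J w = rectint (fun z => 1 / (z - w)) (Re s - 1) (Re s + 1) (Im s - 1) (Im s + 1).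
  by apply: rectint_eq; [lra|lra|move=> z _; rewrite div1r].
have Jd w : cabs (w - s) < 1 / 2 -> cderivable J w.
  move=> /near_square wQ; rewrite (_ : J = fun w => rectint (fun z => 1 / (z - w))
    (Re s - 1) (Re s + 1) (Im s - 1) (Im s + 1)); last exact/funext/JE.
  exact: (cauchy_integral_derivable (g := fun=> 1) h2 wQ).
have Kd w : cabs (w - s) < 1 / 2 -> cderivable K w.
  by move=> /near_square wQ; apply: (cauchy_integral_derivable h2 wQ) => z _; exact: fc.
have J0 w : cabs (w - s) < 1 / 2 -> J w != 0.
  by move=> /near_square wQ; exact: rectwind_neq0 h2 wQ.
have E w : cabs (w - s) < 1 / 2 -> w != s -> f w = K w / J w.
  move=> ws wn; apply: (canRL (mulfK (J0 _ ws))).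
  apply: (@cauchy_exc _ f [:: s]) h2 (near_square ws) _ _ (fd _ wn) => z _ //.
  by rewrite inE => /fd.
have ss : cabs (s - s) < 1 / 2 by rewrite subrr cabs0.
have gd : cderivable (fun w => K w / J w) s.
  by apply: cderivableM; [exact: Kd|apply: cderivableV; [exact: J0|exact: Jd]].
suff fs : f s = K s / J s.
  apply: (cderivable_near h2 _ gd) => w ws.
  by have [->//|wn] := eqVneq w s; rewrite E.
apply/eqP; rewrite -subr_eq0 -cabs_eq0 eq_le cabs_ge0 andbT.
apply/ler_addgt0Pl => e e0; rewrite addr0.
have := ccontB (fc s) (cderivable_ccont gd) e0 => -[d d0 Hd].
pose t : R := Num.min (d / 2) (1 / 4).
have t0 : 0 < t by rewrite lt_min !divr_gt0.
have td : t <= d / 2 by rewrite ge_min lexx.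
have t4 : t <= 1 / 4 by rewrite ge_min lexx orbT.
have := Hd (s + t%:C); rewrite [s + _]addrC addrK cabsR gtr0_norm//.
rewrite E; first last.
- by rewrite -subr_eq0 addrK -cabs_eq0 cabsR normr_eq0 gt_eqF.
- by rewrite addrK cabsR gtr0_norm//; lra.
by rewrite subrr sub0r cabsN => /(_ ltac:(lra))/ltW.
Qed.

(** The Caratheodory quotient at the zero is continuous everywhere and differentiable off [s];
    [removable] does the rest. *)
Lemma divide_zero f s : centire f -> f s = 0 ->
  exists2 g, centire g & forall z, f z = g z * (z - s).
Proof.
move=> fd fs; have [a /has_cderiv_caratheodory[q [_ qc fq]]] := fd s.
have fE z : f z = q z * (z - s) by rewrite -fq fs subr0.
exists q => //.
have qd z : z != s -> cderivable q z.
  move=> zs; apply: (@cderivable_near _ (fun z => f z / (z - s)) q z (cabs (z - s))).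
  - by rewrite cabs_gt0 subr_eq0.
  - move=> w wz; rewrite fE mulfK// subr_eq0; apply: contraTneq wz => ->.
    by rewrite cabsC ltxx.
  - apply: cderivableM; first exact: fd.
    apply: cderivableV; first by rewrite subr_eq0.
    by apply: cderivableB; [exact: cderivable_id|exact: cderivable_cst].
apply: (@removable q s) => // z.
by have [->//|/qd/cderivable_ccont] := eqVneq z s.
Qed.

Lemma divide_zeros f (S : seq R[i]) : centire f -> uniq S ->
  {in S, forall s, f s = 0} ->
  exists2 g, centire g & forall z, f z = g z * \prod_(s <- S) (z - s).
Proof.
elim: S f => [|s S IH] f fd /=.
  by exists f => // z; rewrite big_nil mulr1.
move=> /andP[sS uS] f0.
have [g gd gE] := divide_zero fd (f0 _ (mem_head _ _)).
have [|h hd hE] := IH _ gd uS.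
  move=> t tS; have := f0 t; rewrite inE tS orbT gE => /(_ isT)/eqP.
  rewrite mulf_eq0 subr_eq0 => /orP[/eqP//|/eqP ts].
  by move: sS; rewrite -ts tS.
by exists h => // z; rewrite gE hE big_cons mulrAC mulrA.
Qed.

(** A maximum principle up to a constant, straight from Cauchy's formula: the contour integral is at
    most [32 * M] and the winding integral at least [1 / 4], because [w] keeps distance [r / 2] from
    a boundary of side [2 * r]. *)
Lemma max_bound f (r M : R) w : centire f -> 0 < r ->
  `|Re w| <= r / 2 -> `|Im w| <= r / 2 ->
  (forall z, rect_bnd (- r) r (- r) r z -> cabs (f z) <= M) ->
  cabs (f w) <= 128 * M.
Proof.
move=> fd r0 wr wi HM.
have wQ : in_rect_by (r / 2) (- r) r (- r) r w.
  move: wr wi; rewrite !ler_norml => /andP[? ?] /andP[? ?].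
  by apply/and4P; split; lra.
have r2 : 0 < r / 2 by rewrite divr_gt0.
have rr : - r <= r by lra.
have E := @cauchy_exc _ f [::] (r / 2) (- r) r (- r) r w r2 wQ
  (fun z _ => cderivable_ccont (fd z)) (fun z _ _ => fd z) (fd w).
have J := @rectwind_ge _ (r / 2) (2 * r) _ _ _ _ _ r2 wQ ltac:(lra) ltac:(lra).
have fc z : rect_bnd (- r) r (- r) r z -> ccont f z by move=> _; exact: cderivable_ccont.
have B z : rect_bnd (- r) r (- r) r z -> cabs (f z / (z - w)) <= M / (r / 2).
  move=> Hz; rewrite cabsf ler_pM ?invr_ge0 ?cabs_ge0 ?HM//.
  have h := rect_bnd_dist wQ Hz.
  by rewrite lef_pV2// posrE//; exact: lt_le_trans h.
have := rectint_bound rr rr (hcont_mul_invsub r2 wQ fc) B.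
rewrite -E cabsM.
have -> : 4 * (M / (r / 2)) * (r - - r + (r - - r)) = 32 * M.
  by field; rewrite gt_eqF.
have : 1 / 4 <= cabs (rectwind w (- r) r (- r) r).
  by apply: le_trans J; rewrite le_eqVlt; apply/orP; left; apply/eqP; field; rewrite gt_eqF.
by have := cabs_ge0 (f w); move: (cabs (rectwind _ _ _ _ _)) => J' *; nra.
Qed.

(** Cauchy's formula passes to the uniform limit; near [s] the limit is thus a Cauchy integral
    divided by the winding integral, and both are differentiable. *)
Lemma weierstrass F f : (forall n, centire (F n)) ->
  (forall r e : R, 0 < e -> exists N, forall n z, (N <= n)%N -> cabs z <= r ->
    cabs (F n z - f z) <= e) ->
  centire f.
Proof.
move=> Fd Ff.
have fc z : ccont f z.
  move=> e e0; have [N HN] := Ff (cabs z + 1) (e / 4) ltac:(lra).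
  have e4 : 0 < e / 4 by lra.
  have [d d0 Hd] := cderivable_ccont (Fd N z) e4.
  exists (Num.min d 1); first by rewrite lt_min d0 ltr01.
  move=> w; rewrite lt_min => /andP[/Hd h1 h2].
  have := HN N w (leqnn N); have := HN N z (leqnn N).
  have := cabsBD w z => h3 /(_ ltac:(lra)) h4 /(_ ltac:(lra)) h5.
  have -> : f w - f z = (F N w - F N z) + ((F N z - f z) - (F N w - f w)) by ring.
  apply: (le_lt_trans (cabsD _ _)).
  have := cabsB (F N z - f z) (F N w - f w); lra.
move=> s; have h2 : (0 : R) < 1 / 2 by rewrite divr_gt0.
pose J w := rectwind w (Re s - 1) (Re s + 1) (Im s - 1) (Im s + 1).
pose K g w := rectint (fun z => g z / (z - w)) (Re s - 1) (Re s + 1) (Im s - 1) (Im s + 1).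
have ss : cabs (s - s) < 1 / 2 by rewrite subrr cabs0.
have x12 : Re s - 1 <= Re s + 1 by lra.
have y12 : Im s - 1 <= Im s + 1 by lra.
have E w : cabs (w - s) < 1 / 2 -> f w * J w = K f w.
  move=> /near_square wQ; apply/eqP; rewrite -subr_eq0 -cabs_eq0 eq_le cabs_ge0 andbT.
  apply/ler_addgt0Pl => e e0; rewrite addr0.
  (* The disc of radius [r] contains [w] and the square around [s]. The number [k] splits the error
     into [32 * (e / k)] for the contour integral and [cabs (J w) * (e / k)] for the other side. *)
  pose r := cabs s + cabs w + 4.
  pose k := cabs (J w) + 32.
  have k0 : 0 < k by rewrite ltr_wpDl ?cabs_ge0.
  have [N HN] := Ff r (e / k) (divr_gt0 e0 k0).
  have EN : F N w * J w = K (F N) w.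
    exact: (@cauchy_exc _ (F N) [::]) h2 wQ
      (fun z _ => cderivable_ccont (Fd N z)) (fun z _ _ => Fd N z) (Fd N w).
  have -> : f w * J w - K f w = (K (F N) w - K f w) - (F N w - f w) * J w.
    by rewrite -EN; ring.
  apply: (le_trans (cabsB _ _)); rewrite cabsM.
  have -> : e = e / k * 32 + e / k * cabs (J w).
    by rewrite -mulrDr [32 + _]addrC divfK// gt_eqF.
  apply: lerD; last first.
    rewrite ler_wpM2r ?cabs_ge0// HN// /r; have := cabs_ge0 s; lra.
  have hf := hcont_mul_invsub h2 wQ (fun z _ => fc z).
  have hF := hcont_mul_invsub h2 wQ (fun z _ => cderivable_ccont (Fd N z)).
  have hFf := hcont_mul_invsub h2 wQ (fun z _ => ccontB (cderivable_ccont (Fd N z)) (fc z)).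
  have -> : K (F N) w - K f w =
      rectint (fun z => (F N z - f z) / (z - w)) (Re s - 1) (Re s + 1) (Im s - 1) (Im s + 1).
    apply/eqP; rewrite subr_eq; apply/eqP; rewrite -rectintD//.
    by apply: rectint_eq => // z _; rewrite -mulrDl subrK.
  have B z : rect_bnd (Re s - 1) (Re s + 1) (Im s - 1) (Im s + 1) z ->
      cabs ((F N z - f z) / (z - w)) <= e / k * 2.
    move=> Hz; rewrite cabsf ler_pM ?invr_ge0 ?cabs_ge0//.
      rewrite HN// /r.
      have /andP[/andP[a1 a2] /andP[b1 b2]] := rect_bndW Hz.
      have h : cabs (z - s) <= 2.
        rewrite (le_trans (cabs_le_ReIm _))// cReB cImB.
        have : `|Re z - Re s| <= 1 by rewrite ler_norml; apply/andP; split; lra.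
        have : `|Im z - Im s| <= 1 by rewrite ler_norml; apply/andP; split; lra.
        lra.
      by have := cabsBD z s; have := cabs_ge0 w; lra.
    have h := rect_bnd_dist wQ Hz.
    have -> : (2 : R) = (1 / 2)^-1 by rewrite invf_div divr1.
    by rewrite lef_pV2// posrE//; exact: lt_le_trans h.
  apply: (le_trans (rectint_bound x12 y12 hFf B)).
  by rewrite le_eqVlt; apply/orP; left; apply/eqP; ring.
have J0 w : cabs (w - s) < 1 / 2 -> J w != 0.
  by move=> /near_square wQ; exact: rectwind_neq0 h2 wQ.
apply: (@cderivable_near _ (fun w => K f w / J w) f s (1 / 2)) => //.
  by move=> w ws; rewrite -E// mulfK ?J0.
apply: cderivableM.
  by apply: (cauchy_integral_derivable h2 (near_square ss)) => z _; exact: fc.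
apply: cderivableV; first exact: J0.
rewrite (_ : J = fun w => rectint (fun z => 1 / (z - w))
    (Re s - 1) (Re s + 1) (Im s - 1) (Im s + 1)); last first.
  by apply/funext => w; apply: rectint_eq => // z _; rewrite div1r.
by apply: (cauchy_integral_derivable (g := fun=> 1) h2 (near_square ss)) => z _; exact: ccont_cst.
Qed.

(** The limit is the supremum of the eventual lower bounds. The conclusion carries over the rate of
    convergence, so that pointwise limits of functions inherit uniformity. *)
Lemma real_complete (u : nat -> R) :
  (forall e : R, 0 < e -> exists N, forall n, (N <= n)%N -> `|u n - u N| <= e) ->
  exists l, forall (e : R) N, (forall n, (N <= n)%N -> `|u n - u N| <= e) ->
    `|l - u N| <= e.
Proof.
move=> Hu; pose A := [set x | exists N, forall n, (N <= n)%N -> x <= u n].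
have lo e N : (forall n, (N <= n)%N -> `|u n - u N| <= e) -> A (u N - e).
  move=> H; exists N => n /H; rewrite ler_norml => /andP[? _]; lra.
have up e N : (forall n, (N <= n)%N -> `|u n - u N| <= e) -> ubound A (u N + e).
  move=> H x [M HM]; have := H (maxn M N) (leq_maxr _ _).
  rewrite ler_norml => /andP[_ ?]; have := HM (maxn M N) (leq_maxl _ _); lra.
have [N0 HN0] := Hu 1 ltr01.
exists (sup A) => e N HN; rewrite ler_norml; apply/andP; split.
  have : u N - e <= sup A.
    by apply: ub_le_sup; [exists (u N0 + 1); exact: up HN0|exact: lo].
  lra.
have : sup A <= u N + e.
  by apply: ge_sup; [exists (u N0 - 1); exact: lo HN0|exact: up].
lra.
Qed.

Lemma complex_complete (u : nat -> R[i]) :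
  (forall e : R, 0 < e -> exists N, forall n, (N <= n)%N -> cabs (u n - u N) <= e) ->
  exists l, forall (e : R) N, (forall n, (N <= n)%N -> cabs (u n - u N) <= e) ->
    cabs (l - u N) <= 2 * e.
Proof.
move=> Hu.
have [a Ha] : exists l, forall (e : R) N,
    (forall n, (N <= n)%N -> `|Re (u n) - Re (u N)| <= e) -> `|l - Re (u N)| <= e.
  apply: real_complete => e /Hu[N HN]; exists N => n /HN.
  by rewrite -cReB; exact: le_trans (Re_le_cabs _).
have [b Hb] : exists l, forall (e : R) N,
    (forall n, (N <= n)%N -> `|Im (u n) - Im (u N)| <= e) -> `|l - Im (u N)| <= e.
  apply: real_complete => e /Hu[N HN]; exists N => n /HN.
  by rewrite -cImB; exact: le_trans (Im_le_cabs _).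
exists (a +i* b) => e N HN.
rewrite (le_trans (cabs_le_ReIm _))// cReB cImB /= mulr_natl mulr2n lerD//.
  by apply: Ha => n /HN; rewrite -cReB; exact: le_trans (Re_le_cabs _).
by apply: Hb => n /HN; rewrite -cImB; exact: le_trans (Im_le_cabs _).
Qed.

Lemma entire_limit F : (forall n, centire (F n)) ->
  (forall r e : R, 0 < e -> exists N, forall n m z, (N <= n)%N -> (N <= m)%N ->
    cabs z <= r -> cabs (F n z - F m z) <= e) ->
  exists2 f, centire f & forall r e : R, 0 < e ->
    exists N, forall n z, (N <= n)%N -> cabs z <= r -> cabs (F n z - f z) <= e.
Proof.
move=> Fd Fc.
have /choice[f Hf] z : exists l, forall (e : R) N,
    (forall n, (N <= n)%N -> cabs (F n z - F N z) <= e) -> cabs (l - F N z) <= 2 * e.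
  apply: (@complex_complete (fun n => F n z)) => e e0.
  by have [N HN] := Fc (cabs z) e e0; exists N => n Nn; exact: HN.
have Ff r e : 0 < e -> exists N, forall n z, (N <= n)%N -> cabs z <= r ->
    cabs (F n z - f z) <= e.
  move=> e0; have [N HN] := Fc r (e / 2) ltac:(lra); exists N => n z Nn zr.
  rewrite cabsC (le_trans (@Hf z (e / 2) n _))//; last by lra.
  move=> m nm; apply: HN => //; exact: leq_trans nm.
by exists f => //; exact: weierstrass Ff.
Qed.

End EntireFunctions.

(** * The weight and local estimates for point values *)

Section Weight.
Variables (R : realType) (alpha : R).
Hypothesis alpha_gt0 : 0 < alpha.
Implicit Types (f : R[i] -> R[i]) (z w : R[i]).

(** With this substitute for the modulus, [log^+] is a plain logarithm and the unit disc needs no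
    separate treatment. *)
Definition mx z : R := Num.max 1 (cabs z).

Lemma mx_ge1 z : 1 <= mx z. Proof. by rewrite le_max lexx. Qed.

Lemma mx_gt0 z : 0 < mx z. Proof. exact: lt_le_trans (mx_ge1 z). Qed.

Lemma cabs_le_mx z : cabs z <= mx z. Proof. by rewrite le_max lexx orbT. Qed.

Lemma logp_mx z : logp (cabs z) = ln (mx z).
Proof.
rewrite /logp /mx; have [h|h] := lerP 1 (cabs z).
  by rewrite max_l// ln_ge0.
by rewrite ln1 max_r// ln_le0// ltW.
Qed.

Lemma weightE z : weight alpha z = alpha * ln (mx z) ^+ 2.
Proof. by rewrite /weight logp_mx. Qed.

Lemma weight_ge0 z : 0 <= weight alpha z.
Proof. by rewrite mulr_ge0 ?sqr_ge0// ltW. Qed.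

Lemma ln_mx_ge0 z : 0 <= ln (mx z).
Proof. by rewrite ln_ge0// mx_ge1. Qed.

Lemma mx_exp z : mx z = expR (ln (mx z)).
Proof. by rewrite lnK// posrE mx_gt0. Qed.

Definition fdens f (x : R * R) : R :=
  cabs (f (plane x)) ^+ 2 * expR (- (2 * weight alpha (plane x))).

Definition fint f : \bar R := (\int[planar_measure R]_(x in setT) (fdens f x)%:E)%E.

Lemma fdens_ge0 f x : 0 <= fdens f x.
Proof. by rewrite mulr_ge0 ?sqr_ge0// expR_ge0. Qed.

Lemma measurable_fdens f : (forall z, ccont f z) ->
  measurable_fun [set: (measurableTypeR R * measurableTypeR R)%type]
    (fun x => (fdens f x)%:E).
Proof.
move=> fc; apply/measurable_EFinP; apply: measurable_funM.
  by apply: measurable_funX; exact: measurable_cabs.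
apply: measurableT_comp => //; apply: measurableT_comp => //.
by apply: measurable_funM => //; exact: measurable_weight.
Qed.

Lemma fint_ge0 f : (0 <= fint f)%E.
Proof. by apply: integral_ge0 => x _; rewrite lee_fin fdens_ge0. Qed.

Let e1_gt2 : 2 <= expR 1 :> R.
Proof. by rewrite (le_trans _ (expR_ge1Dx _))//; lra. Qed.

(* Near [w] the function [expR weight] is comparable with [|z| ^ n], where [n]
   is the integer part of [2 alpha log |w|]. *)
Lemma weight_compare w : exists2 n : nat, (cabs w < 1 -> n = 0%N) &
  forall z, cabs (z - w) <= mx w / 2 -> (cabs w < 1 \/ z != 0) /\
    expR (2 * weight alpha z) * cabs (z^-1 ^+ n) ^+ 2 <=
    expR (2 * (1 + alpha)) * (expR (2 * weight alpha w) * cabs (w^-1 ^+ n) ^+ 2).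
Proof.
have [w1|w1] := ltrP (cabs w) 1.
  exists 0%N => // z zw; split; first by left.
  rewrite !expr0 cabs1 expr1n !mulr1 -expRD ler_expR.
  have mw : mx w = 1 by rewrite /mx max_l// ltW.
  have mz : mx z <= 3 / 2.
    rewrite ge_max; apply/andP; split; first lra.
    by have := cabsBD z w; rewrite mw in zw; lra.
  have lz : ln (mx z) <= 1.
    rewrite -[leRHS]expRK ler_ln ?posrE ?expR_gt0 ?mx_gt0//.
    by apply: (le_trans mz); apply: (le_trans _ e1_gt2); lra.
  have : weight alpha z <= alpha.
    rewrite weightE -[leRHS]mulr1 ler_wpM2l ?(ltW alpha_gt0)//.
    by rewrite exprn_ile1// ln_mx_ge0.
  by have := weight_ge0 w; lra.
have mw : mx w = cabs w by rewrite /mx max_r.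
have x0 : 0 <= ln (cabs w) by rewrite ln_ge0.
set x := ln (cabs w) in x0.
have a0 : 0 <= 2 * alpha * x by rewrite !mulr_ge0// ltW.
(* [2 * alpha * x] is the slope of [alpha * x ^+ 2] at [x = ln (cabs w)]. An integer exponent keeps
   the power of [z] holomorphic, and the rounding costs at most a constant factor since
   [ln (cabs z)] stays within 1 of [x]. *)
exists (Num.truncn (2 * alpha * x)) => //.
set n := Num.truncn _ => z; rewrite mw => zw.
have w0 : 0 < cabs w by lra.
have z2 : cabs w / 2 <= cabs z by have := cabsBD w z; rewrite cabsC; lra.
have z3 : cabs z <= 2 * cabs w by have := cabsBD z w; lra.
have z0 : 0 < cabs z by lra.
split; first by right; rewrite -cabs_gt0.
pose y := ln (cabs z).
have wE : cabs w = expR x by rewrite lnK// posrE.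
have zE : cabs z = expR y by rewrite lnK// posrE.
have yx : y <= x + 1.
  rewrite -ler_expR expRD -zE -wE (le_trans z3)// mulrC ler_wpM2l//; lra.
have xy : x <= y + 1.
  rewrite -ler_expR expRD -zE -wE; have := e1_gt2; nra.
have n1 : n%:R <= 2 * alpha * x by rewrite truncn_le.
have n2 : 2 * alpha * x < n%:R + 1 by rewrite natr1 truncnS_gt.
have powE (t : R[i]) (u : R) : cabs t = expR u -> cabs (t^-1 ^+ n) ^+ 2 = expR (- (2 * (n%:R * u))).
  move=> tE; rewrite cabsX cabsV tE -expRN -!expRM_natl; congr expR; ring.
rewrite (powE _ _ zE) (powE _ _ wE) -!expRD ler_expR.
have wzE : weight alpha z <= alpha * y ^+ 2.
  rewrite /weight /logp -/y ler_wpM2l ?(ltW alpha_gt0)//; case: (lerP y 0) => h.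
    by rewrite expr0n sqr_ge0.
  by rewrite lexx.
have wwE : weight alpha w = alpha * x ^+ 2 by rewrite weightE mw.
rewrite wwE.
have h1 : (2 * alpha * x - n%:R) * (y - x) <= 1.
  have u0 : 0 <= 2 * alpha * x - n%:R by rewrite subr_ge0.
  have [h|h] := lerP y x.
    by rewrite (@le_trans _ _ 0)// mulr_ge0_le0// subr_le0.
  rewrite -[leRHS]mulr1 ler_pM//; move: n2 yx h; clear; lra.
have h2 : alpha * (y - x) ^+ 2 <= alpha.
  rewrite -[leRHS]mulr1 ler_wpM2l ?(ltW alpha_gt0)//.
  rewrite -subr_ge0; have -> : 1 - (y - x) ^+ 2 = (1 - (y - x)) * (1 + (y - x)) by ring.
  by rewrite mulr_ge0//; move: yx xy; clear; lra.
have -> : 2 * (1 + alpha) + (2 * (alpha * x ^+ 2) + - (2 * (n%:R * x))) =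
  2 * ((1 + alpha) + alpha * x ^+ 2 - n%:R * x) by ring.
have : alpha * y ^+ 2 - n%:R * y = alpha * x ^+ 2 - n%:R * x +
  (2 * alpha * x - n%:R) * (y - x) + alpha * (y - x) ^+ 2 by ring.
lra.
Qed.

(** The weight is traded for a power of [z]: [area_mean_value] is applied to
    [(f z * z^-1 ^+ n) ^+ 2], whose modulus on the square is at most [K] times the density, with a
    matching size at [w]. The bound [d <= 1 / 4] keeps the square in the disc of
    [weight_compare]. *)
Lemma local_estimate (d : R) : 0 < d -> d <= 1 / 4 -> exists2 C : R, 0 < C &
  forall f w, centire f ->
  ((cabs (f w) ^+ 2 * expR (- (2 * weight alpha w)) * mx w ^+ 2)%:E <=
   C%:E * \int[planar_measure R]_(x in sqr w (d * mx w)) (fdens f x)%:E)%E.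
Proof.
move=> d0 d1; pose C0 := expR (2 * (1 + alpha)).
exists (32 * C0 * (2 / d) ^+ 2).
  by rewrite /C0 !mulr_gt0 ?expR_gt0 ?invr_gt0.
move=> f w fd; have fc z := cderivable_ccont (fd z).
have [n n0 Hn] := weight_compare w.
have mw := mx_gt0 w.
set r := d * mx w / 2; have r0 : 0 < r by rewrite divr_gt0// mulr_gt0.
pose F z := (f z * (z^-1) ^+ n) ^+ 2.
pose K := C0 * (expR (2 * weight alpha w) * cabs (w^-1 ^+ n) ^+ 2).
have r2 : 2 * r = d * mx w by rewrite /r; field.
have zw z : in_rect (Re w - 2 * r) (Re w + 2 * r) (Im w - 2 * r) (Im w + 2 * r) z ->
    cabs (z - w) <= mx w / 2.
  move=> /andP[/andP[z1 z2] /andP[z3 z4]].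
  rewrite (le_trans (cabs_le_ReIm _))// cReB cImB.
  have : `|Re z - Re w| <= d * mx w by rewrite ler_norml; apply/andP; split; lra.
  have : `|Im z - Im w| <= d * mx w by rewrite ler_norml; apply/andP; split; lra.
  have : d * mx w <= 1 / 4 * mx w by rewrite ler_wpM2r// ltW.
  lra.
have Fd z : in_rect (Re w - 2 * r) (Re w + 2 * r) (Im w - 2 * r) (Im w + 2 * r) z ->
    cderivable F z.
  move=> /zw /Hn[zw0 _]; apply: cderivableX; apply: cderivableM; first exact: fd.
  case: zw0 => [/n0 ->|z0]; first exact: (cderivable_cst 1).
  by apply: cderivableX; apply: cderivableV => //; exact: cderivable_id.
pose h (x : R * R) : \bar R := (K * fdens f x)%:E.
have K0 : 0 <= K by rewrite !mulr_ge0 ?expR_ge0 ?exprn_ge0 ?cabs_ge0.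
have mh : measurable_fun [set: (measurableTypeR R * measurableTypeR R)%type] h.
  apply/measurable_EFinP; apply: measurable_funM => //.
  by apply/measurable_EFinP; exact: measurable_fdens.
have h0 x : (0 <= h x)%E by rewrite lee_fin mulr_ge0// fdens_ge0.
have Fh x : sqr w (2 * r) x -> ((cabs (F (plane x)))%:E <= h x)%E.
  case: x => x y [/=]; rewrite !in_itv/= => xx yy; rewrite lee_fin.
  have /zw/Hn[_ H] : in_rect (Re w - 2 * r) (Re w + 2 * r) (Im w - 2 * r) (Im w + 2 * r)
      (plane (x, y)) by rewrite /in_rect /plane /= xx yy.
  rewrite /F cabsX cabsM exprMn /fdens [leRHS]mulrCA ler_wpM2l ?exprn_ge0 ?cabs_ge0//.
  by rewrite expRN ler_pdivlMr ?expR_gt0// mulrC.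
have := @area_mean_value R F w r h r0 Fd mh h0 Fh.
rewrite r2 => B.
set I := (\int[planar_measure R]_(x in sqr w (d * mx w)) (fdens f x)%:E)%E.
have IE : (\int[planar_measure R]_(x in sqr w (d * mx w)) h x = K%:E * I)%E.
  under eq_integral do rewrite /h EFinM.
  rewrite ge0_integralZl_EFin//.
  - exact: measurable_sqr.
  - by move=> x _; rewrite lee_fin fdens_ge0.
  - by apply: measurable_funTS; exact: measurable_fdens.
rewrite IE in B.
have P0 : 0 < expR (2 * weight alpha w) * cabs (w^-1 ^+ n) ^+ 2.
  rewrite mulr_gt0 ?expR_gt0// exprn_gt0// cabs_gt0.
  have [h1|h1] := ltrP (cabs w) 1; first by rewrite n0// expr0 oner_neq0.
  by rewrite expf_neq0// invr_neq0// -cabs_gt0; lra.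
set P := expR (2 * weight alpha w) * _ in K P0 h K0 mh h0 Fh IE B.
have I0 : (0 <= I)%E by apply: integral_ge0 => x _; rewrite lee_fin fdens_ge0.
have -> : cabs (f w) ^+ 2 * expR (- (2 * weight alpha w)) * mx w ^+ 2 =
    ((2 / d) ^+ 2 / P) * (r ^+ 2 * cabs (F w)).
  rewrite /F cabsX cabsM exprMn /P /r expRN.
  have c0 : cabs (w^-1 ^+ n) != 0.
    by move: P0; rewrite /P; apply: contraTneq => ->; rewrite expr0n mulr0 ltxx.
  have e0 : expR (2 * weight alpha w) != 0 by rewrite gt_eqF ?expR_gt0.
  by field; rewrite c0 e0 gt_eqF.
rewrite EFinM.
have PP : 0 <= (2 / d) ^+ 2 / P by rewrite divr_ge0 ?exprn_ge0 ?divr_ge0// ltW.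
apply: (le_trans (lee_wpmul2l _ B)); first by rewrite lee_fin.
rewrite !muleA -!EFinM.
have -> : (2 / d) ^+ 2 / P * 32 * K = 32 * C0 * (2 / d) ^+ 2.
  by rewrite /K; field; rewrite !gt_eqF.
by [].
Qed.

Lemma point_estimate : exists2 C : R, 0 < C & forall f w, centire f ->
  ((cabs (f w) ^+ 2 * expR (- (2 * weight alpha w)) * mx w ^+ 2)%:E <=
   C%:E * fint f)%E.
Proof.
have [C C0 HC] := @local_estimate (1 / 4) ltac:(lra) ltac:(lra).
exists C => // f w fd; apply: (le_trans (HC f w fd)).
rewrite lee_wpmul2l//; first by rewrite lee_fin ltW.
apply: ge0_subset_integral => //.
- exact: measurable_sqr.
- by apply: measurable_fdens => z; exact: cderivable_ccont.
- by move=> x _; rewrite lee_fin fdens_ge0.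
Qed.

Lemma fock_normE f : fock_norm alpha exp_two f = sqrte (fint f).
Proof. by []. Qed.

End Weight.

(** * The Hilbert space and its reproducing kernel *)

Section FockKernel.
Variables (R : realType) (alpha : R).
Hypothesis alpha_gt0 : 0 < alpha.
Notation lam := (planar_measure R).
Notation PT := ((measurableTypeR R * measurableTypeR R)%type).
Implicit Types (f g h : R[i] -> R[i]) (z w : R[i]) (x : R * R).

Definition fock2 f := centire f /\ (fint alpha f < +oo)%E.

Lemma fock2P f : fock alpha exp_two f <-> fock2 f.
Proof.
rewrite /fock /= entireP /fock_norm -/(fint alpha f).
have := fint_ge0 alpha f; rewrite /fock2.
by case: (fint alpha f) => [r| |] //= _; rewrite ?ltry.
Qed.

Definition nrm f : R := fine (fint alpha f).

Lemma nrm_ge0 f : 0 <= nrm f.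
Proof. by rewrite fine_ge0// fint_ge0. Qed.

Lemma fintE f : fock2 f -> fint alpha f = (nrm f)%:E.
Proof. by move=> [_ h]; rewrite fineK// ge0_fin_numE// fint_ge0. Qed.

Definition wgt x : R := expR (- (2 * weight alpha (plane x))).

Lemma measurable_wgt : measurable_fun [set: PT] (wgt : PT -> measurableTypeR R).
Proof.
apply: measurableT_comp => //; apply: measurableT_comp => //.
by apply: measurable_funM => //; exact: measurable_weight.
Qed.

Lemma fdens_integrable f : fock2 f -> lam.-integrable setT (EFin \o fdens alpha f).
Proof.
move=> [fd foo]; have mf := measurable_fdens alpha (fun z => cderivable_ccont (fd z)).
apply/integrableP; split=> //; rewrite (le_lt_trans _ foo)//.
rewrite le_eqVlt; apply/orP; left; apply/eqP; apply: eq_integral => x _ /=.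
by rewrite ger0_norm// fdens_ge0.
Qed.

(** The real part of [f] times the conjugate of [g], with the weight. The imaginary part is
    recovered by replacing [g] with ['i * g], so one real inner product suffices for [fock_dot]. *)
Definition rprod f g x : R :=
  (Re (f (plane x)) * Re (g (plane x)) + Im (f (plane x)) * Im (g (plane x))) * wgt x.

Lemma measurable_rprod f g : centire f -> centire g ->
  measurable_fun [set: PT] (rprod f g : PT -> measurableTypeR R).
Proof.
move=> fd gd; have fc z := cderivable_ccont (fd z); have gc z := cderivable_ccont (gd z).
apply: measurable_funM; last exact: measurable_wgt.
by apply: measurable_funD; apply: measurable_funM;
  solve [exact: measurable_Re|exact: measurable_Im].
Qed.

Lemma rprod_integrable f g : fock2 f -> fock2 g ->
  lam.-integrable setT (EFin \o rprod f g).
Proof.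
move=> Hf Hg; have H := integrableD measurableT (fdens_integrable Hf) (fdens_integrable Hg).
apply: le_integrable H => //.
  by apply/measurable_EFinP; apply: measurable_rprod; [case: Hf|case: Hg].
move=> x _ /=; rewrite lee_fin [leRHS]ger0_norm ?addr_ge0 ?fdens_ge0//.
rewrite /rprod /fdens -/(wgt x) normrM [X in _ * X <= _]ger0_norm ?expR_ge0//.
rewrite -mulrDl ler_wpM2r ?expR_ge0// !sqr_cabs ler_norml.
set a := Re _; set b := Im _; set c := Re _; set d := Im _.
have := sqr_ge0 (a - c); have := sqr_ge0 (a + c); have := sqr_ge0 (b - d).
have := sqr_ge0 (b + d); have := sqr_ge0 a; have := sqr_ge0 b.
have := sqr_ge0 c; have := sqr_ge0 d; rewrite !sqrrD !sqrrN !mulrN.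
by clear; set p := a * c; set q := b * d; move=> *; apply/andP; split; lra.
Qed.

Definition rdot f g : R := Rintegral lam setT (rprod f g).

Lemma rdot_id f : fock2 f -> rdot f f = nrm f.
Proof.
move=> Hf; rewrite /rdot /Rintegral /nrm; congr fine; apply: eq_integral => x _.
by rewrite /rprod /fdens -/(wgt x) sqr_cabs !expr2.
Qed.

Lemma rdotC f g : rdot f g = rdot g f.
Proof.
apply: eq_Rintegral => x _; rewrite /rprod; congr (_ * _).
by rewrite mulrC; congr (_ + _); rewrite mulrC.
Qed.

Lemma fock2_lin (c : R[i]) f g : fock2 f -> fock2 g -> fock2 (fun z => f z + c * g z).
Proof.
move=> Hf Hg; have [[fd foo] [gd goo]] := (Hf, Hg).
have hd : centire (fun z => f z + c * g z).
  by move=> z; apply: cderivableD => //; apply: cderivableM => //; exact: cderivable_cst.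
split=> //; have mh := measurable_fdens alpha (fun z => cderivable_ccont (hd z)).
have H := integrableD measurableT (integrableZl measurableT 2 (fdens_integrable Hf))
  (integrableZl measurableT (2 * cabs c ^+ 2) (fdens_integrable Hg)).
have /integrableP[_] : lam.-integrable setT (EFin \o fdens alpha (fun z => f z + c * g z)).
  apply: le_integrable H => // x _ /=; rewrite lee_fin.
  rewrite !ger0_norm ?fdens_ge0//; last first.
    by rewrite addr_ge0 ?mulr_ge0 ?fdens_ge0 ?exprn_ge0 ?cabs_ge0.
  rewrite /fdens !mulrA -mulrDl ler_wpM2r ?expR_ge0//.
  have := cabsD (f (plane x)) (c * g (plane x)); rewrite cabsM.
  have := cabs_ge0 (f (plane x)); have := cabs_ge0 (f (plane x) + c * g (plane x)).
  have := cabs_ge0 c; have := cabs_ge0 (g (plane x)).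
  set a := cabs (f _ + _); set b := cabs (f _); set u := cabs c; set v := cabs _.
  move=> v0 u0 a0 b0 ab; have uv : 0 <= u * v by rewrite mulr_ge0.
  have : a ^+ 2 <= (b + u * v) ^+ 2 by rewrite lerXn2r// nnegrE// addr_ge0.
  have -> : 2 * b * b + 2 * u * u * v * v = 2 * b ^+ 2 + 2 * (u * v) ^+ 2 by ring.
  have := sqr_ge0 (b - u * v); rewrite !sqrrD sqrrN mulrN.
  by move: (b * (u * v)); clear => q *; lra.
apply: le_lt_trans; rewrite le_eqVlt; apply/orP; left; apply/eqP.
by apply: eq_integral => x _ /=; rewrite ger0_norm// fdens_ge0.
Qed.

Lemma fock2_0 : fock2 (fun=> 0).
Proof.
split; first by move=> z; exact: cderivable_cst.
rewrite /fint (eq_integral (fun=> 0%E)) ?integral0 ?ltry// => x _.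
by rewrite /fdens cabs0 expr0n mul0r.
Qed.

Lemma fock2Z (c : R[i]) f : fock2 f -> fock2 (fun z => c * f z).
Proof.
move=> Hf; rewrite (_ : (fun z => _) = (fun z => 0 + c * f z)).
  exact: (fock2_lin c fock2_0 Hf).
by apply/funext => z; rewrite add0r.
Qed.

Lemma rdotD f g h : fock2 f -> fock2 g -> fock2 h ->
  rdot (fun z => f z + g z) h = rdot f h + rdot g h.
Proof.
move=> Hf Hg Hh; rewrite /rdot -RintegralD//; [|exact: rprod_integrable..].
by apply: eq_Rintegral => x _; rewrite /rprod cReD cImD; ring.
Qed.

Lemma rdotZ (t : R) f h : fock2 f -> fock2 h ->
  rdot (fun z => t%:C * f z) h = t * rdot f h.
Proof.
move=> Hf Hh; rewrite /rdot -RintegralZl//; last exact: rprod_integrable.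
by apply: eq_Rintegral => x _; rewrite /rprod cReM cImM /=; ring.
Qed.

Lemma nrm_lin (t : R) f g : fock2 f -> fock2 g ->
  nrm (fun z => f z + t%:C * g z) = nrm f + 2 * t * rdot f g + t ^+ 2 * nrm g.
Proof.
move=> Hf Hg; have Hz := fock2Z t%:C Hg; have Hl := fock2_lin t%:C Hf Hg.
have E h : fock2 h -> rdot (fun z => f z + t%:C * g z) h = rdot f h + t * rdot g h.
  by move=> Hh; rewrite rdotD// rdotZ.
rewrite -!rdot_id// E// (rdotC f (fun z => _)) (rdotC g (fun z => _)) !E// (rdotC g f).
ring.
Qed.

Lemma nrmZ (t : R) g : fock2 g -> nrm (fun z => t%:C * g z) = t ^+ 2 * nrm g.
Proof.
move=> Hg; have Hz := fock2Z t%:C Hg.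
by rewrite -!rdot_id// rdotZ// rdotC rdotZ// rdot_id// mulrA expr2.
Qed.

Lemma fock_dotE f g : fock_dot alpha f g = rdot f g +i* rdot f (fun z => 'i%C * g z).
Proof.
rewrite /fock_dot; congr (_ +i* _); apply: eq_Rintegral => x _;
  rewrite ?cReM ?cImM ?mulr0 ?subr0 ?add0r /rprod /wgt /=;
  case: (f (plane x)) => a b; case: (g (plane x)) => c d /=; ring.
Qed.

Lemma fock_point : exists2 C : R, 0 < C & forall f w, fock2 f ->
  cabs (f w) ^+ 2 * expR (- (2 * weight alpha w)) * mx w ^+ 2 <= C * nrm f.
Proof.
have [C C0 HC] := point_estimate alpha_gt0; exists C => // f w Hf.
by have := HC f w (proj1 Hf); rewrite fintE// -EFinM lee_fin.
Qed.

Lemma fock_point_unif (r : R) : exists2 C : R, 0 < C & forall f w, fock2 f ->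
  cabs w <= r -> cabs (f w) ^+ 2 <= C * nrm f.
Proof.
have [C C0 HC] := fock_point.
exists (C * expR (2 * (alpha * ln (Num.max 1 r) ^+ 2))); first by rewrite mulr_gt0 ?expR_gt0.
move=> f w Hf wr; have := HC f w Hf.
have m1 := mx_ge1 w; rewrite -mulrA.
have W0 : 0 < expR (- (2 * weight alpha w)) by exact: expR_gt0.
have : expR (- (2 * (alpha * ln (Num.max 1 r) ^+ 2))) <=
    expR (- (2 * weight alpha w)) * mx w ^+ 2.
  apply: (@le_trans _ _ (expR (- (2 * weight alpha w)))); last first.
    by rewrite -[leLHS]mulr1 ler_wpM2l ?(ltW W0)// exprn_ege1.
  rewrite ler_expR lerN2 ler_wpM2l// weightE ler_wpM2l ?(ltW alpha_gt0)//.
  apply: lerXn2r; rewrite ?nnegrE ?ln_mx_ge0//.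
    by rewrite ln_ge0// le_max lexx.
  rewrite ler_ln ?posrE ?mx_gt0//; last by rewrite lt_max ltr01.
  by rewrite ge_max !le_max lexx/= wr orbT.
set E := expR (2 * _); rewrite expRN -/E; have E0 : 0 < E by exact: expR_gt0.
move: (_ * mx w ^+ 2) => u Eu h.
rewrite -mulrA mulrCA -ler_pdivrMl// mulrC; apply: le_trans h.
by rewrite ler_wpM2l// exprn_ge0// cabs_ge0.
Qed.

Let real_le_eps (a b : R) : (forall e : R, 0 < e -> a <= b + e) -> a <= b.
Proof. by move=> H; apply/ler_addgt0Pr. Qed.

Let inv_nat_lt (e : R) : 0 < e -> exists N, forall n, (N <= n)%N -> n.+1%:R^-1 <= e.
Proof.
move=> e0; have e1 : 0 < e^-1 by rewrite invr_gt0.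
exists (Num.bound e^-1) => n Nn.
rewrite -[leRHS]invrK lef_pV2 ?posrE//; apply: ltW.
by apply: lt_le_trans (archi_boundP (ltW e1)) _; rewrite ler_nat (leq_trans Nn).
Qed.

(** Lower semicontinuity of the norm under pointwise convergence. It puts into the space both the
    limit of a minimising sequence and the sum of an interpolation series. *)
Lemma fint_fatou (F : nat -> R[i] -> R[i]) f (S : R) : (forall n, centire (F n)) ->
  (forall z (e : R), 0 < e -> exists N, forall n, (N <= n)%N -> cabs (F n z - f z) <= e) ->
  (exists N, forall n, (N <= n)%N -> (fint alpha (F n) <= S%:E)%E) ->
  (fint alpha f <= S%:E)%E.
Proof.
move=> Fd Ff [N0 HN0].
have fcv x : (fdens alpha (F (n + N0)%N) x)%:E @[n --> \oo] --> (fdens alpha f x)%:E.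
  apply: cvg_EFin; first by near=> n.
  apply: cvgMl; rewrite expr2; under eq_fun do rewrite expr2.
  have c1 : cabs (F (n + N0)%N (plane x)) @[n --> \oo] --> cabs (f (plane x)).
    apply/cvgrPdist_le => e /(Ff (plane x))[N HN].
    exists N => // n Nn; rewrite distrC (le_trans (cabs_lip _ _))//.
    by apply: HN; rewrite (leq_trans Nn)// leq_addr.
  exact: cvgM.
have mfn n : measurable_fun [set: PT] (fun x => (fdens alpha (F (n + N0)%N) x)%:E).
  by apply: measurable_fdens => z; exact/cderivable_ccont/Fd.
have := @fatou _ _ _ lam setT measurableT (fun n x => (fdens alpha (F (n + N0)%N) x)%:E) mfn
  (fun n x _ => fdens_ge0 alpha (F (n + N0)%N) x).
have -> : (\int[lam]_(x in setT) limn_einf (fun n => (fdens alpha (F (n + N0)%N) x)%:E) =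
    fint alpha f)%E.
  by apply: eq_integral => x _; rewrite (cvg_limn_einf_sup (fcv x)).1.
move/le_trans; apply; rewrite limn_einf_lim; apply: lime_le; first exact: is_cvg_einfs.
near=> n; apply: (@le_trans _ _ (fint alpha (F (n + N0)%N))).
  by apply: ereal_inf_lbound; exists n => //=.
by apply: HN0; exact: leq_addl.
Unshelve. all: by end_near.
Qed.

(* The reproducing kernel is a multiple of the element of least norm taking the
   value 1 at [w]. *)
Lemma min_exists w f0 : fock2 f0 -> f0 w != 0 ->
  exists f, [/\ fock2 f, f w = 1 & forall g, fock2 g -> g w = 1 -> nrm f <= nrm g].
Proof.
move=> Hf0 f0w; pose A := [set r | exists2 g, fock2 g & g w = 1 /\ r = nrm g].
have Ainf : has_inf A.
  split; last by exists 0 => _ [g _ [_ ->]]; exact: nrm_ge0.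
  exists (nrm (fun z => (f0 w)^-1 * f0 z)); exists (fun z => (f0 w)^-1 * f0 z).
    exact: fock2Z.
  by rewrite mulVf.
set m := inf A; have mle g : fock2 g -> g w = 1 -> m <= nrm g.
  by move=> Hg gw; apply: ge_inf; [case: Ainf|exists g].
have /choice[F HF] (n : nat) : exists f, [/\ fock2 f, f w = 1 & nrm f < m + n.+1%:R^-1].
  have [|_ [g Hg [gw ->]] h] := @inf_adherent R A n.+1%:R^-1 _ Ainf; first by rewrite invr_gt0.
  by exists g.
(* Parallelogram law: the half sum takes the value 1 at [w], so its squared norm is at least [m],
   which leaves little for the difference. *)
have par n k : nrm (fun z => F n z + (- 1)%:C * F k z) <= 2 * (n.+1%:R^-1 + k.+1%:R^-1).
  have [[a1 a2 a3] [b1 b2 b3]] := (HF n, HF k).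
  have Hs : fock2 (fun z => F n z + 1%:C * F k z) by exact: fock2_lin.
  have := mle (fun z => (1 / 2)%:C * (F n z + 1%:C * F k z)) (fock2Z _ Hs).
  rewrite nrmZ// !nrm_lin// a2 b2.
  have -> : (1 / 2)%:C * (1 + 1%:C * 1) = 1 :> R[i].
    by apply: complexP; rewrite /= ?(mulr0, mul0r, addr0, subr0, mulr1); field.
  by move=> /(_ erefl); move: a3 b3; set u := n.+1%:R^-1; set v := k.+1%:R^-1; clear; lra.
have subE n k z : F n z - F k z = F n z + (- 1)%:C * F k z.
  by rewrite rmorphN rmorph1 mulN1r.
have [|f fd Ff] := @entire_limit R F (fun n => let: And3 H _ _ := HF n in proj1 H).
  move=> r e e0; have [C C0 HC] := fock_point_unif r.
  have [N HN] := inv_nat_lt (divr_gt0 (exprn_gt0 2 e0) (mulr_gt0 (ltr0n R 4) C0)).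
  exists N => n k z Nn Nk zr.
  have [a1 _ _] := HF n; have [b1 _ _] := HF k.
  rewrite -(@ler_pXn2r _ 2)// ?nnegrE ?cabs_ge0 ?(ltW e0)//.
  rewrite subE (le_trans (HC _ z (fock2_lin _ a1 b1) zr))//.
  rewrite -ler_pdivlMl// (le_trans (par n k))//.
  have := HN _ Nn; have := HN _ Nk; set u := n.+1%:R^-1; set v := k.+1%:R^-1.
  have -> : e ^+ 2 / (4 * C) = (C^-1 * e ^+ 2) / 4 by field; rewrite gt_eqF.
  by clear; lra.
have fw : f w = 1.
  apply/eqP; rewrite -subr_eq0 -cabs_eq0 eq_le cabs_ge0 andbT.
  apply: real_le_eps => e e0; rewrite add0r.
  have [N HN] := Ff (cabs w) e e0; have := HN N w (leqnn N) (lexx _).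
  by have [_ -> _] := HF N; rewrite cabsC.
have fle : (fint alpha f <= m%:E)%E.
  apply/lee_addgt0Pr => e /inv_nat_lt[N HN]; rewrite -EFinD.
  apply: (@fint_fatou F f).
  - by move=> n; have [[]] := HF n.
  - move=> z e' e0; have [N' HN'] := Ff (cabs z) e' e0.
    by exists N' => n Nn; exact: HN'.
  exists N => n Nn; have [h1 _ h3] := HF n; rewrite fintE// lee_fin.
  by apply: (le_trans (ltW h3)); rewrite lerD2l HN.
have Hf : fock2 f by split => //; rewrite (le_lt_trans fle) ?ltry.
exists f; split => // g Hg gw; apply: le_trans (mle g Hg gw).
by rewrite -lee_fin -fintE.
Qed.

(** Tested at [t = - A / (N + 1)], where the denominator is positive even if [N = 0]. *)
Let quad_zero (A N : R) : 0 <= N -> (forall t : R, 0 <= 2 * t * A + t ^+ 2 * N) -> A = 0.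
Proof.
move=> N0 H; apply/eqP; rewrite -sqrf_eq0 eq_le sqr_ge0 andbT.
have N1 : 0 < N + 1 by lra.
have := H (- A / (N + 1)).
have -> : 2 * (- A / (N + 1)) * A + (- A / (N + 1)) ^+ 2 * N =
  - (A ^+ 2 * ((N + 2) / (N + 1) ^+ 2)) by field; rewrite gt_eqF.
rewrite oppr_ge0 pmulr_lle0// divr_gt0 ?exprn_gt0//; lra.
Qed.

(** Minimality makes [f] orthogonal to the functions vanishing at [w], first for the real inner
    product and then, since these functions are stable under multiplication by ['i], for the complex
    one. Any [F] is [F w] times [f] plus such a function. If every function of the space vanishes at
    [w], the kernel is zero. *)
Lemma kernel_exists w : exists k, fock2 k /\
  forall f, fock2 f -> f w = fock_dot alpha f k.
Proof.
have [[f0 [Hf0 f0w]]|/forallNP none] := pselect (exists f0, fock2 f0 /\ f0 w != 0); last first.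
  exists (fun=> 0); split; first exact: fock2_0.
  move=> f Hf; have : f w = 0.
    by apply/eqP; apply: contrapT => /negP fw; apply: (none f).
  move=> ->; rewrite fock_dotE; have z0 : rdot f (fun=> 0) = 0.
    rewrite rdotC -[RHS](mul0r (rdot (fun=> 0) f)) -(rdotZ 0 fock2_0 Hf).
    by congr rdot; apply/funext => z; rewrite mulr0.
  rewrite z0 (_ : (fun z => _) = (fun=> 0)) ?z0//.
  by apply/funext => z; rewrite mulr0.
have [f [Hf fw fmin]] := min_exists Hf0 f0w.
have N0 : 0 < nrm f.
  have [C C0 HC] := fock_point; have := HC f w Hf; rewrite fw cabs1 expr1n mul1r.
  have : 0 < expR (- (2 * weight alpha w)) * mx w ^+ 2.
    by rewrite mulr_gt0 ?expR_gt0// exprn_gt0// mx_gt0.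
  by move=> h1 h2; rewrite -(pmulr_rgt0 _ C0); exact: lt_le_trans h2.
have orth g : fock2 g -> g w = 0 -> rdot g f = 0.
  move=> Hg gw; rewrite rdotC; apply: (quad_zero (nrm_ge0 g)) => t.
  have := fmin _ (fock2_lin t%:C Hf Hg); rewrite gw mulr0 addr0 nrm_lin// => /(_ fw).
  by rewrite -addrA lerDl.
have orthi g : fock2 g -> g w = 0 -> rdot g (fun z => 'i%C * f z) = 0.
  move=> Hg gw; have Hig := fock2Z 'i%C Hg.
  have := orth _ Hig; rewrite gw mulr0 => /(_ erefl) E.
  transitivity (rdot (fun z => (- 1)%:C * ('i%C * g z)) f); last by rewrite rdotZ// E mulr0.
  apply: eq_Rintegral => x _; rewrite /rprod !(cReM, cImM) /=; ring.
have rii : rdot f (fun z => 'i%C * f z) = 0.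
  transitivity (Rintegral lam setT (fun=> 0 : R)); last by rewrite Rintegral_cst// mul0r.
  by apply: eq_Rintegral => x _; rewrite /rprod !(cReM, cImM) /=; ring.
exists (fun z => ((nrm f)^-1)%:C * f z); split; first exact: fock2Z.
move=> F HF; pose g z := F z + (- F w) * f z.
have Hg : fock2 g by exact: fock2_lin.
have gw : g w = 0 by rewrite /g fw mulr1 subrr.
have Hif := fock2Z 'i%C Hf.
have FE : F = fun z => (g z + (Re (F w))%:C * f z) + (Im (F w))%:C * ('i%C * f z).
  apply/funext => z; rewrite /g -!addrA -[LHS]addr0; congr (_ + _).
  rewrite mulrA mulNr -mulrDl [(Im _)%:C * _]mulrC -[X in _ + X * _]complexE.
  by rewrite addrC subrr.
have rif : rdot (fun z => 'i%C * f z) f = 0 by rewrite rdotC.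
have riif : rdot (fun z => 'i%C * f z) (fun z => 'i%C * f z) = nrm f.
  rewrite -rdot_id//; apply: eq_Rintegral => x _; rewrite /rprod !(cReM, cImM) /=; ring.
have Hs := fock2_lin (Re (F w))%:C Hg Hf; have Hrf := fock2Z (Re (F w))%:C Hf.
have Hiif := fock2Z (Im (F w))%:C Hif.
have E1 : rdot F f = Re (F w) * nrm f.
  rewrite [in LHS]FE (rdotD Hs Hiif Hf) (rdotD Hg Hrf Hf) (rdotZ _ Hf Hf).
  by rewrite (rdotZ _ Hif Hf) (orth g Hg gw) rif (rdot_id Hf) mulr0 add0r addr0.
have E2 : rdot F (fun z => 'i%C * f z) = Im (F w) * nrm f.
  rewrite [in LHS]FE (rdotD Hs Hiif Hif) (rdotD Hg Hrf Hif) (rdotZ _ Hf Hif).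
  by rewrite (rdotZ _ Hif Hif) (orthi g Hg gw) rii riif mulr0 add0r add0r.
rewrite fock_dotE; apply: complexP => /=.
  by rewrite rdotC rdotZ// rdotC E1 mulrCA mulVf ?mulr1// gt_eqF.
rewrite (_ : (fun z => _) = (fun z => ((nrm f)^-1)%:C * ('i%C * f z))); last first.
  by apply/funext => z; rewrite mulrCA.
by rewrite rdotC rdotZ// rdotC E2 mulrCA mulVf ?mulr1// gt_eqF.
Qed.

Lemma fock_kernelP w : fock2 (fock_kernel alpha w) /\
  forall f, fock2 f -> f w = fock_dot alpha f (fock_kernel alpha w).
Proof.
have [k [Hk kP]] := kernel_exists w.
have [|h1 h2] := @xgetPex (R[i] -> R[i]) (fun=> 0) [set k | fock alpha exp_two k /\
    forall f, fock alpha exp_two f -> f w = fock_dot alpha f k].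
  by exists k; split; [exact/fock2P|move=> f /fock2P; exact: kP].
by split; [exact/fock2P|move=> f /fock2P; exact: h2].
Qed.

Lemma kernel_diag w : Re (fock_kernel alpha w w) = nrm (fock_kernel alpha w).
Proof.
have [Hk kP] := fock_kernelP w.
by rewrite [in LHS](kP _ Hk) fock_dotE /= rdot_id.
Qed.

Lemma kernel_ge0 w : 0 <= Re (fock_kernel alpha w w).
Proof. by rewrite kernel_diag nrm_ge0. Qed.

(** The point estimate applied to the kernel itself, whose squared norm is its diagonal value; one
    factor cancels. *)
Lemma kernel_upper : exists2 C : R, 0 < C & forall w,
  Re (fock_kernel alpha w w) * (expR (- (2 * weight alpha w)) * mx w ^+ 2) <= C.
Proof.
have [C C0 HC] := fock_point; exists C => // w.
have [Hk kP] := fock_kernelP w; have := HC _ w Hk.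
have := Re_le_cabs (fock_kernel alpha w w).
have := kernel_ge0 w; rewrite -kernel_diag.
set k := Re _ => k0; rewrite ger0_norm// => kc h.
have [->|kn0] := eqVneq k 0; first by rewrite mul0r ltW.
have kp : 0 < k by rewrite lt_def kn0.
rewrite -(ler_pM2l kp) [leRHS]mulrC; apply: le_trans h.
rewrite -[leRHS]mulrA [leLHS]mulrA; apply: ler_wpM2r.
  by rewrite mulr_ge0 ?expR_ge0// exprn_ge0// ltW// mx_gt0.
by rewrite -expr2 lerXn2r// nnegrE ?cabs_ge0.
Qed.

Lemma rdot_le (t : R) f g : 0 < t -> fock2 f -> fock2 g ->
  2 * `|rdot f g| <= t * nrm f + t^-1 * nrm g.
Proof.
move=> t0 Hf Hg.
have pos (s : R) : 0 <= t * nrm f + t^-1 * nrm g + 2 * s * rdot f g -> True by [].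
have tt : t * t^-1 = 1 by rewrite mulfV// gt_eqF.
have key (s : R) : s ^+ 2 = 1 -> 0 <= t * nrm f + 2 * s * rdot f g + t^-1 * nrm g.
  move=> s1; have := nrm_ge0 (fun z => f z + (s * t^-1)%:C * g z).
  rewrite nrm_lin// exprMn s1 mul1r => /(mulr_ge0 (ltW t0)).
  have -> : t * (nrm f + 2 * (s / t) * rdot f g + t^-1 ^+ 2 * nrm g) =
    t * nrm f + 2 * s * rdot f g + t^-1 * nrm g by field; rewrite gt_eqF.
  by [].
have := key 1 (expr1n _ _); have := key (- 1) ltac:(by rewrite sqrrN expr1n).
by have [h|h] := ger0P (rdot f g); lra.
Qed.

(** Cauchy-Schwarz for the pairing with the kernel; the 4 comes from treating real and imaginary
    part separately. Applied to a function of small norm with [f w = 1], it bounds the diagonal from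
    below. *)
Lemma kernel_lower w f : fock2 f ->
  cabs (f w) ^+ 2 <= 4 * Re (fock_kernel alpha w w) * nrm f.
Proof.
move=> Hf; have [Hk kP] := fock_kernelP w.
rewrite kernel_diag; set k := fock_kernel alpha w in Hk kP *.
have Hik := fock2Z 'i%C Hk.
have nik : nrm (fun z => 'i%C * k z) = nrm k.
  rewrite -!rdot_id//; apply: eq_Rintegral => x _; rewrite /rprod !(cReM, cImM) /=; ring.
have key (t : R) : 0 < t -> cabs (f w) <= t * nrm f + t^-1 * nrm k.
  move=> t0; rewrite (kP f Hf) fock_dotE (le_trans (cabs_le_ReIm _))//=.
  by have := rdot_le t0 Hf Hk; have := rdot_le t0 Hf Hik; rewrite nik; lra.
have := nrm_ge0 f; have := nrm_ge0 k; have := cabs_ge0 (f w).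
move: key; set a := cabs _; set n1 := nrm f; set n2 := nrm k => key a0 n20 n10.
have [->|an0] := eqVneq a 0; first by rewrite expr0n mulr_ge0 ?mulr_ge0.
have ap : 0 < a by rewrite lt_def an0.
have [n1z|n1n] := eqVneq n1 0.
  have := key (2 * (n2 + 1) / a) ltac:(by rewrite divr_gt0 ?mulr_gt0 ?ltr_wpDl).
  rewrite n1z mulr0 add0r invf_div => h; exfalso; move: h.
  rewrite mulrAC ler_pdivlMr; last by rewrite mulr_gt0 ?ltr_wpDl.
  by move: ap n20; clear; nra.
have n1p : 0 < n1 by rewrite lt_def n1n.
have := key (a / (2 * n1)) ltac:(by rewrite divr_gt0 ?mulr_gt0).
have -> : a / (2 * n1) * n1 = a / 2 by field; rewrite gt_eqF.
rewrite invf_div => h.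
have {h} : a / 2 <= 2 * n1 / a * n2 by lra.
rewrite mulrAC ler_pdivlMr//; lra.
Qed.

End FockKernel.

(** * Geometric sums and limits of entire functions *)

Section GeometricSums.
Variable R : realType.
Implicit Types (t u x y b : R).

Definition ndist (j k : nat) : nat := (j - k + (k - j))%N.

Lemma ndistC j k : ndist j k = ndist k j. Proof. exact: addnC. Qed.

Lemma geo_sum t N : 0 <= t -> t < 1 -> \sum_(j < N) t ^+ j <= (1 - t)^-1.
Proof.
move=> t0 t1; elim: N => [|N IH]; first by rewrite big_ord0 invr_ge0 subr_ge0 ltW.
rewrite big_ord_recl expr0 (eq_bigr (fun i : 'I_N => t * t ^+ i)); last first.
  by move=> i _; rewrite -exprS.
rewrite -mulr_sumr; have h : 0 < 1 - t by rewrite subr_gt0.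
apply: (@le_trans _ _ (1 + t * (1 - t)^-1)); first by rewrite lerD2l ler_wpM2l.
by rewrite le_eqVlt; apply/orP; left; apply/eqP; field; rewrite gt_eqF.
Qed.

Lemma geo_sum_dist t N k : 0 <= t -> t < 1 ->
  \sum_(j < N) t ^+ ndist j k <= 2 * (1 - t)^-1.
Proof.
move=> t0 t1; have H n : \sum_(j < n) t ^+ j <= (1 - t)^-1 by exact: geo_sum.
rewrite (bigID (fun j : 'I_N => (j < k)%N)) /= mulr_natl mulr2n; apply: lerD.
  apply: le_trans (H k.+1).
  rewrite (eq_bigr (fun j : 'I_N => t ^+ (k - j)%N)); last first.
    by move=> j jk; congr (_ ^+ _); rewrite /ndist; lia.
  rewrite -(big_mkord (fun j => (j < k)%N) (fun j => t ^+ (k - j)%N)).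
  apply: (@le_trans _ _ (\sum_(0 <= j < k) t ^+ (k - j)%N)).
    have [Nk|kN] := leqP N k.
      rewrite (big_cat_nat (leq0n N) Nk) /= -[leLHS]addr0; apply: lerD.
        by rewrite big_mkcond; apply: ler_sum => j _; case: ifP => // _; exact: exprn_ge0.
      by apply: sumr_ge0 => j _; exact: exprn_ge0.
    rewrite (big_cat_nat (leq0n k) (ltnW kN)) /= [X in _ + X]big_nat_cond.
    rewrite [X in _ + X]big_pred0 ?addr0; last by move=> j; lia.
    by rewrite big_mkcond; apply: ler_sum => j _; case: ifP => // _; exact: exprn_ge0.
  rewrite big_mkord (reindex_inj rev_ord_inj) /= big_ord_recl -[leLHS]add0r.
  apply: lerD; first exact: exprn_ge0.
  by apply: ler_sum => j _; rewrite /bump /= (_ : (k - (k - j.+1))%N = (1 + j)%N)//; have := ltn_ord j; lia.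
apply: le_trans (H N).
rewrite (eq_bigr (fun j : 'I_N => t ^+ (j - k)%N)); last first.
  by move=> j jk; congr (_ ^+ _); rewrite /ndist; lia.
rewrite -(big_mkord (fun j => ~~ (j < k)%N) (fun j => t ^+ (j - k)%N)).
have [Nk|kN] := leqP N k.
  rewrite big_nat_cond big_pred0; last by move=> j; lia.
  by apply: sumr_ge0 => j _; exact: exprn_ge0.
rewrite (big_cat_nat (leq0n k) (ltnW kN)) /= big_nat_cond big_pred0 ?add0r; last by move=> j; lia.
rewrite -{1}[k]add0n big_addn.
rewrite -(big_mkord xpredT (fun j => t ^+ j)).
rewrite (big_cat_nat (leq0n (N - k)) (leq_subr k N)) /= -[leLHS]addr0; apply: lerD; last first.
  by apply: sumr_ge0 => j _; exact: exprn_ge0.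
rewrite big_mkcond; apply: ler_sum => j _; case: ifP => _; last exact: exprn_ge0.
by rewrite addnK.
Qed.

Lemma expR_ge1B u : 0 <= u -> u <= 1 / 2 -> expR (- (2 * u)) <= 1 - u.
Proof.
move=> u0 u1; have h : 0 < 1 - u by lra.
rewrite expRN -[leRHS]invrK lef_pV2 ?posrE ?expR_gt0 ?invr_gt0//.
apply: (@le_trans _ _ (1 + 2 * u)); last exact: expR_ge1Dx.
by rewrite -[leLHS]mul1r ler_pdivrMr//; nra.
Qed.

Lemma prod_expR_le (I : Type) (s : seq I) (P : pred I) (b : R) M : 0 <= b ->
  (size s <= M)%N -> \prod_(i <- s | P i) expR b <= expR (M%:R * b).
Proof.
move=> b0 sM; rewrite -expR_sum ler_expR big_const_seq iter_addr_0 -[leLHS]mulr_natl.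
rewrite ler_wpM2r// ler_nat (leq_trans _ sM)//; exact: count_size.
Qed.

Lemma expR_sub1_le u : 0 <= u -> expR u - 1 <= u * expR u.
Proof.
move=> u0; have := expR_ge1Dx (- u); have := expR_gt0 u; have e : expR u * expR (- u) = 1.
  by rewrite -expRD subrr expR0.
set a := expR u in e *; set b := expR (- u) in e * => a0 ab; nra.
Qed.

Lemma prod_sub1 (I : Type) (s : seq I) (P : pred I) (F : I -> R[i]) u : 0 <= u ->
  (forall i, P i -> cabs (F i - 1) <= u) ->
  cabs (\prod_(i <- s | P i) F i - 1) <= expR ((size s)%:R * u) - 1.
Proof.
move=> u0 HF; elim: s => [|i s IH].
  by rewrite big_nil subrr cabs0 mul0r expR0 subrr.
have mono : expR ((size s)%:R * u) <= expR ((size (i :: s))%:R * u).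
  by rewrite ler_expR ler_wpM2r// ler_nat /=.
rewrite big_cons; case: ifP => Pi; last by apply: (le_trans IH); rewrite lerD2r.
set p := \prod_(j <- s | P j) F j in IH *.
have -> : F i * p - 1 = (F i - 1) * p + (p - 1) by ring.
apply: (le_trans (cabsD _ _)); rewrite cabsM /= -natr1 mulrDl mul1r expRD.
have pl : cabs p <= expR ((size s)%:R * u).
  by have := cabsBD p 1; rewrite cabs1; move: IH; lra.
have h := expR_ge1Dx u; set E := expR ((size s)%:R * u) in IH pl mono *.
have := HF i Pi; have := cabs_ge0 (F i - 1); have := cabs_ge0 p.
have E0 : 0 < E by exact: expR_gt0.
set a := cabs (F i - 1); set b := cabs p in pl *; set e := expR u in h *; move=> *.
have : a * b <= u * E by rewrite ler_pM.
have : u * E <= (e - 1) * E by rewrite ler_wpM2r ?(ltW E0)//; lra.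
rewrite mulrBl mul1r; move: IH; lra.
Qed.

Lemma entire_geometric (F : nat -> R[i] -> R[i]) t : 0 <= t -> t < 1 ->
  (forall n, centire (F n)) ->
  (forall r : R, exists A N0, forall n z, (N0 <= n)%N -> cabs z <= r ->
     cabs (F n.+1 z - F n z) <= A * t ^+ n) ->
  exists2 f, centire f & forall r e : R, 0 < e ->
    exists N, forall n z, (N <= n)%N -> cabs z <= r -> cabs (F n z - f z) <= e.
Proof.
move=> t0 t1 Fd HF; apply: entire_limit => // r e e0.
have [A0 [N0 HA0]] := HF r; pose A := `|A0| + 1.
have A_gt0 : 0 < A by rewrite ltr_wpDl.
have HA n z : (N0 <= n)%N -> cabs z <= r -> cabs (F n.+1 z - F n z) <= A * t ^+ n.
  move=> h1 h2; apply: le_trans (HA0 n z h1 h2) _.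
  rewrite ler_wpM2r ?exprn_ge0// /A; have := ler_norm A0; lra.
have c0 : 0 < (1 - t)^-1 by rewrite invr_gt0 subr_gt0.
have sum n k z : (N0 <= n)%N -> cabs z <= r ->
    cabs (F (n + k)%N z - F n z) <= A * t ^+ n * \sum_(i < k) t ^+ i.
  move=> h1 h2; elim: k => [|k IH]; first by rewrite addn0 subrr cabs0 big_ord0 mulr0.
  rewrite big_ord_recr /= mulrDr addnS -(subrK (F (n + k)%N z) (F (n + k).+1 z)) -addrA.
  rewrite (le_trans (cabsD _ _))// [leLHS]addrC lerD//.
  have -> : A * t ^+ n * t ^+ k = A * t ^+ (n + k) by rewrite exprD mulrA.
  by apply: HA => //; lia.
have {}sum n k z : (N0 <= n)%N -> cabs z <= r ->
    cabs (F (n + k)%N z - F n z) <= A * (1 - t)^-1 * t ^+ n.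
  move=> h1 h2; apply: (le_trans (sum n k z h1 h2)).
  rewrite [leLHS]mulrAC ler_wpM2r ?exprn_ge0// ler_wpM2l ?(ltW A_gt0)//.
  exact: geo_sum.
have [N HN] : exists N, A * (1 - t)^-1 * t ^+ N <= e.
  have [->|tn0] := eqVneq t 0; first by exists 1%N; rewrite expr1 mulr0 ltW.
  have tp : 0 < t by rewrite lt_def tn0.
  have [N] := @expn_gt_real R (A * (1 - t)^-1 / e) t^-1 ltac:(by rewrite invf_gt1).
  rewrite ltr_pdivrMr// exprVn => h; exists N.
  by rewrite -ler_pdivlMr ?exprn_gt0// [leRHS]mulrC ltW.
have dec n : (N <= n)%N -> A * (1 - t)^-1 * t ^+ n <= e.
  move=> Nn; apply: le_trans HN; rewrite ler_wpM2l ?mulr_ge0 ?(ltW A_gt0) ?(ltW c0)//.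
  by apply: ler_wiXn2l => //; exact: ltW.
exists (maxn N0 N) => n m z; rewrite !geq_max => /andP[a1 a2] /andP[b1 b2] zr.
have [nm|mn] := leqP n m.
  rewrite cabsC -(subnKC nm); apply: (le_trans (sum n _ z a1 zr)); exact: dec.
rewrite -(subnKC (ltnW mn)); apply: (le_trans (sum m _ z b1 zr)); exact: dec.
Qed.

End GeometricSums.

(** * Products over separated points in shells *)

Section Products.
Variables (R : realType) (q delta : R) (M : nat) (c : nat -> seq R[i]).
Hypothesis q_ge4 : 4 <= q.
Hypothesis delta_gt0 : 0 < delta.
Hypothesis delta_le1 : delta <= 1.
Implicit Types (z w g h : R[i]) (P : pred R[i]).

(** As [mx] is at least 1, shell 0 contains the whole unit disc. *)
Definition in_shell (k : nat) z := q ^+ k <= mx z < q ^+ k.+1.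

Hypothesis c_shell : forall j g, g \in c j -> in_shell j g.
Hypothesis c_size : forall j, (size (c j) <= M)%N.
Hypothesis c_sep : forall i j g h, g \in c i -> h \in c j -> g != h ->
  delta * mx g <= cabs (g - h).

Let q_gt0 : 0 < q. Proof. by apply: lt_le_trans q_ge4. Qed.
Let q_gt1 : 1 < q. Proof. by apply: lt_le_trans q_ge4; rewrite ltr1n. Qed.

Let p : R := q^-1.
Let p_gt0 : 0 < p. Proof. by rewrite invr_gt0. Qed.
Let p_le4 : p <= 1 / 4.
Proof. by rewrite div1r lef_pV2 ?posrE. Qed.
Let p_lt1 : p < 1. Proof. by apply: (le_lt_trans p_le4); lra. Qed.
Let pq n : p ^+ n * q ^+ n = 1.
Proof. by rewrite -exprMn mulVf ?gt_eqF// expr1n. Qed.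

(** Normalises the factor to [1 - z / g] for [1 <= cabs g], which makes the product converge, and to
    [z - g] for points in the unit disc, where dividing by [g] would be unsafe. In both cases
    [cabs (nu g) = mx g]. *)
Definition nu g : R[i] := if cabs g < 1 then 1 else - g.

Lemma cabs_nu g : cabs (nu g) = mx g.
Proof.
rewrite /nu; case: (ltrP (cabs g) 1) => h.
  by rewrite cabs1 /mx max_l// ltW.
by rewrite cabsN /mx max_r.
Qed.

Lemma nu_neq0 g : nu g != 0.
Proof. by rewrite -cabs_gt0 cabs_nu mx_gt0. Qed.

Definition efac g z : R[i] := (z - g) / nu g.

(** The size of a factor at a point of shell [k], up to [expR] of a constant times
    [q^-1 ^+ ndist j k], provided [z] is not too close to [g]. *)
Definition efac_main (k j : nat) z g : R := if (j < k)%N then mx z / mx g else 1.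

Lemma efac_main_gt0 k j z g : 0 < efac_main k j z g.
Proof. by rewrite /efac_main; case: ifP => // _; rewrite divr_gt0// mx_gt0. Qed.

Lemma efac_main_ge1 k j z g : in_shell k z -> in_shell j g -> 1 <= efac_main k j z g.
Proof.
move=> /andP[z1 _] /andP[_ g2]; rewrite /efac_main; case: ifP => // jk.
rewrite ler_pdivlMr ?mx_gt0// mul1r (le_trans (ltW g2))// (le_trans _ z1)//.
by rewrite ler_weXn2l// ltW.
Qed.

Lemma shell_ratio j k g z : (j <= k)%N -> in_shell j g -> in_shell k z ->
  mx g / mx z <= q * p ^+ ndist j k.
Proof.
move=> jk /andP[_ g2] /andP[z1 _]; rewrite ler_pdivrMr ?mx_gt0//.
apply: (le_trans (ltW g2)).
have -> : q ^+ j.+1 = q * p ^+ ndist j k * q ^+ k.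
  have -> : ndist j k = (k - j)%N by rewrite /ndist; move: jk; clear; lia.
  by rewrite -{2}(subnK jk) exprD mulrA -[q * _ * _]mulrA pq mulr1 exprS.
by rewrite ler_wpM2l// mulr_ge0 ?exprn_ge0// ltW.
Qed.

Lemma efac_upper j k g z : in_shell j g -> in_shell k z ->
  cabs (efac g z) <= expR (q * p ^+ ndist j k) * efac_main k j z g.
Proof.
move=> hg hz; have mg := mx_gt0 g; have mz := mx_gt0 z.
have h0 : cabs (efac g z) <= (mx z + mx g) / mx g.
  rewrite cabsf cabs_nu ler_wpM2r ?invr_ge0 ?(ltW mg)// (le_trans (cabsB _ _))//.
  by rewrite lerD// cabs_le_mx.
apply: (le_trans h0); rewrite /efac_main; case: ltnP => jk.
  have -> : (mx z + mx g) / mx g = (1 + mx g / mx z) * (mx z / mx g).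
    by field; rewrite !gt_eqF.
  rewrite ler_wpM2r ?divr_ge0 ?(ltW mg) ?(ltW mz)//.
  apply: (le_trans _ (expR_ge1Dx _)); rewrite lerD2l; apply: shell_ratio => //; exact: ltnW.
rewrite mulr1; apply: (le_trans _ (expR_ge1Dx _)).
have -> : (mx z + mx g) / mx g = 1 + mx z / mx g by field; rewrite gt_eqF.
by rewrite lerD2l ndistC; apply: shell_ratio.
Qed.

(** The first term serves shells at distance at least 2, through [1 - u >= expR (- (2 * u))]. The
    second serves the same and adjacent shells, where the relative size of the factor is at least
    [d / q ^+ 2]; the extra [q] makes up for the power [q^-1 ^+ ndist j k], at least [q^-1]
    there. *)
Definition efac_cst (d : R) : R := 2 * q + q * ln (q ^+ 2 / d).

Lemma efac_cst_ge0 d : 0 < d -> d <= 1 -> 0 <= efac_cst d.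
Proof.
move=> d0 d1; rewrite addr_ge0 ?mulr_ge0 ?(ltW q_gt0)// ln_ge0//.
rewrite ler_pdivlMr// mul1r (le_trans d1)// exprn_ege1// ltW//.
Qed.

Lemma efac_lower d j k g z : 0 < d -> d <= 1 -> in_shell j g -> in_shell k z ->
  ((ndist j k <= 1)%N -> d * mx z <= cabs (z - g)) ->
  expR (- (efac_cst d * p ^+ ndist j k)) * efac_main k j z g <= cabs (efac g z).
Proof.
move=> d0 d1 hg hz near; have mg := mx_gt0 g; have mz := mx_gt0 z.
have qd : 1 <= q ^+ 2 / d.
  by rewrite ler_pdivlMr// mul1r (le_trans d1)// exprn_ege1// ltW.
have cge : 2 * q <= efac_cst d.
  by rewrite lerDl mulr_ge0 ?(ltW q_gt0)// ln_ge0.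
rewrite cabsf cabs_nu.
have [n1|n2] := leqP (ndist j k) 1%N.
  have e1 : expR (- (efac_cst d * p ^+ ndist j k)) <= d / q ^+ 2.
    rewrite -[leRHS]lnK ?posrE ?divr_gt0 ?exprn_gt0// ler_expR.
    rewrite -[d / _]invf_div lnV ?posrE ?divr_gt0 ?exprn_gt0// lerN2.
    apply: (@le_trans _ _ (efac_cst d * p)); last first.
      rewrite ler_wpM2l ?efac_cst_ge0// -[leLHS]expr1.
      by apply: ler_wiXn2l => //; exact: ltW.
    rewrite /efac_cst mulrDl [q * _ * p]mulrAC mulfV ?gt_eqF// mul1r lerDr.
    by rewrite !mulr_ge0// ltW.
  apply: (@le_trans _ _ (d * (mx z / mx g))); last first.
    by rewrite mulrA ler_wpM2r ?invr_ge0 ?(ltW mg)// near.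
  apply: (le_trans (ler_wpM2r (ltW (efac_main_gt0 k j z g)) e1)).
  rewrite -mulrA ler_wpM2l ?(ltW d0)// /efac_main; case: ltnP => jk.
    rewrite -[leRHS]mul1r ler_wpM2r ?divr_ge0 ?(ltW mg) ?(ltW mz)//.
    by rewrite invf_le1 ?exprn_gt0// exprn_ege1// ltW.
  rewrite mulr1 ler_pdivlMr// mulrC ler_pdivrMr ?exprn_gt0//.
  move: hg hz => /andP[_ g2] /andP[z1 _].
  apply: (le_trans (ltW g2)); apply: (@le_trans _ _ (q ^+ k * q ^+ 2)).
    rewrite -exprD ler_weXn2l ?(ltW q_gt1)//; move: n1; rewrite /ndist; clear; lia.
  by rewrite ler_wpM2r ?exprn_ge0// ltW.
have big u t : in_shell u t -> (0 < u)%N -> mx t = cabs t.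
  move=> /andP[h _] u0; rewrite /mx max_r// leNgt; apply/negP => t1.
  move: h; rewrite /mx max_l ?(ltW t1)// leNgt; apply/negP; rewrite negbK.
  by rewrite exprn_egt1// -lt0n.
have core (u : R) : 0 <= u -> u <= q * p ^+ ndist j k ->
    expR (- (efac_cst d * p ^+ ndist j k)) <= 1 - u.
  move=> u0 uq; have qp : q * p ^+ ndist j k <= 1 / 2.
    rewrite -(prednK (ltnW n2)) exprS mulrA mulfV ?gt_eqF// [leLHS]mul1r.
    apply: (@le_trans _ _ (p ^+ 1)); last by rewrite expr1; have := p_le4; lra.
    apply: ler_wiXn2l; [exact: ltW|exact: ltW|].
    by move: n2; clear; lia.
  apply: (@le_trans _ _ (1 - q * p ^+ ndist j k)); last by rewrite lerD2l lerN2.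
  apply: (le_trans _ (expR_ge1B _ qp)); last by rewrite mulr_ge0 ?exprn_ge0// ltW.
  by rewrite ler_expR lerN2 mulrA ler_wpM2r// exprn_ge0// ltW.
rewrite /efac_main; case: ltnP => jk.
  have zz : mx z = cabs z by apply: (big k) => //; move: jk; clear; lia.
  have u0 : 0 <= mx g / mx z by rewrite divr_ge0// ltW.
  apply: (le_trans (ler_wpM2r _ (core _ u0 (shell_ratio (ltnW jk) hg hz)))).
    by rewrite divr_ge0// ltW.
  have -> : (1 - mx g / mx z) * (mx z / mx g) = (mx z - mx g) / mx g.
    by field; rewrite !gt_eqF.
  rewrite ler_wpM2r ?invr_ge0 ?(ltW mg)// (le_trans _ (cabsBD _ _))// zz lerD2l lerN2.
  exact: cabs_le_mx.
have gg : mx g = cabs g by apply: (big j) => //; move: n2 jk; rewrite /ndist; clear; lia.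
have u0 : 0 <= mx z / mx g by rewrite divr_ge0// ltW.
have := shell_ratio jk hz hg; rewrite ndistC => hr.
rewrite mulr1 (le_trans (core _ u0 hr))//.
have -> : 1 - mx z / mx g = (mx g - mx z) / mx g by field; rewrite gt_eqF.
rewrite ler_wpM2r ?invr_ge0 ?(ltW mg)// cabsC (le_trans _ (cabsBD _ _))// gg lerD2l lerN2.
exact: cabs_le_mx.
Qed.

Definition gprod P N z : R[i] := \prod_(j < N) \prod_(g <- c j | P g) efac g z.

Definition mprod P N k z : R :=
  \prod_(j < N) \prod_(g <- c j | P g) efac_main k j z g.

Definition cellprod k (rho : R) : R := \prod_(j < k) \prod_(g <- c j) (rho / mx g).

Definition total_dist (b : R) P N k : R :=
  \sum_(j < N) \sum_(g <- c j | P g) b * p ^+ ndist j k.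

(** At most [M] points per shell, and the sum of [q^-1 ^+ ndist j k] over [j] is at most
    [2 / (1 - 1 / 4)], hence below 3, uniformly in [N] and [k]. *)
Lemma total_dist_bound b P N k : 0 <= b ->
  total_dist b P N k <= 3 * M%:R * b.
Proof.
move=> b0; apply: (@le_trans _ _ (\sum_(j < N) M%:R * b * p ^+ ndist j k)).
  apply: ler_sum => j _; rewrite big_const_seq iter_addr_0 -[leLHS]mulr_natl -mulrA.
  apply: ler_wpM2r; first by rewrite mulr_ge0// exprn_ge0// ltW.
  by rewrite ler_nat (leq_trans (count_size _ _)).
have -> : 3 * M%:R * b = M%:R * b * 3 by ring.
rewrite -mulr_sumr ler_wpM2l ?mulr_ge0//.
have := geo_sum_dist N k (ltW p_gt0) p_lt1; move/le_trans; apply.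
by rewrite ler_pdivrMr ?subr_gt0//; have := p_le4; lra.
Qed.

Lemma prod_expR P N k (b : R) :
  \prod_(j < N) \prod_(g <- c j | P g) expR (b * p ^+ ndist j k) =
  expR (total_dist b P N k).
Proof. by rewrite /total_dist expR_sum; apply: eq_bigr => j _; rewrite expR_sum. Qed.

Lemma prod_split P N k z (b : R) :
  \prod_(j < N) \prod_(g <- c j | P g) (expR (b * p ^+ ndist j k) * efac_main k j z g) =
  expR (total_dist b P N k) * mprod P N k z.
Proof.
by rewrite -prod_expR -big_split; apply: eq_bigr => j _; rewrite -big_split.
Qed.

Lemma cabs_gprod P N z :
  cabs (gprod P N z) = \prod_(j < N) \prod_(g <- c j | P g) cabs (efac g z).
Proof. by rewrite cabs_prod; apply: eq_bigr => j _; rewrite cabs_prod. Qed.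

Lemma ler_prod_seq (I : eqType) (s : seq I) (Q : pred I) (E F : I -> R) :
  (forall i, i \in s -> Q i -> 0 <= E i <= F i) ->
  \prod_(i <- s | Q i) E i <= \prod_(i <- s | Q i) F i.
Proof.
move=> H; rewrite big_seq_cond [leRHS]big_seq_cond.
by apply: ler_prod => i /andP[]; exact: H.
Qed.

Lemma prod_seq_ge1 (I : eqType) (s : seq I) (Q : pred I) (F : I -> R) :
  (forall i, i \in s -> Q i -> 1 <= F i) -> 1 <= \prod_(i <- s | Q i) F i.
Proof.
elim: s => [|i s IH] H; first by rewrite big_nil.
have {}IH : 1 <= \prod_(i <- s | Q i) F i.
  by apply: IH => j js; apply: H; rewrite inE js orbT.
rewrite big_cons; case Qi: (Q i) => //.
by rewrite -[leLHS]mulr1 ler_pM// H// mem_head.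
Qed.

Lemma mprod_ge0 P N k z : 0 <= mprod P N k z.
Proof. by apply: prodr_ge0 => j _; apply: prodr_ge0 => g _; exact/ltW/efac_main_gt0. Qed.

Lemma gprod_upper P N k z : in_shell k z ->
  cabs (gprod P N z) <= expR (3 * M%:R * q) * mprod P N k z.
Proof.
move=> hz; rewrite cabs_gprod.
apply: (@le_trans _ _ (\prod_(j < N) \prod_(g <- c j | P g)
   (expR (q * p ^+ ndist j k) * efac_main k j z g))).
  apply: ler_prod => j _; rewrite prodr_ge0 ?(fun _ _ => cabs_ge0 _)//=; last first.
    by move=> g _; exact: cabs_ge0.
  apply: ler_prod_seq => g /c_shell hg _; rewrite cabs_ge0/=; exact: efac_upper.
rewrite prod_split ler_wpM2r ?mprod_ge0// ler_expR.
by apply: total_dist_bound; exact: ltW.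
Qed.

Lemma gprod_lower d P N k z : 0 < d -> d <= 1 -> in_shell k z ->
  (forall j g, g \in c j -> P g -> (ndist j k <= 1)%N -> d * mx z <= cabs (z - g)) ->
  expR (- (3 * M%:R * efac_cst d)) * mprod P N k z <= cabs (gprod P N z).
Proof.
move=> d0 d1 hz near; rewrite cabs_gprod.
apply: (@le_trans _ _ (\prod_(j < N) \prod_(g <- c j | P g)
   (expR (- efac_cst d * p ^+ ndist j k) * efac_main k j z g))).
  rewrite prod_split ler_wpM2r ?mprod_ge0// ler_expR.
  have -> : total_dist (- efac_cst d) P N k = - total_dist (efac_cst d) P N k.
    rewrite /total_dist -sumrN; apply: eq_bigr => j _; rewrite -sumrN.
    by apply: eq_bigr => g _; rewrite mulNr.
  by rewrite lerN2; apply: total_dist_bound; exact: efac_cst_ge0.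
apply: ler_prod => j _; apply/andP; split.
  by apply: prodr_ge0 => g _; rewrite mulr_ge0 ?expR_ge0// ltW// efac_main_gt0.
apply: ler_prod_seq => g gc Pg; rewrite mulr_ge0 ?expR_ge0 ?(ltW (efac_main_gt0 _ _ _ _))//=.
by rewrite mulNr; apply: efac_lower => //; [exact: c_shell|exact: near].
Qed.

Lemma mprod_trunc P N k z : (k <= N)%N ->
  mprod P N k z = \prod_(j < k) \prod_(g <- c j | P g) (mx z / mx g).
Proof.
move=> kN; rewrite /mprod.
rewrite -(big_mkord xpredT (fun j => \prod_(g <- c j | P g) efac_main k j z g)).
rewrite (big_cat_nat (leq0n k) kN) /= [X in _ * X]big1_seq ?mulr1; last first.
  move=> j /andP[_]; rewrite mem_index_iota => /andP[kj _].
  by apply: big1 => g _; rewrite /efac_main ltnNge kj.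
by rewrite big_mkord; apply: eq_bigr => j _; apply: eq_bigr => g _; rewrite /efac_main ltn_ord.
Qed.

Lemma mprod_all P N k z : (k <= N)%N ->
  (forall j g, (j < k)%N -> g \in c j -> P g) ->
  mprod P N k z = cellprod k (mx z).
Proof.
move=> kN HP; rewrite mprod_trunc//; apply: eq_bigr => j _.
rewrite big_seq_cond [RHS]big_seq; apply: eq_bigl => g.
by case gc: (g \in c j); rewrite // (HP j)// gc.
Qed.

(** [cellprod] splits into the factors at [h] and the others. All factors are at least 1, so the
    part at [h] is at least the contribution of a single occurrence, whatever the multiplicity of
    [h] in the list. *)
Lemma mprod_remove N k z i h : in_shell k z -> h \in c i -> (k <= N)%N ->
  mprod (predC1 h) N k z <=
  cellprod k (mx z) * (if (i < k)%N then mx h / mx z else 1).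
Proof.
move=> hz hc kN; have mz := mx_gt0 z; have mh := mx_gt0 h.
have ge1 (j : 'I_k) g : g \in c j -> 1 <= mx z / mx g.
  move=> gc; have := efac_main_ge1 hz (c_shell gc).
  by rewrite /efac_main ltn_ord.
have E : cellprod k (mx z) = mprod (pred1 h) N k z * mprod (predC1 h) N k z.
  rewrite !mprod_trunc// -big_split; apply: eq_bigr => j _.
  by rewrite [LHS](bigID (pred1 h)).
have X1 : 1 <= mprod (pred1 h) N k z.
  rewrite mprod_trunc//; apply: prod_seq_ge1 => j _ _.
  by apply: prod_seq_ge1 => g gc _; exact: ge1 gc.
have H0 := mprod_ge0 (predC1 h) N k z.
case: ltnP => ik; last by rewrite mulr1 E -[leLHS]mul1r ler_wpM2r.
have X2 : mx z / mx h <= mprod (pred1 h) N k z.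
  rewrite mprod_trunc// (bigD1 (Ordinal ik))//= -[leLHS]mulr1 ler_pM ?divr_ge0 ?(ltW mz) ?(ltW mh)//.
    rewrite -big_filter (eq_big_seq (fun=> mx z / mx h)); last first.
      by move=> g; rewrite mem_filter /= => /andP[/eqP ->].
    have : (0 < size [seq g <- c i | pred1 h g])%N.
      by rewrite size_filter -has_count; apply/hasP; exists h; rewrite //= eqxx.
    case: [seq g <- c i | pred1 h g] => // a s _.
    rewrite big_cons -[leLHS]mulr1 ler_pM ?divr_ge0 ?(ltW mz) ?(ltW mh)//.
    by apply: prod_seq_ge1 => g _ _; exact: (ge1 (Ordinal ik) h hc).
  apply: prod_seq_ge1 => j _ _.
  by apply: prod_seq_ge1 => g gc _; exact: ge1 gc.
rewrite E -[mx h / mx z]invf_div ler_pdivlMr ?divr_gt0// mulrC.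
by rewrite ler_wpM2r.
Qed.

Section Limit.
Variable P : pred R[i].

Lemma gprod_entire N : centire (gprod P N).
Proof.
have H (I : Type) (s : seq I) (Q : pred I) (F : I -> R[i] -> R[i]) :
    (forall i, centire (F i)) -> centire (fun z => \prod_(i <- s | Q i) F i z).
  move=> FE; elim: s => [|i s IH] z.
    by rewrite (_ : (fun _ => _) = fun=> 1); [exact: cderivable_cst|apply/funext => t; rewrite big_nil].
  case Qi: (Q i).
    rewrite (_ : (fun _ => _) = fun z => F i z * \prod_(i <- s | Q i) F i z).
      by apply: cderivableM; [exact: FE|exact: IH].
    by apply/funext => t; rewrite big_cons Qi.
  rewrite (_ : (fun _ => _) = fun z => \prod_(i <- s | Q i) F i z); first exact: IH.
  by apply/funext => t; rewrite big_cons Qi.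
rewrite /gprod; apply: (H) => j; apply: (H) => g z.
apply: cderivableM; last exact: cderivable_cst.
by apply: cderivableB; [exact: cderivable_id|exact: cderivable_cst].
Qed.

(** Each factor is at most [1 + r * q^-1 ^+ j]. Unlike [gprod_upper], the bound refers to no shell;
    it is uniform in [N] on discs. *)
Lemma gprod_bound N r z : 0 <= r -> cabs z <= r ->
  cabs (gprod P N z) <= expR (2 * M%:R * r).
Proof.
move=> r0 zr; rewrite cabs_gprod.
apply: (@le_trans _ _ (\prod_(j < N) \prod_(g <- c j | P g) expR (r * p ^+ j))).
  apply: ler_prod => j _; rewrite prodr_ge0 /=; last by move=> g _; exact: cabs_ge0.
  apply: ler_prod_seq => g /c_shell/andP[hg _] _; rewrite cabs_ge0/=.
  have mg := mx_gt0 g; rewrite cabsf cabs_nu (le_trans _ (expR_ge1Dx _))//.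
  rewrite ler_pdivrMr// mulrDl mul1r (le_trans (cabsB _ _))// addrC lerD ?cabs_le_mx//.
  rewrite (le_trans zr)// -mulrA -[leLHS]mulr1 ler_wpM2l// -(pq j) ler_wpM2l//.
  by rewrite exprn_ge0// ltW.
apply: (@le_trans _ _ (\prod_(j < N) expR (M%:R * (r * p ^+ j)))).
  apply: ler_prod => j _; rewrite prodr_ge0 /=; last by move=> g _; exact: expR_ge0.
  by apply: prod_expR_le => //; rewrite mulr_ge0// exprn_ge0// ltW.
rewrite -expR_sum ler_expR -mulr_sumr -mulr_sumr.
rewrite [2 * _]mulrC -mulrA ler_wpM2l// mulrC ler_wpM2r//.
apply: (le_trans (geo_sum N (ltW p_gt0) p_lt1)).
by rewrite -[leLHS]mul1r ler_pdivrMr ?subr_gt0//; have := p_le4; lra.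
Qed.

Lemma gprod_step N r z : (0 < N)%N -> 0 <= r -> cabs z <= r ->
  cabs (gprod P N.+1 z - gprod P N z) <=
  expR (3 * M%:R * r) * (M%:R * r) * p ^+ N.
Proof.
move=> N0 r0 zr; rewrite /gprod big_ord_recr /= -/(gprod P N z).
have -> (a b : R[i]) : a * b - a = a * (b - 1) by ring.
rewrite cabsM; pose u := r * p ^+ N.
have pN : 0 <= p ^+ N by rewrite exprn_ge0// ltW.
have u0 : 0 <= u by rewrite mulr_ge0.
have ur : u <= r by rewrite -[leRHS]mulr1 ler_wpM2l// exprn_ile1// ltW.
have h1 : cabs (\prod_(g <- c N | P g) efac g z - 1) <= expR (M%:R * u) - 1.
  rewrite big_seq_cond.
  apply: (@le_trans _ _ (expR ((size (c N))%:R * u) - 1)); last first.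
    by rewrite lerD2r ler_expR ler_wpM2r// ler_nat.
  apply: prod_sub1 => // g /andP[gc _].
  have /andP[hg _] := c_shell gc.
  (* For [0 < N] the points of shell [N] lie outside the unit disc, so the factor is [1 - z / g]. *)
  have g1 : cabs g < 1 = false.
    apply/negP => g1; move: hg; rewrite /mx max_l ?(ltW g1)// leNgt.
    by have -> : 1 < q ^+ N by rewrite exprn_egt1// -lt0n.
  have gn : g != 0 by apply/eqP => g0; move: g1; rewrite g0 cabs0 ltr01.
  have -> : efac g z - 1 = - z / g by rewrite /efac /nu g1; field.
  have gE : mx g = cabs g by rewrite /mx max_r// leNgt g1.
  rewrite cabsf cabsN -gE ler_pdivrMr ?mx_gt0// (le_trans zr)// /u -mulrA.
  by rewrite -[leLHS]mulr1 ler_wpM2l// -(pq N) ler_wpM2l.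
have h2 := gprod_bound N r0 zr.
apply: (le_trans (ler_pM (cabs_ge0 _) (cabs_ge0 _) h2 h1)).
have Mu : 0 <= M%:R * u by rewrite mulr_ge0.
apply: (le_trans (ler_wpM2l (expR_ge0 _) (expR_sub1_le Mu))).
have -> : 3 * M%:R * r = 2 * M%:R * r + M%:R * r by ring.
rewrite expRD -[leRHS]mulrA -[leRHS]mulrA ler_wpM2l ?expR_ge0//.
rewrite [leLHS]mulrC; have -> : M%:R * r * p ^+ N = M%:R * u by rewrite /u mulrA.
by rewrite ler_wpM2r// ler_expR ler_wpM2l.
Qed.

Lemma gprod_limit : exists2 G, centire G & forall r e : R, 0 < e ->
  exists N, forall n z, (N <= n)%N -> cabs z <= r -> cabs (gprod P n z - G z) <= e.
Proof.
apply: (entire_geometric (ltW p_gt0) p_lt1); first exact: gprod_entire.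
move=> r; pose r' := Num.max r 0; exists (expR (3 * M%:R * r') * (M%:R * r')), 1%N => n z n1 zr.
by apply: gprod_step; rewrite ?le_max ?lexx ?orbT ?zr.
Qed.

End Limit.

Variable wf : R -> R.
Variable Cw : R.
Hypothesis Cw_gt0 : 0 < Cw.
Hypothesis wf_gt0 : forall r, 0 < wf r.
Hypothesis cellprod_wf : forall k rho, q ^+ k <= rho <= q ^+ k.+1 ->
  Cw^-1 * wf rho <= cellprod k rho <= Cw * wf rho.

(** The product over all points other than [h]. At [h] itself nothing is lost in comparison with the
    full partial product, because the latter only runs over shells strictly inside that of [h];
    beyond the shell of [h] the missing factor appears as [mx h / mx z]. *)
Lemma interpolating_function : exists2 C : R, 0 < C & forall i h, h \in c i ->
  exists G : R[i] -> R[i], [/\ centire G,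
    forall j g, g \in c j -> g != h -> G g = 0,
    C^-1 * wf (mx h) <= cabs (G h) &
    forall k z, in_shell k z ->
      cabs (G z) <= C * wf (mx z) * (if (i < k)%N then mx h / mx z else 1)].
Proof.
pose C1 := expR (3 * M%:R * q) * Cw; pose C2 := Cw * expR (3 * M%:R * efac_cst delta).
have C10 : 0 < C1 by rewrite mulr_gt0// expR_gt0.
have C20 : 0 < C2 by rewrite mulr_gt0// expR_gt0.
exists (C1 + C2); first by rewrite addr_gt0.
move=> i h hc; have [G Gd GF] := gprod_limit (predC1 h).
exists G; split => //.
- move=> j g gc gh; apply/eqP; rewrite -cabs_eq0 eq_le cabs_ge0 andbT.
  apply/ler_addgt0Pl => e e0; rewrite addr0.
  have [N HN] := GF (cabs g) e e0.
  (* The index exceeds [j], so the factor vanishing at [g] is present. *)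
  have := HN (maxn N j.+1) g (leq_maxl _ _) (lexx _).
  have -> : gprod (predC1 h) (maxn N j.+1) g = 0.
    have jN : (j < maxn N j.+1)%N by rewrite leq_max leqnn orbT.
    rewrite /gprod (bigD1 (Ordinal jN))//= (perm_big _ (perm_to_rem gc)) /= big_cons /= gh.
    by rewrite /efac subrr !mul0r.
  by rewrite sub0r cabsN.
- have hi := c_shell hc.
  have low N : (i <= N)%N -> C2^-1 * wf (mx h) <= cabs (gprod (predC1 h) N h).
    move=> iN; apply: (le_trans _ (@gprod_lower delta (predC1 h) N i h delta_gt0 delta_le1 hi _)).
      rewrite mprod_all//; last first.
        move=> j g ji gc /=; apply/eqP => gh.
        move: (c_shell gc) hi; rewrite gh => /andP[a1 a2] /andP[b1 b2].
        by have := le_lt_trans b1 a2; rewrite ltr_eXn2l// ltnS leqNgt ji.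
      have -> : C2^-1 * wf (mx h) =
          expR (- (3 * M%:R * efac_cst delta)) * (Cw^-1 * wf (mx h)).
        by rewrite /C2 invfM expRN; ring.
      rewrite ler_wpM2l ?expR_ge0//.
      by have /andP[a1 a2] := hi; have /andP[] := @cellprod_wf i (mx h) ltac:(by rewrite a1 ltW).
    by move=> j g gc /= gh _; apply: c_sep hc gc _; rewrite eq_sym.
  apply: (@le_trans _ _ (C2^-1 * wf (mx h))).
    by rewrite ler_wpM2r ?(ltW (wf_gt0 _))// lef_pV2 ?posrE ?addr_gt0// lerDr ltW.
  apply/ler_addgt0Pl => e e0.
  have [N HN] := GF (cabs h) e e0.
  have := HN (maxn N i) h (leq_maxl _ _) (lexx _); have := low _ (leq_maxr N i).
  have := cabsBD (gprod (predC1 h) (maxn N i) h) (G h); lra.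
move=> k z hz; apply/ler_addgt0Pl => e e0.
have [N HN] := GF (cabs z) e e0.
have := HN (maxn N k) z (leq_maxl _ _) (lexx _).
have := cabsBD (G z) (gprod (predC1 h) (maxn N k) z); rewrite cabsC.
have : cabs (gprod (predC1 h) (maxn N k) z) <=
    (C1 + C2) * wf (mx z) * (if (i < k)%N then mx h / mx z else 1).
  apply: (le_trans (gprod_upper _ _ hz)).
  apply: (le_trans (ler_wpM2l (expR_ge0 _) (mprod_remove hz hc (leq_maxr N k)))).
  rewrite mulrA ler_wpM2r//.
    by case: ifP => // _; rewrite divr_ge0// ltW// mx_gt0.
  apply: (@le_trans _ _ (C1 * wf (mx z))).
    have -> : C1 * wf (mx z) = expR (3 * M%:R * q) * (Cw * wf (mx z)) by rewrite /C1 mulrA.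
    rewrite ler_wpM2l ?expR_ge0//.
    by have /andP[a1 a2] := hz; have /andP[] := @cellprod_wf k (mx z) ltac:(by rewrite a1 ltW).
  by rewrite ler_wpM2r ?(ltW (wf_gt0 _))// lerDl ltW.
lra.
Qed.

End Products.

(** Pigeonhole: there are [size L + 1] candidates spaced by [2 * eta], and an element of [L] is
    within [eta] of at most one of them. *)
Lemma free_slot (R : realType) (L : seq R) (a eta : R) : 0 < eta ->
  exists2 i, (i <= size L)%N & forall x, x \in L -> eta <= `|x - (a + 2 * eta * i%:R)|.
Proof.
move=> eta0; apply: contrapT => none.
have /choice[u Hu] (i : 'I_(size L).+1) : exists x, x \in L /\ `|x - (a + 2 * eta * i%:R)| < eta.
  apply: contrapT => nx; apply: none; exists i; first by rewrite -ltnS.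
  move=> x xL; rewrite leNgt; apply/negP => h; apply: nx; by exists x.
have key (y s t : R) : y - (a + 2 * eta * s) < eta -> - eta < y - (a + 2 * eta * t) -> t < s + 1.
  by move=> h1 h2; rewrite -subr_gt0 -(pmulr_rgt0 _ eta0); lra.
have inj : injective u.
  move=> i j uij; have [_] := Hu i; have [_] := Hu j; rewrite uij !ltr_norml.
  move=> /andP[h1 h2] /andP[h3 h4].
  have d1 := key _ _ _ h4 h1; have d2 := key _ _ _ h2 h3.
  move: d1 d2; rewrite !natr1 !ltr_nat !ltnS => d1 d2.
  by apply/val_inj/eqP; rewrite /= eqn_leq d1 d2.
have : (size [seq u i | i <- enum 'I_(size L).+1] <= size L)%N.
  apply: uniq_leq_size; first by rewrite map_inj_uniq ?enum_uniq.
  by move=> x /mapP[i _ ->]; have [] := Hu i.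
by rewrite size_map size_enum_ord ltnn.
Qed.

(** The exponent in the decay of a Lagrange function beyond the shell of its node: [x = ln (mx z)]
    in shell [k], [y = ln (mx h)] in shell [i], and [y - x] for the removed factor. The companion
    treats the shells up to that of the node. *)
Lemma shell_gap_below (R : realFieldType) (T x y k i : R) :
  k * T <= x -> y <= (i + 1) * T ->
  x / 2 + - (y / 2) + (y - x) <= T / 2 + - ((k - i) * T / 2).
Proof. by rewrite mulrDl mulrBl; lra. Qed.

Lemma shell_gap_above (R : realFieldType) (T x y k i : R) :
  x <= (k + 1) * T -> i * T <= y ->
  x / 2 + - (y / 2) <= T / 2 + - ((i - k) * T / 2).
Proof. by rewrite mulrDl mulrBl; lra. Qed.

Lemma shell_exists_gen (R : realType) (q : R) (z : R[i]) : 1 < q -> exists k, in_shell q k z.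
Proof.
move=> q1; have q0 : 0 < q by exact: lt_trans q1.
pose u := ln (mx z) / ln q; exists (Num.truncn u).
have T0 : 0 < ln q by rewrite ln_gt0.
have u0 : 0 <= u by rewrite divr_ge0 ?ln_mx_ge0// ltW.
have qE n : q ^+ n = expR (n%:R * ln q) by rewrite expRM_natl lnK// posrE.
rewrite /in_shell !qE mx_exp ler_expR ltr_expR -ler_pdivlMr// -ltr_pdivrMr// -/u.
by rewrite truncn_le u0 truncnS_gt.
Qed.

(** * Lagrange interpolation and uniqueness *)

Section LagrangeInterpolation.
Variables (R : realType) (alpha kap q delta : R) (M : nat) (c : nat -> seq R[i]).
Hypothesis alpha_gt0 : 0 < alpha.
Hypothesis kap_ge0 : 0 <= kap.
Hypothesis q_ge4 : 4 <= q.
Hypothesis delta_gt0 : 0 < delta.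
Hypothesis delta_le1 : delta <= 1.
Hypothesis c_shell : forall j g, g \in c j -> in_shell q j g.
Hypothesis c_size : forall j, (size (c j) <= M)%N.
Hypothesis c_uniq : forall j, uniq (c j).
Hypothesis c_sep : forall i j g h, g \in c i -> h \in c j -> g != h ->
  delta * mx g <= cabs (g - h).
Implicit Types (z w g h : R[i]).

Definition wfun (rho : R) : R := expR (alpha * ln rho ^+ 2 - (kap - 1 / 2) * ln rho).

Variable Cw : R.
Hypothesis Cw_gt0 : 0 < Cw.
Hypothesis cellprod_wfun : forall k rho, q ^+ k <= rho <= q ^+ k.+1 ->
  Cw^-1 * wfun rho <= cellprod c k rho <= Cw * wfun rho.

Let q_gt0 : 0 < q. Proof. by apply: lt_le_trans q_ge4. Qed.
Let q_gt1 : 1 < q. Proof. by apply: lt_le_trans q_ge4; rewrite ltr1n. Qed.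
Let T_gt0 : 0 < ln q. Proof. by rewrite ln_gt0. Qed.

(** The common weight for both exponents: for [kap = 0] it is [expR (- weight)], and for [kap = 1]
    its square is comparable with the inverse of the kernel diagonal at the chosen points. *)
Definition omega z : R := expR (- (alpha * ln (mx z) ^+ 2) + kap * ln (mx z)).

Lemma omega_gt0 z : 0 < omega z. Proof. exact: expR_gt0. Qed.

(** The inverse square root of [q], the decay factor of the weighted Lagrange functions per
    shell. *)
Definition troot : R := expR (- (ln q / 2)).

Lemma troot_ge0 : 0 <= troot. Proof. exact: expR_ge0. Qed.

Lemma troot_le : troot <= 1 / 2.
Proof.
have : troot * troot * q <= 1.
  have qE : q = expR (ln q) by rewrite lnK// posrE.
  rewrite /troot -expRD [X in _ * X <= _]qE -expRD.
  by rewrite (_ : _ + _ = 0) ?expR0//; field.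
have := troot_ge0; move: troot => t t0 h.
rewrite leNgt; apply/negP => t2.
have tt : 1 / 4 < t * t by nra.
by have := q_ge4; nra.
Qed.

Lemma troot_lt1 : troot < 1. Proof. by apply: le_lt_trans troot_le _; lra. Qed.

Lemma shell_ln k z : in_shell q k z ->
  k%:R * ln q <= ln (mx z) /\ ln (mx z) <= k.+1%:R * ln q.
Proof.
have qE n : q ^+ n = expR (n%:R * ln q) by rewrite expRM_natl lnK// posrE.
rewrite /in_shell => /andP[h1 h2].
rewrite qE mx_exp ler_expR in h1; rewrite qE mx_exp ltr_expR in h2.
by split; last exact: ltW.
Qed.

Lemma trootX n : troot ^+ n = expR (- (n%:R * ln q / 2)).
Proof. by rewrite /troot -expRM_natl; congr expR; ring. Qed.

(** [omega z * wfun (mx z)] is the square root of [mx z], the powers involving [kap] cancelling; the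
    same at [h] turns [1 / wfun (mx h)] into [omega h] divided by a square root. What remains is the
    ratio of the two square roots times the removed factor, that is, [troot] to the distance of the
    shells. *)
Lemma lagrange_function : exists2 C : R, 0 < C & forall i h, h \in c i ->
  exists H : R[i] -> R[i], [/\ centire H, H h = 1,
    forall j g, g \in c j -> g != h -> H g = 0 &
    forall k z, in_shell q k z ->
      omega z * cabs (H z) <= C * omega h * troot ^+ ndist i k].
Proof.
have [C C0 HC] := interpolating_function q_ge4 delta_gt0 delta_le1 c_shell c_size c_sep
  Cw_gt0 (fun r => expR_gt0 _) cellprod_wfun.
exists (C * C * expR (ln q / 2)); first by rewrite !mulr_gt0// expR_gt0.
move=> i h hc; have [G [Gd G0 Gh Gz]] := HC i h hc.
have Gh0 : 0 < cabs (G h).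
  by apply: lt_le_trans Gh; rewrite mulr_gt0 ?invr_gt0// expR_gt0.
have Ghn : G h != 0 by rewrite -cabs_gt0.
exists (fun z => G z / G h); split.
- by move=> z; apply: cderivableM; [exact: Gd|exact: cderivable_cst].
- by rewrite mulfV.
- by move=> j g gc gh; rewrite (G0 j g)// mul0r.
move=> k z hz; rewrite cabsf.
have hh := c_shell hc.
have [z1 z2] := shell_ln hz; have [h1 h2] := shell_ln hh.
set x := ln (mx z) in z1 z2; set y := ln (mx h) in h1 h2.
have wz : omega z * wfun (mx z) = expR (x / 2).
  by rewrite -expRD; congr expR; rewrite -/x; field.
have wh : (wfun (mx h))^-1 = omega h * expR (- (y / 2)).
  by rewrite -expRN -expRD; congr expR; rewrite -/y; field.
have inv : (cabs (G h))^-1 <= C * (wfun (mx h))^-1.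
  by rewrite -[C]invrK -invfM lef_pV2 ?posrE// mulr_gt0 ?invr_gt0 ?expR_gt0.
set m := (if (i < k)%N then mx h / mx z else 1) in Gz *.
have := Gz k z hz; rewrite -/m => {}Gz.
have m0 : 0 <= m by rewrite /m; case: ifP => // _; rewrite divr_ge0// ltW// mx_gt0.
have key : expR (x / 2) * expR (- (y / 2)) * m <= expR (ln q / 2) * troot ^+ ndist i k.
  rewrite trootX /m; case: ltnP => ik.
    have -> : mx h / mx z = expR (y - x) by rewrite expRD expRN /x /y -!mx_exp.
    have -> : (ndist i k)%:R = k%:R - i%:R :> R.
      by rewrite -natrB ?(ltnW ik)//; congr (_%:R); rewrite /ndist; move: ik; clear; lia.
    rewrite -!expRD ler_expR; move: z1 h2; rewrite -natr1.
    exact: shell_gap_below.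
  have -> : (ndist i k)%:R = i%:R - k%:R :> R.
    by rewrite -natrB//; congr (_%:R); rewrite /ndist; move: ik; clear; lia.
  rewrite mulr1 -!expRD ler_expR; move: z2 h1; rewrite -natr1.
  exact: shell_gap_above.
apply: (@le_trans _ _ (omega z * ((C * wfun (mx z) * m) * (C * (wfun (mx h))^-1)))).
  rewrite ler_wpM2l ?(ltW (omega_gt0 z))// ler_pM ?cabs_ge0 ?invr_ge0 ?cabs_ge0//.
rewrite wh.
have -> : omega z * (C * wfun (mx z) * m * (C * (omega h * expR (- (y / 2))))) =
  (C * C * omega h) * ((omega z * wfun (mx z)) * expR (- (y / 2)) * m) by ring.
rewrite wz.
have -> : C * C * expR (ln q / 2) * omega h * troot ^+ ndist i k =
  (C * C * omega h) * (expR (ln q / 2) * troot ^+ ndist i k) by ring.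
by rewrite ler_wpM2l// !mulr_ge0// ltW// expR_gt0.
Qed.

Lemma cell_disjoint i j g : g \in c i -> g \in c j -> i = j.
Proof.
move=> /c_shell/andP[a1 a2] /c_shell/andP[b1 b2].
have := le_lt_trans a1 b2; have := le_lt_trans b1 a2.
by rewrite !ltr_eXn2l//; clear; lia.
Qed.

(** The bound [V] serves the convergence of the series. The final estimate concerns the partial
    sums, in terms of the data shell by shell; the uniform and the square-summable versions are both
    derived from it. *)
Lemma lagrange_interpolation : exists2 C : R, 0 < C & forall (v : R[i] -> R[i]) (V : R),
  0 <= V -> (forall j g, g \in c j -> cabs (v g) * omega g <= V) ->
  exists f (F : nat -> R[i] -> R[i]), [/\ centire f, forall n, centire (F n),
    (forall z (e : R), 0 < e -> exists N, forall n, (N <= n)%N -> cabs (F n z - f z) <= e),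
    forall j g, g \in c j -> f g = v g &
    forall N k z, in_shell q k z -> omega z * cabs (F N z) <=
      C * \sum_(j < N) (\sum_(g <- c j) cabs (v g) * omega g) * troot ^+ ndist j k].
Proof.
have [C C0 HC] := lagrange_function; exists C => // v V V0 HV.
(* A function is attached to every complex number, the zero function off the cells; the cell index
   is unambiguous because the shells are disjoint. *)
have /choice[H HH] h : exists H : R[i] -> R[i], forall i, h \in c i ->
    [/\ centire H, H h = 1, forall j g, g \in c j -> g != h -> H g = 0 &
    forall k z, in_shell q k z -> omega z * cabs (H z) <= C * omega h * troot ^+ ndist i k].
  have [[i hi]|none] := pselect (exists i, h \in c i).
    have [H [h1 h2 h3 h4]] := HC i h hi; exists H => j hj.
    by rewrite (cell_disjoint hj hi).
  by exists (fun=> 0) => i hi; case: none; exists i.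
pose X j z := \sum_(g <- c j) v g * H g z.
pose F N z := \sum_(j < N) X j z.
have Xd j : centire (X j).
  have : forall g, g \in c j -> centire (H g) by move=> g /HH[].
  rewrite /X; elim: (c j) => [|g s IH] sd z.
    rewrite (_ : (fun _ => _) = fun=> 0); first exact: cderivable_cst.
    by apply/funext => t; rewrite big_nil.
  rewrite (_ : (fun _ => _) = fun z => v g * H g z + \sum_(g <- s) v g * H g z); last first.
    by apply/funext => t; rewrite big_cons.
  apply: cderivableD.
    by apply: cderivableM; [exact: cderivable_cst|apply: sd; rewrite mem_head].
  by apply: IH => g' g's; apply: sd; rewrite inE g's orbT.
have FS N z : F N.+1 z = F N z + X N z by rewrite /F big_ord_recr.
have Fd N : centire (F N).
  elim: N => [|N IH] z.
    rewrite (_ : F 0%N = fun=> 0); first exact: cderivable_cst.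
    by apply/funext => t; rewrite /F big_ord0.
  rewrite (_ : F N.+1 = fun z => F N z + X N z); last by apply/funext => t; exact: FS.
  by apply: cderivableD; [exact: IH|exact: Xd].
have Xb j k z : in_shell q k z ->
    omega z * cabs (X j z) <= C * ((\sum_(g <- c j) cabs (v g) * omega g) * troot ^+ ndist j k).
  move=> hz; apply: (le_trans (ler_wpM2l (ltW (omega_gt0 z)) (cabs_sum _ _ _))).
  rewrite mulr_sumr mulr_suml mulr_sumr big_seq [leRHS]big_seq; apply: ler_sum => g gc.
  have [_ _ _ /(_ k z hz) h] := HH g j gc.
  rewrite cabsM mulrCA; have := ler_wpM2l (cabs_ge0 (v g)) h; move/le_trans; apply.
  by rewrite le_eqVlt; apply/orP; left; apply/eqP; ring.
have Mom j : \sum_(g <- c j) cabs (v g) * omega g <= M%:R * V.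
  apply: (@le_trans _ _ (\sum_(g <- c j) V)).
    by rewrite big_seq [leRHS]big_seq; apply: ler_sum => g; exact: HV.
  rewrite big_const_seq iter_addr_0 -[leLHS]mulr_natl count_predT ler_wpM2r// ler_nat//.
have [f fd Ff] : exists2 f, centire f & forall r e : R, 0 < e ->
    exists N, forall n z, (N <= n)%N -> cabs z <= r -> cabs (F n z - f z) <= e.
  apply: (entire_geometric troot_ge0 troot_lt1 Fd) => r.
  pose r1 := Num.max 1 r; have [K HK] := @expn_gt_real R r1 q q_gt1.
  (* A point of the disc lies in a shell [k <= K], hence [n - K <= ndist n k], and [troot ^- K] pays
     for the difference. *)
  exists (expR (alpha * ln r1 ^+ 2) * (C * (M%:R * V)) * troot ^- K), K => n z Kn zr.
  rewrite FS addrAC subrr add0r.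
  have [k hz] := shell_exists_gen z q_gt1.
  have mr : mx z <= r1 by rewrite ge_max !le_max lexx zr orbT.
  have kK : (k <= K)%N.
    move: hz => /andP[h1 _]; have := le_lt_trans (le_trans h1 mr) HK.
    by rewrite ltr_eXn2l// => /ltnW.
  have oz : (omega z)^-1 <= expR (alpha * ln r1 ^+ 2).
    rewrite -expRN ler_expR opprD opprK; have L0 := ln_mx_ge0 z.
    have : ln (mx z) ^+ 2 <= ln r1 ^+ 2.
      rewrite lerXn2r ?nnegrE//; first by rewrite ln_ge0// le_max lexx.
      by rewrite ler_ln ?posrE ?mx_gt0// lt_max ltr01.
    move/(ler_wpM2l (ltW alpha_gt0)); have : 0 <= kap * ln (mx z) by rewrite mulr_ge0.
    lra.
  have := Xb n k z hz; rewrite mulrC -ler_pdivlMr ?omega_gt0// => h.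
  apply: (le_trans h).
  have S0 : 0 <= \sum_(g <- c n) cabs (v g) * omega g.
    by apply: sumr_ge0 => g _; rewrite mulr_ge0 ?cabs_ge0// ltW// omega_gt0.
  have tn : troot ^+ ndist n k <= troot ^- K * troot ^+ n.
    rewrite mulrC ler_pdivlMr ?exprn_gt0 ?expR_gt0// -exprD.
    by apply: ler_wiXn2l; [exact: troot_ge0|exact: ltW troot_lt1|move: kK; rewrite /ndist; clear; lia].
  have t0 := troot_ge0; have tn0 : 0 <= troot ^+ ndist n k by exact: exprn_ge0.
  have oz0 : 0 <= (omega z)^-1 by rewrite invr_ge0 ltW// omega_gt0.
  have E : expR (alpha * ln r1 ^+ 2) * (C * (M%:R * V)) * troot ^- K * troot ^+ n =
      expR (alpha * ln r1 ^+ 2) * (C * ((M%:R * V) * (troot ^- K * troot ^+ n))) by ring.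
  rewrite E [leLHS]mulrC ler_pM//; first by rewrite !mulr_ge0// ltW.
  by rewrite ler_wpM2l ?(ltW C0)// ler_pM.
exists f, F; split => //.
- by move=> z e e0; have [N HN] := Ff (cabs z) e e0; exists N => n Nn; exact: HN.
- move=> j g gc; apply/eqP; rewrite -subr_eq0 -cabs_eq0 eq_le cabs_ge0 andbT.
  apply/ler_addgt0Pl => e e0; rewrite addr0.
  have [N HN] := Ff (cabs g) e e0.
  have := HN (maxn N j.+1) g (leq_maxl _ _) (lexx _).
  have -> : F (maxn N j.+1) g = v g.
    have jN : (j < maxn N j.+1)%N by rewrite leq_max leqnn orbT.
    have [_ Hg1 _ _] := HH g j gc.
    rewrite /F (bigD1 (Ordinal jN))//= big1 ?addr0; last first.
      move=> i ij; rewrite /X big_seq big1// => h hi.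
      have [_ _ H0 _] := HH h i hi; rewrite (H0 j g gc) ?mulr0//.
      apply: contraNneq ij => gh; apply/eqP/val_inj => /=.
      by rewrite -gh in hi; exact: cell_disjoint hi gc.
    rewrite /X (perm_big _ (perm_to_rem gc)) /= big_cons Hg1 mulr1 big_seq big1 ?addr0// => h.
    rewrite mem_rem_uniq// inE => /andP[hg hj].
    have [_ _ H0 _] := HH h j hj; rewrite (H0 j g gc) ?mulr0// eq_sym//.
  by rewrite cabsC.
move=> N k z hz; apply: (le_trans (ler_wpM2l (ltW (omega_gt0 z)) (cabs_sum _ _ _))).
by rewrite mulr_sumr mulr_sumr; apply: ler_sum => j _; exact: Xb.
Qed.

Let supn z : R := Num.max `|Re z| `|Im z|.

Let supn_lip z w : `|supn z - supn w| <= cabs (z - w).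
Proof.
have key (a b a' b' m : R) : `|a - a'| <= m -> `|b - b'| <= m ->
    Num.max `|a| `|b| - Num.max `|a'| `|b'| <= m.
  move=> h1 h2; rewrite lerBlDr ge_max; apply/andP; split.
    apply: (@le_trans _ _ (m + `|a'|)); last by rewrite lerD2l le_max lexx.
    by rewrite -lerBlDr (le_trans _ h1)// lerB_dist.
  apply: (@le_trans _ _ (m + `|b'|)); last by rewrite lerD2l le_max lexx orbT.
  by rewrite -lerBlDr (le_trans _ h2)// lerB_dist.
have hr := Re_le_cabs (z - w); have hi := Im_le_cabs (z - w).
rewrite cReB in hr; rewrite cImB in hi.
rewrite ler_norml lerNl opprB; apply/andP; split; last exact: key.
by apply: key; rewrite distrC.
Qed.

Local Notation flat N := (flatten [seq c j | j <- iota 0 N]).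

Let flatP N g : reflect (exists2 j, (j < N)%N & g \in c j) (g \in flat N).
Proof.
apply: (iffP flatten_mapP) => -[j jN gj]; exists j => //.
  by move: jN; rewrite mem_iota.
by rewrite mem_iota.
Qed.

Lemma flat_uniq N : uniq (flat N).
Proof.
elim: N => [//|N IH]; rewrite -addn1 iotaD map_cat flatten_cat /= cats0 add0n.
rewrite cat_uniq IH c_uniq andbT /=; apply/hasPn => g gN; apply/negP => /flatP[j jN gj].
by rewrite (cell_disjoint gj gN) ltnn in jN.
Qed.

Let gprod_flat N z :
  \prod_(g <- flat N) (z - g) = gprod c predT N z * \prod_(g <- flat N) nu g.
Proof.
have iE : iota 0 N = index_iota 0 N by rewrite /index_iota subn0.
rewrite /gprod iE !big_flatten !big_map !big_mkord -big_split.
apply: eq_bigr => j _.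
rewrite -big_split; apply: eq_bigr => g _.
by rewrite /efac /= divfK// nu_neq0.
Qed.

(** [free_slot] is applied to the values of [supn] at the at most [3 * M] points of the three shells
    around [k], with radii from [q ^+ k] up to [2 * q ^+ k]. The modulus on the boundary is between
    [r] and [2 * r < 4 * q ^+ k], which stays in shell [k] because [4 <= q]; with
    [eta = q ^+ k / (2 * n)] this also yields the constant [8 * n], where [n = 3 * M + 1]. *)
Lemma small_square k : (0 < k)%N -> exists2 r : R, q ^+ k <= r &
  forall z, rect_bnd (- r) r (- r) r z -> in_shell q k z /\
    forall j g, g \in c j -> (ndist j k <= 1)%N ->
      (8 * (3 * M + 1)%:R)^-1 * mx z <= cabs (z - g).
Proof.
move=> k0; pose L := [seq supn g | g <- c k.-1 ++ (c k ++ c k.+1)].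
have sL : (size L <= 3 * M)%N.
  rewrite size_map !size_cat (_ : (3 * M = M + (M + M))%N); last by ring.
  by rewrite !leq_add.
set n := (3 * M + 1)%N; have n0 : 0 < (n%:R : R) by rewrite ltr0n /n addn1.
have Q0 : 0 < q ^+ k by rewrite exprn_gt0.
pose eta : R := q ^+ k / (2 * n%:R); have eta0 : 0 < eta by rewrite divr_gt0// mulr_gt0.
have [i iL Hi] := free_slot L (q ^+ k) eta0.
have iM : (i%:R : R) + 1 <= n%:R.
  by rewrite natr1 ler_nat /n addn1 ltnS (leq_trans iL).
set r := q ^+ k + 2 * eta * i%:R in Hi.
have rE : r = q ^+ k * (1 + i%:R / n%:R) by rewrite /r /eta; field; rewrite gt_eqF.
have i01 : 0 <= i%:R / (n%:R : R) by rewrite divr_ge0// ltW.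
have i1 : i%:R / (n%:R : R) < 1 by rewrite ltr_pdivrMr// mul1r; lra.
have r1 : q ^+ k <= r by rewrite rE -[leLHS]mulr1 ler_wpM2l ?(ltW Q0)//; lra.
have r2 : r < 2 * q ^+ k by rewrite rE mulrC ltr_pM2r//; lra.
exists r => // z zB.
have zr : supn z = r.
  have /andP[/andP[/andP[z1 z2] /andP[z3 z4]] zE] := zB.
  have rr : 0 <= r by apply: le_trans r1; exact: ltW.
  have a1 : `|Re z| <= r by rewrite ler_norml z1 z2.
  have a2 : `|Im z| <= r by rewrite ler_norml z3 z4.
  apply/eqP; rewrite eq_le ge_max a1 a2 /= le_max.
  by move: zE => /or4P[]/eqP ->; rewrite ?normrN (ger0_norm rr) lexx ?orbT.
have z4 : cabs z <= 2 * r.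
  have h1 : `|Re z| <= r by rewrite -zr le_max lexx.
  have h2 : `|Im z| <= r by rewrite -zr le_max lexx orbT.
  by apply: (le_trans (cabs_le_ReIm _)); rewrite mulr_natl mulr2n lerD.
have z1 : r <= cabs z.
  by rewrite -zr /supn ge_max Re_le_cabs Im_le_cabs.
have q1 : 1 <= q ^+ k by rewrite exprn_ege1// ltW.
have mz : mx z = cabs z by rewrite /mx max_r// (le_trans q1)// (le_trans r1).
have z4q : cabs z < 4 * q ^+ k by apply: (le_lt_trans z4); lra.
split.
  by rewrite /in_shell mz (le_trans r1 z1) (lt_le_trans z4q)// exprS ler_wpM2r// ltW.
move=> j g gc jk.
have : eta <= `|supn g - r|.
  apply: Hi; apply: map_f; rewrite !mem_cat.
  have : [|| j == k.-1, j == k | j == k.+1] by move: jk k0; rewrite /ndist; clear; lia.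
  by case/or3P => /eqP <-; rewrite gc ?orbT.
rewrite -zr distrC => /le_trans/(_ (supn_lip z g)); apply: le_trans.
rewrite mz /eta mulrC ler_pdivrMr ?mulr_gt0//.
apply: (le_trans (ltW z4q)); rewrite le_eqVlt; apply/orP; left; apply/eqP.
by field; rewrite gt_eqF.
Qed.

(* [f] is divided by a finite product over the zeros, and the quotient is
   estimated on a square that stays away from them. *)
Lemma uniqueness (f : R[i] -> R[i]) (A : R) : centire f ->
  (forall j g, g \in c j -> f g = 0) ->
  (forall z, omega z * cabs (f z) <= A) -> forall w, f w = 0.
Proof.
move=> fd f0 fA w; have A0 : 0 <= A.
  by apply: le_trans (fA w); rewrite mulr_ge0 ?cabs_ge0// ltW// omega_gt0.
pose d : R := (8 * (3 * M + 1)%:R)^-1.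
have d0 : 0 < d by rewrite invr_gt0 mulr_gt0// ltr0n addn1.
have d1 : d <= 1.
  rewrite invf_le1 ?mulr_gt0 ?ltr0n ?addn1//.
  by rewrite -[leLHS]mulr1 ler_pM// ?ler1n.
pose Cl := expR (- (3 * M%:R * efac_cst q d)) * Cw^-1.
have Cl0 : 0 < Cl by rewrite mulr_gt0 ?expR_gt0// invr_gt0.
pose B := expR (2 * M%:R * cabs w).
(* On the square the quotient is at most a constant over the square root of [mx z], hence of order
   [troot ^+ k]. At [w] the product is bounded by [B], independently of [k], so letting [k] grow
   forces [f w = 0]. *)
have key k : (0 < k)%N -> 2 * mx w <= q ^+ k ->
    cabs (f w) <= 128 * (A / Cl) * B * troot ^+ k.
  move=> k0 wk; have [r r1 Hr] := small_square k0.
  have [g gd gE] := divide_zeros fd (flat_uniq k) (fun s (sN : s \in flat k) =>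
    let: ex_intro2 j _ sj := elimT (flatP k s) sN in f0 j s sj).
  set nn := \prod_(g <- flat k) nu g.
  have {}gE z : f z = (g z * nn) * gprod c predT k z.
    by rewrite gE gprod_flat -/nn; ring.
  have r0 : 0 < r by apply: lt_le_trans r1; rewrite exprn_gt0.
  have bound z : rect_bnd (- r) r (- r) r z -> cabs (g z * nn) <= A / Cl * troot ^+ k.
    move=> /Hr[hz near].
    have := @gprod_lower _ q M c q_ge4 c_shell c_size d predT k k z d0 d1 hz
      (fun j g gc _ => near j g gc).
    rewrite mprod_all// => low.
    have /andP[z1 z2] := hz.
    have /andP[low2 _] := @cellprod_wfun k (mx z) ltac:(by rewrite z1 ltW).
    have {}low : Cl * wfun (mx z) <= cabs (gprod c predT k z).
      by apply: le_trans low; rewrite /Cl -mulrA ler_wpM2l ?expR_ge0.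
    have wf0 : 0 < wfun (mx z) by exact: expR_gt0.
    have gp0 : 0 < cabs (gprod c predT k z).
      by apply: lt_le_trans low; rewrite mulr_gt0.
    have ow : expR (ln (mx z) / 2) = omega z * wfun (mx z).
      by rewrite -expRD; congr expR; field.
    have tE : 1 <= troot ^+ k * expR (ln (mx z) / 2).
      rewrite trootX -expRD -[leLHS]expR0 ler_expR; have [h _] := shell_ln hz; lra.
    rewrite -(ler_pM2r gp0) -cabsM -gE.
    rewrite -(ler_pM2l (omega_gt0 z)) (le_trans (fA z))//.
    apply: (@le_trans _ _ (omega z * (A / Cl * troot ^+ k * (Cl * wfun (mx z))))); last first.
      rewrite ler_wpM2l ?(ltW (omega_gt0 z))// ler_wpM2l//.
      by rewrite mulr_ge0 ?exprn_ge0 ?troot_ge0// divr_ge0// ltW.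
    have -> : omega z * (A / Cl * troot ^+ k * (Cl * wfun (mx z))) =
        A * (troot ^+ k * (omega z * wfun (mx z))) by field; rewrite gt_eqF.
    by rewrite -ow -[leLHS]mulr1 ler_wpM2l.
  have gnd : centire (fun z => g z * nn).
    by move=> z; apply: cderivableM; [exact: gd|exact: cderivable_cst].
  have wr : mx w <= r / 2 by rewrite ler_pdivlMr// mulrC (le_trans wk).
  have := @max_bound _ (fun z => g z * nn) r (A / Cl * troot ^+ k) w gnd r0
    (le_trans (Re_le_cabs w) (le_trans (cabs_le_mx w) wr))
    (le_trans (Im_le_cabs w) (le_trans (cabs_le_mx w) wr)) bound.
  move=> h; rewrite gE cabsM.
  have hb := gprod_bound q_ge4 c_shell c_size predT k (cabs_ge0 w) (lexx (cabs w)).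
  apply: (le_trans (ler_pM (cabs_ge0 _) (cabs_ge0 _) h hb)).
  by rewrite -/B le_eqVlt; apply/orP; left; apply/eqP; ring.
apply/eqP; rewrite -cabs_eq0 eq_le cabs_ge0 andbT.
apply/ler_addgt0Pl => e e0; rewrite addr0.
set D := 128 * (A / Cl) * B in key.
have D0 : 0 <= D by rewrite !mulr_ge0 ?expR_ge0// invr_ge0 ltW.
have [n1 hn1] := @expn_gt_real R (2 * mx w) q q_gt1.
have [n2 hn2] := @expn_gt_real R (D / e) 2 ltac:(by rewrite ltr1n).
have := key (n1 + n2).+1 (ltn0Sn _); rewrite (_ : _ <= _ = true); last first.
  by rewrite (le_trans (ltW hn1))// ler_weXn2l ?(ltW q_gt1)// -addSn addSnnS leq_addr.
move=> /(_ isT)/le_trans; apply.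
have t2 : troot ^+ (n1 + n2).+1 <= (2 ^+ n2)^-1.
  apply: (@le_trans _ _ ((1 / 2) ^+ (n1 + n2).+1)).
    by rewrite lerXn2r ?nnegrE ?troot_ge0 ?troot_le.
  rewrite div1r -exprVn ler_wiXn2l ?invr_ge0 ?invf_le1 ?ler1n//.
  by rewrite leqW// leq_addl.
apply: (le_trans (ler_wpM2l D0 t2)).
by rewrite ler_pdivrMr ?exprn_gt0// mulrC -ler_pdivrMr// ltW.
Qed.

End LagrangeInterpolation.

(** * Schur's test, integration over shells, disjoint squares *)

Section L2Tools.
Variables (R : realType) (alpha : R).
Hypothesis alpha_gt0 : 0 < alpha.
Notation lam := (planar_measure R).
Notation PT := ((measurableTypeR R * measurableTypeR R)%type).

Lemma cauchy_schwarz_weighted (I : Type) (s : seq I) (w x : I -> R) :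
  (forall i, 0 <= w i) ->
  (\sum_(i <- s) w i * x i) ^+ 2 <=
  (\sum_(i <- s) w i) * (\sum_(i <- s) w i * x i ^+ 2).
Proof.
move=> w0; elim: s => [|i s IH]; first by rewrite !big_nil expr0n mul0r.
rewrite !big_cons.
have : 0 <= \sum_(j <- s) w j by exact: sumr_ge0.
have : 0 <= \sum_(j <- s) w j * x j ^+ 2.
  by apply: sumr_ge0 => j _; rewrite mulr_ge0// sqr_ge0.
move: IH (w0 i); set A := \sum_(j <- s) _; set W := \sum_(j <- s) _.
set B := \sum_(j <- s) _; move: (w i) (x i) => u y; clear => AB u0 B0 W0.
suff : 2 * A * y <= W * y ^+ 2 + B.
  move=> h; have := ler_wpM2l u0 h; rewrite -subr_ge0 => h2; rewrite -subr_ge0.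
  have -> : (u + W) * (u * y ^+ 2 + B) - (u * y + A) ^+ 2 =
    (W * B - A ^+ 2) + (u * (W * y ^+ 2 + B) - u * (2 * A * y)) by ring.
  by rewrite addr_ge0// subr_ge0.
have [W1|Wn] := eqVneq W 0.
  have -> : A = 0.
    by apply/eqP; rewrite -sqrf_eq0 eq_le sqr_ge0 andbT (le_trans AB)// W1 mul0r.
  by rewrite mulr0 mul0r W1 mul0r add0r.
have Wp : 0 < W by rewrite lt_def Wn.
rewrite -(ler_pM2l Wp) -subr_ge0.
have -> : W * (W * y ^+ 2 + B) - W * (2 * A * y) = (W * y - A) ^+ 2 + (W * B - A ^+ 2) by ring.
by rewrite addr_ge0 ?sqr_ge0// subr_ge0.
Qed.

(** For [t <= 1 / 2] the row and column sums of [t ^+ ndist j k] are at most 4, whence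
    [16 = 4 * 4]. *)
Lemma schur_dist (t : R) (a : nat -> R) (N K : nat) : 0 <= t -> t <= 1 / 2 ->
  \sum_(k < K) (\sum_(j < N) a j * t ^+ ndist j k) ^+ 2 <= 16 * \sum_(j < N) a j ^+ 2.
Proof.
move=> t0 t2; have t1 : t < 1 by lra.
have S4 n k : \sum_(j < n) t ^+ ndist j k <= 4.
  apply: (le_trans (geo_sum_dist n k t0 t1)).
  by rewrite ler_pdivrMr ?subr_gt0//; lra.
apply: (@le_trans _ _ (\sum_(k < K) 4 * \sum_(j < N) t ^+ ndist j k * a j ^+ 2)).
  apply: ler_sum => k _; rewrite (eq_bigr (fun j : 'I_N => t ^+ ndist j k * a j)); last first.
    by move=> j _; rewrite mulrC.
  apply: (le_trans (cauchy_schwarz_weighted _ _ _)); first by move=> j; exact: exprn_ge0.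
  apply: ler_wpM2r; last exact: S4.
  by apply: sumr_ge0 => j _; rewrite mulr_ge0 ?sqr_ge0 ?exprn_ge0//.
rewrite -mulr_sumr (_ : 16 = 4 * 4 :> R); last by ring.
rewrite -mulrA ler_wpM2l// exchange_big /= mulr_sumr; apply: ler_sum => j _.
rewrite -mulr_suml ler_wpM2r ?sqr_ge0//.
by under eq_bigr do rewrite ndistC; exact: S4.
Qed.

Lemma measure_box (r : R) : 0 <= r -> lam (sqr (0 : R[i]) r) = ((2 * r) ^+ 2)%:E.
Proof.
move=> r0; have := @product_measure1E _ _ _ _ R (@lebesgue_measure R) (@lebesgue_measure R)
  `[Re (0 : R[i]) - r, Re (0 : R[i]) + r]%classic
  `[Im (0 : R[i]) - r, Im (0 : R[i]) + r]%classic (measurable_itv _) (measurable_itv _).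
have M1 (a b : R) : a <= b -> (@lebesgue_measure R) `[a, b]%classic = (b - a)%:E.
  move=> ab; rewrite lebesgue_measure_itv /= lte_fin.
  by case: (ltrP a b) => // ba; rewrite (le_anti (_ : a <= b <= a)) ?subrr// ab.
move=> E; apply: (etrans E).
have rr : Re (0 : R[i]) - r <= Re (0 : R[i]) + r by rewrite /= lerD2l ge0_cp.
have ri : Im (0 : R[i]) - r <= Im (0 : R[i]) + r by rewrite /= lerD2l ge0_cp.
apply: (etrans (f_equal2 mule (M1 _ _ rr) (M1 _ _ ri))).
by rewrite -EFinM /=; congr EFin; ring.
Qed.

(** Shell [k] lies in the square of half side [q ^+ k.+1], whose area is [4 * q ^+ 2] times
    [(q ^+ k) ^+ 2]; the density is dominated by the sum of constants on these squares. *)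
Lemma shell_integral (q S : R) (b : nat -> R) f : 1 < q -> centire f -> 0 <= S ->
  (forall k, 0 <= b k) -> (forall K, \sum_(k < K) b k <= S) ->
  (forall k x, in_shell q k (plane x) -> fdens alpha f x * (q ^+ k) ^+ 2 <= b k) ->
  (fint alpha f <= (4 * q ^+ 2 * S)%:E)%E.
Proof.
move=> q1 fd S0 b0 bS fb; have q0 : 0 < q by lra.
pose beta k : R := b k / (q ^+ k) ^+ 2.
have beta0 k : 0 <= beta k by rewrite divr_ge0// sqr_ge0.
pose box k := sqr (0 : R[i]) (q ^+ k.+1).
have mbox k : measurable (box k : set PT) by exact: measurable_sqr.
pose g k (x : PT) : \bar R := (beta k * \1_(box k) x)%:E.
have g0 k x : (0 <= g k x)%E by rewrite lee_fin mulr_ge0.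
have mg k : measurable_fun [set: PT] (g k).
  apply/measurable_EFinP; apply: measurable_funM => //.
have le1 x : ((fdens alpha f x)%:E <= \sum_(0 <= k <oo) g k x)%E.
  have [k hk] := shell_exists_gen (plane x) q1.
  apply: (@le_trans _ _ (g k x)).
    rewrite lee_fin indicE mem_set ?mulr1; last first.
      have /andP[_ /ltW hx] := hk; case: x hk hx => x y hk hx.
      split; rewrite /= in_itv/= sub0r add0r -ler_norml.
        exact: le_trans (Re_le_cabs (plane (x, y))) (le_trans (cabs_le_mx _) hx).
      exact: le_trans (Im_le_cabs (plane (x, y))) (le_trans (cabs_le_mx _) hx).
    by rewrite ler_pdivlMr ?exprn_gt0// fb.
  apply: le_trans (nneseries_lim_ge k.+1 (fun n _ _ => g0 n x)).
  rewrite big_nat_recr//= leeDr// sume_ge0// => i _; exact: g0.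
apply: (@le_trans _ _ (\int[lam]_(x in setT) \sum_(0 <= k <oo) g k x)%E).
  apply: ge0_le_integral => //.
  - by move=> x _; rewrite lee_fin fdens_ge0.
  - by apply: measurable_fdens => z; exact: cderivable_ccont.
  - by apply: ge0_emeasurable_sum => // n x _ _; exact: g0.
rewrite integral_nneseries//.
have gE k : (\int[lam]_(x in setT) g k x = (4 * q ^+ 2 * b k)%:E)%E.
  under eq_integral do rewrite /g EFinM.
  rewrite ge0_integralZl_EFin//; last first.
    by apply/measurable_EFinP.
  rewrite integral_indic// setIT /box measure_box ?exprn_ge0 ?(ltW q0)// -EFinM.
  congr EFin; rewrite /beta (_ : q ^+ k.+1 = q * q ^+ k) ?exprS//.
  have : q ^+ k != 0 by rewrite expf_neq0// gt_eqF.
  by move: (q ^+ k) => u u0; field.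
apply: lime_le; first by apply: is_cvg_nneseries => n _ _; apply: integral_ge0 => x _; exact: g0.
near=> n; rewrite (eq_bigr (fun k => (4 * q ^+ 2 * b k)%:E)); last by move=> k _; exact: gE.
rewrite sumEFin lee_fin big_mkord -mulr_sumr ler_wpM2l//.
by rewrite mulr_ge0// sqr_ge0.
Unshelve. all: by end_near.
Qed.

(** The separation makes the squares disjoint: a common point would be within [2 * d * mx g] of each
    centre. *)
Lemma sum_squares_le (h : PT -> \bar R) (s : seq R[i]) (d : R) : 0 < d ->
  measurable_fun [set: PT] h -> (forall x, 0 <= h x)%E -> uniq s ->
  (forall g g', g \in s -> g' \in s -> g != g' ->
     2 * d * (mx g + mx g') < cabs (g - g')) ->
  (\sum_(g <- s) \int[lam]_(x in sqr g (d * mx g)) h x <= \int[lam]_x h x)%E.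
Proof.
move=> d0 mh h0 us sep.
have ms g : measurable (sqr g (d * mx g) : set PT) by exact: measurable_sqr.
pose H (g : R[i]) := h \_ (sqr g (d * mx g)).
have H0 g x : (0 <= H g x)%E by rewrite /H patchE; case: ifP.
have mH g : measurable_fun [set: PT] (H g).
  by apply/(measurable_restrictT h (ms g)); exact: measurable_funTS.
rewrite (eq_bigr (fun g => \int[lam]_x H g x)%E); last by move=> g _; rewrite integral_mkcond.
rewrite -ge0_integral_sum//; apply: ge0_le_integral => //.
- by move=> x _; apply: sume_ge0 => g _; exact: H0.
- by apply: emeasurable_sum => g _; exact: mH.
move=> x _; have [[g gs xg]|none] := pselect (exists2 g, g \in s & sqr g (d * mx g) x); last first.
  rewrite big_seq big1 ?h0// => g gs; rewrite /H patchE ifN//.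
  by apply/negP; rewrite inE => xg; apply: none; exists g.
rewrite (perm_big _ (perm_to_rem gs)) /= big_cons.
rewrite big_seq big1 ?adde0; first by rewrite /H patchE mem_set.
move=> g' ; rewrite mem_rem_uniq// inE => /andP[gg' gs'].
rewrite /H patchE ifN//; apply/negP; rewrite inE => xg'.
have near t : sqr t (d * mx t) x -> cabs (plane x - t) <= 2 * d * mx t.
  case: x {xg xg'} => x y [] /=; rewrite !in_itv/= => /andP[a1 a2] /andP[b1 b2].
  rewrite (le_trans (cabs_le_ReIm _))// cReB cImB /plane /=.
  have : `|x - Re t| <= d * mx t by rewrite ler_norml; apply/andP; split; lra.
  have : `|y - Im t| <= d * mx t by rewrite ler_norml; apply/andP; split; lra.
  lra.
have := sep _ _ gs gs' ltac:(by rewrite eq_sym).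
have -> : g - g' = (plane x - g') - (plane x - g) by ring.
have := cabsB (plane x - g') (plane x - g); have := near _ xg; have := near _ xg'.
lra.
Qed.

End L2Tools.

(** * Complete interpolating sequences for both exponents *)

Section CompleteInterpolating.
Variables (R : realType) (alpha kap q delta : R) (M : nat) (c : nat -> seq R[i]).
Hypothesis alpha_gt0 : 0 < alpha.
Hypothesis kap_ge0 : 0 <= kap.
Hypothesis q_ge4 : 4 <= q.
Hypothesis delta_gt0 : 0 < delta.
Hypothesis delta_le1 : delta <= 1.
Hypothesis c_shell : forall j g, g \in c j -> in_shell q j g.
Hypothesis c_size : forall j, (size (c j) <= M)%N.
Hypothesis c_uniq : forall j, uniq (c j).
Hypothesis c_sep : forall i j g h, g \in c i -> h \in c j -> g != h ->
  delta * mx g <= cabs (g - h).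
Variable Cw : R.
Hypothesis Cw_gt0 : 0 < Cw.
Hypothesis cellprod_wfun : forall k rho, q ^+ k <= rho <= q ^+ k.+1 ->
  Cw^-1 * wfun alpha kap rho <= cellprod c k rho <= Cw * wfun alpha kap rho.
Implicit Types (z w g : R[i]) (f v : R[i] -> R[i]).

Let q_gt0 : 0 < q. Proof. by apply: lt_le_trans q_ge4. Qed.
Let q_gt1 : 1 < q. Proof. by apply: lt_le_trans q_ge4; rewrite ltr1n. Qed.

Definition cellset : set R[i] := [set g | exists j, g \in c j].

Local Notation om := (omega alpha kap).

Let om_gt0 z : 0 < om z. Proof. exact: omega_gt0. Qed.

Lemma cellset_countable : countable cellset.
Proof.
rewrite (_ : cellset = \bigcup_j [set` c j]).
  by apply: bigcup_countable => // j _; apply: finite_set_countable; exact: finite_seq.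
by apply/seteqP; split => [g [j gj]|g [j _ gj]]; exists j.
Qed.

Let interp := lagrange_interpolation alpha_gt0 kap_ge0 q_ge4 delta_gt0 delta_le1
  c_shell c_size c_uniq c_sep Cw_gt0 cellprod_wfun.

Let uniq_fun := uniqueness q_ge4 c_shell c_size c_uniq Cw_gt0 cellprod_wfun.

Let unique (f g : R[i] -> R[i]) (A : R) : centire f -> centire g ->
  (forall j l, l \in c j -> f l = g l) ->
  (forall z, om z * cabs (f z - g z) <= A) -> f = g.
Proof.
move=> fd gd fg fA; apply/funext => z; apply/eqP; rewrite -subr_eq0; apply/eqP.
apply: (uniq_fun (f := fun z => f z - g z) _ _ fA).
  by move=> w; exact: cderivableB.
by move=> j l lc; rewrite (fg j)// subrr.
Qed.

Lemma interp_sup : exists2 C : R, 0 < C & forall v (V : R), 0 <= V ->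
  (forall j g, g \in c j -> cabs (v g) * om g <= V) ->
  exists f, [/\ centire f, forall j g, g \in c j -> f g = v g &
    forall z, om z * cabs (f z) <= C * V].
Proof.
(* At most [M] points per cell and [2 / (1 - troot) <= 4]; the successor of [M] keeps the constant
   positive if [M = 0]. *)
have [C C0 HC] := interp; exists (C * (M.+1%:R * 4)).
  by rewrite !mulr_gt0.
move=> v V V0 HV; have [f [F [fd Fd Ff fv Fb]]] := HC v V V0 HV.
exists f; split => // z; have [k hz] := shell_exists_gen z q_gt1.
apply/ler_addgt0Pl => e e0.
have [N HN] := Ff z (e / om z) (divr_gt0 e0 (om_gt0 z)).
have := HN N (leqnn N); rewrite ler_pdivlMr ?om_gt0// => h1.
have h2 := Fb N k z hz.
have h3 : \sum_(j < N) (\sum_(g <- c j) cabs (v g) * om g) * troot q ^+ ndist j k <=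
    M.+1%:R * 4 * V.
  apply: (@le_trans _ _ (\sum_(j < N) (M.+1%:R * V) * troot q ^+ ndist j k)).
    apply: ler_sum => j _; rewrite ler_wpM2r ?exprn_ge0 ?troot_ge0//.
    apply: (@le_trans _ _ (\sum_(g <- c j) V)).
      by rewrite big_seq [leRHS]big_seq; apply: ler_sum => g; exact: HV.
    rewrite big_const_seq iter_addr_0 -[leLHS]mulr_natl count_predT ler_wpM2r//.
    by rewrite ler_nat leqW.
  rewrite -mulr_sumr [leRHS]mulrAC ler_wpM2l ?mulr_ge0//.
  apply: (le_trans (geo_sum_dist N k (troot_ge0 q) (troot_lt1 q_ge4))).
  by rewrite ler_pdivrMr ?subr_gt0 ?troot_lt1//; have := troot_le q_ge4; lra.
have h4 : om z * cabs (f z) <= om z * cabs (F N z) + e.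
  have := cabsBD (f z) (F N z); rewrite cabsC => h5.
  have := ler_wpM2l (ltW (om_gt0 z)) h5; rewrite mulrBr mulrC in h1 *.
  by rewrite [om z * cabs (F N z - f z)]mulrC; lra.
apply: (le_trans h4); rewrite addrC lerD2l (le_trans h2)//.
by rewrite -[leRHS]mulrA ler_wpM2l ?(ltW C0).
Qed.

Let sup_nonneg_le (A : set R[i]) (u : R[i] -> R) (V : R) : 0 <= V ->
  (forall z, A z -> u z <= V) -> (sup_nonneg A u <= V%:E)%E.
Proof.
move=> V0 H; rewrite /sup_nonneg ge_max lee_fin V0 /=.
by apply: ge_ereal_sup => _ [z Az <-]; rewrite lee_fin H.
Qed.

Let sup_nonneg_ge (A : set R[i]) (u : R[i] -> R) z : A z ->
  ((u z)%:E <= sup_nonneg A u)%E.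
Proof.
by move=> Az; rewrite /sup_nonneg le_max; apply/orP; right; apply: ereal_sup_ubound; exists z.
Qed.

Let sup_nonneg_real (A : set R[i]) (u : R[i] -> R) : (sup_nonneg A u < +oo)%E ->
  exists V : R, [/\ 0 <= V, sup_nonneg A u = V%:E & forall z, A z -> u z <= V].
Proof.
move=> H; have h0 : (0 <= sup_nonneg A u)%E by rewrite /sup_nonneg le_max lexx.
exists (fine (sup_nonneg A u)).
have E : (fine (sup_nonneg A u))%:E = sup_nonneg A u by rewrite fineK// ge0_fin_numE.
split=> //; first by rewrite fine_ge0.
by move=> z Az; rewrite -lee_fin E; exact: sup_nonneg_ge.
Qed.

Lemma complete_interpolating_infty : kap = 0 -> complete_interpolating alpha exp_infty cellset.
Proof.
move=> kap0; have omE z : om z = expR (- weight alpha z).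
  by rewrite /omega weightE kap0 mul0r addr0.
have [C C0 HC] := interp_sup.
have fockP f : fock alpha exp_infty f -> centire f /\ exists V : R, [/\ 0 <= V,
    fock_norm alpha exp_infty f = V%:E & forall z, om z * cabs (f z) <= V].
  move=> [/entireP fd /sup_nonneg_real[V [V0 VE HV]]]; split=> //.
  by exists V; split => // z; rewrite mulrC omE; exact: HV.
split; first exact: cellset_countable.
- exists C => // f Hf; have [fd [A [A0 AE HA]]] := fockP f Hf.
  have [|V [V0 VE HV]] := @sup_nonneg_real cellset (fun l => cabs (f l) * expR (- weight alpha l)).
    apply: (@le_lt_trans _ _ A%:E); last exact: ltry.
    by apply: sup_nonneg_le => // z _; rewrite -omE mulrC.
  have [|g [gd gf gb]] := HC f V V0.
    by move=> j g gc; rewrite omE; apply: HV; exists j.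
  have E : f = g.
    apply: (unique (A := A + C * V)) => //; first by move=> j l lc; rewrite (gf j).
    move=> z; apply: (@le_trans _ _ (om z * (cabs (f z) + cabs (g z)))).
      by rewrite ler_wpM2l ?(ltW (om_gt0 z))// cabsB.
    by rewrite mulrDr lerD.
  rewrite /seq_norm VE -EFinM; apply: sup_nonneg_le; first by rewrite mulr_ge0// ltW.
  by move=> z _; rewrite -omE mulrC E.
- move=> v /sup_nonneg_real[V [V0 VE HV]].
  have [|f [fd fv fb]] := HC v V V0.
    by move=> j g gc; rewrite omE; apply: HV; exists j.
  exists f; last by move=> l [j lc]; rewrite (fv j).
  split; first exact/entireP.
  apply: (@le_lt_trans _ _ (C * V)%:E); last exact: ltry.
  apply: sup_nonneg_le; first by rewrite mulr_ge0// ltW.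
  by move=> z _; rewrite -omE mulrC.
Qed.

Section SquareIntegrable.
Hypothesis kap1 : kap = 1.

Let om2 z : om z ^+ 2 = expR (- (2 * weight alpha z)) * mx z ^+ 2.
Proof.
rewrite /omega kap1 mul1r expRD -mx_exp exprMn; congr (_ * _).
by rewrite -expRM_natl weightE; congr expR; ring.
Qed.

Let fdensE f x : fdens alpha f x = (om (plane x) * cabs (f (plane x))) ^+ 2 / mx (plane x) ^+ 2.
Proof.
rewrite exprMn om2 /fdens; field; rewrite gt_eqF// mx_gt0//.
Qed.

(** On shell [k] the partial sum is controlled by the convolution of the cell sums with
    [troot ^+ ndist j k]. Schur's test bounds these in [l2], [shell_integral] turns them into an
    integral, and Fatou passes to the limit. *)
Lemma interp_l2 : exists2 C : R, 0 < C & forall v (S : R), 0 <= S ->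
  (forall N, \sum_(j < N) \sum_(g <- c j) (cabs (v g) * om g) ^+ 2 <= S) ->
  exists f, [/\ fock2 alpha f, forall j g, g \in c j -> f g = v g &
    (fint alpha f <= (C * S)%:E)%E].
Proof.
have [C C0 HC] := interp.
exists (4 * q ^+ 2 * (C ^+ 2 * 16 * M.+1%:R)).
  by rewrite !mulr_gt0 ?exprn_gt0.
move=> v S S0 HS.
(* Square-summable data are bounded, which is what [interp] asks for; this bound does not enter the
   final constant. *)
have V1 j g : g \in c j -> cabs (v g) * om g <= Num.sqrt S.
  move=> gc; rewrite -[leLHS]ger0_norm ?mulr_ge0 ?cabs_ge0 ?(ltW (om_gt0 g))//.
  rewrite -sqrtr_sqr ler_sqrt//; apply: le_trans (HS j.+1).
  rewrite big_ord_recr /= (perm_big _ (perm_to_rem gc)) /= big_cons addrCA lerDl.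
  by apply: addr_ge0; [apply: sumr_ge0 => i _|]; apply: sumr_ge0 => i' _; exact: sqr_ge0.
have [f [F [fd Fd Ff fv Fb]]] := HC v (Num.sqrt S) (sqrtr_ge0 S) V1.
have Fint N : (fint alpha (F N) <= (4 * q ^+ 2 * (C ^+ 2 * 16 * M.+1%:R) * S)%:E)%E.
  pose a j := \sum_(g <- c j) cabs (v g) * om g.
  pose b k := (C * \sum_(j < N) a j * troot q ^+ ndist j k) ^+ 2.
  rewrite -mulrA; apply: (@shell_integral R alpha q _ b (F N) q_gt1 (Fd N)).
  - by rewrite !mulr_ge0// ltW.
  - by move=> k; exact: sqr_ge0.
  - move=> K; rewrite /b; under eq_bigr do rewrite exprMn.
    have -> : C ^+ 2 * 16 * M.+1%:R * S = C ^+ 2 * (16 * (M.+1%:R * S)) by ring.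
    rewrite -mulr_sumr ler_wpM2l ?sqr_ge0//.
    apply: (le_trans (schur_dist a N K (troot_ge0 q) (troot_le q_ge4))).
    rewrite ler_wpM2l//; apply: (@le_trans _ _ (M.+1%:R *
      \sum_(j < N) \sum_(g <- c j) (cabs (v g) * om g) ^+ 2)); last by rewrite ler_wpM2l.
    rewrite mulr_sumr; apply: ler_sum => j _.
    (* The square of the sum over a cell costs a factor equal to its number of points. *)
    have := @cauchy_schwarz_weighted R _ (c j) (fun=> 1) (fun g => cabs (v g) * om g) (fun=> ler01).
    rewrite /a; under eq_bigr do rewrite mul1r.
    under [X in _ <= _ * X]eq_bigr do rewrite mul1r.
    move/le_trans; apply; rewrite ler_wpM2r//.
      by apply: sumr_ge0 => g _; exact: sqr_ge0.
    by rewrite big_const_seq iter_addr_0 count_predT ler_nat leqW.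
  move=> k x hx; rewrite fdensE.
  have mq : (q ^+ k) ^+ 2 <= mx (plane x) ^+ 2.
    by have /andP[h _] := hx; rewrite lerXn2r ?nnegrE ?exprn_ge0 ?(ltW q_gt0)// ltW// mx_gt0.
  have m0 : 0 < mx (plane x) ^+ 2 by rewrite exprn_gt0// mx_gt0.
  apply: (@le_trans _ _ ((om (plane x) * cabs (F N (plane x))) ^+ 2)).
    by rewrite mulrAC ler_pdivrMr// ler_wpM2l// sqr_ge0.
  have h := Fb N k _ hx.
  have h0 : 0 <= om (plane x) * cabs (F N (plane x)).
    by rewrite mulr_ge0 ?cabs_ge0// ltW.
  by rewrite lerXn2r ?nnegrE// (le_trans h0 h).
have fle := @fint_fatou R alpha F f _ Fd Ff (ex_intro _ 0%N (fun n _ => Fint n)).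
by exists f; split => //; split => //; apply: (le_lt_trans fle); exact: ltry.
Qed.

(** The upper sampling inequality: [local_estimate] on squares of half side [delta / 8 * mx g],
    which are disjoint by the separation, so the integrals add up to at most the full one. *)
Lemma carleson : exists2 C : R, 0 < C & forall f N, centire f ->
  ((\sum_(j < N) \sum_(g <- c j) (cabs (f g) * om g) ^+ 2)%:E <= C%:E * fint alpha f)%E.
Proof.
have [C C0 HC] := @local_estimate R alpha alpha_gt0 (delta / 8) ltac:(by rewrite divr_gt0)
  ltac:(have := delta_le1; lra).
exists C => // f N fd; pose s := flatten [seq c j | j <- index_iota 0 N].
have sP g : g \in s -> exists j, g \in c j.
  by move/flatten_mapP => [j _ gj]; exists j.
have us : uniq s by rewrite /s /index_iota subn0; exact: (flat_uniq q_ge4 c_shell c_uniq N).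
have -> : \sum_(j < N) \sum_(g <- c j) (cabs (f g) * om g) ^+ 2 =
    \sum_(g <- s) (cabs (f g) * om g) ^+ 2.
  by rewrite /s big_flatten big_map big_mkord.
have mh : measurable_fun [set: (measurableTypeR R * measurableTypeR R)%type]
    (fun x => (fdens alpha f x)%:E).
  by apply: measurable_fdens => z; exact: cderivable_ccont.
have sepS g g' : g \in s -> g' \in s -> g != g' ->
    2 * (delta / 8) * (mx g + mx g') < cabs (g - g').
  move=> /sP[j gj] /sP[j' gj'] gg'.
  have h1 := c_sep gj gj' gg'; have h2 := c_sep gj' gj.
  have := h2 ltac:(by rewrite eq_sym); rewrite cabsC => {}h2.
  have := mx_gt0 g; have := mx_gt0 g'; have := delta_gt0.
  move: h1 h2; set u := mx g; set w := mx g'; set d := cabs _ => h1 h2 d0 w0 u0.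
  have : 0 < delta * (u + w) by rewrite mulr_gt0// addr_gt0.
  lra.
have B := @sum_squares_le R (fun x => (fdens alpha f x)%:E) s (delta / 8)
  ltac:(by rewrite divr_gt0) mh (fun x => fdens_ge0 alpha f x) us sepS.
apply: (le_trans _ (lee_wpmul2l (_ : (0 <= C%:E)%E) B)); last by rewrite lee_fin ltW.
rewrite -sumEFin ge0_sume_distrr; last first.
  by move=> g _; apply: integral_ge0 => x _; exact: fdens_ge0.
apply: lee_sum => g _; rewrite exprMn om2 mulrA; exact: HC.
Qed.

Let ker g := Re (fock_kernel alpha g g).

(** The inverse kernel diagonal is comparable with [om g ^+ 2] at the points of the cells. One bound
    is [kernel_upper]; the other applies [kernel_lower] to the function interpolating 1 at [g] and 0
    at all other points. *)
Let ker_bounds : exists2 C : R, 0 < C & forall j g, g \in c j ->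
  [/\ 0 < ker g, om g ^+ 2 <= C / ker g & (ker g)^-1 <= C * om g ^+ 2].
Proof.
have [C1 C10 H1] := kernel_upper alpha_gt0; have [C2 C20 H2] := interp_l2.
exists (C1 + 4 * C2); first by rewrite addr_gt0// mulr_gt0.
move=> j g gc; pose v z : R[i] := (z == g)%:R.
have [|f [Hf fv fb]] := H2 v (om g ^+ 2) (sqr_ge0 _).
  move=> N; have zero (g' : R[i]) : g' != g -> (cabs (v g') * om g') ^+ 2 = 0.
    by move=> h; rewrite /v (negbTE h) cabs0 mul0r expr0n.
  have vg : (cabs (v g) * om g) ^+ 2 = om g ^+ 2 by rewrite /v eqxx cabs1 mul1r.
  have [jN|Nj] := ltnP j N.
    rewrite (bigD1 (Ordinal jN))//= [X in _ + X]big1 ?addr0; last first.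
      move=> i ij; rewrite big_seq big1// => g' g'i; apply: zero.
      apply: contraNneq ij => gg; apply/eqP/val_inj => /=; rewrite gg in g'i.
      exact: (cell_disjoint q_ge4 c_shell g'i gc).
    rewrite (perm_big _ (perm_to_rem gc)) /= big_cons vg big_seq big1 ?addr0// => g'.
    by rewrite mem_rem_uniq// inE => /andP[h _]; exact: zero.
  rewrite big1 ?sqr_ge0// => i _; rewrite big_seq big1// => g' g'i; apply: zero.
  apply/eqP => gg; rewrite gg in g'i.
  have ij := cell_disjoint q_ge4 c_shell g'i gc.
  by have := ltn_ord i; rewrite ij ltnNge Nj.
have fg : f g = 1 by rewrite (fv j)// /v eqxx.
have := kernel_lower alpha_gt0 g Hf; rewrite fg cabs1 expr1n -/(ker g) => h1.
have nf : nrm alpha f <= C2 * om g ^+ 2 by rewrite -lee_fin -fintE.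
have k0 : 0 < ker g.
  rewrite lt_def (kernel_ge0 alpha_gt0 g) andbT; apply: contraTneq h1 => ->.
  by rewrite mulr0 mul0r ler10.
have o2 : 0 < om g ^+ 2 by rewrite exprn_gt0.
split=> //.
  rewrite ler_pdivlMr// mulrC (le_trans (_ : _ <= C1))//; last by rewrite lerDl mulr_ge0// ltW.
  by rewrite om2; exact: H1.
rewrite -[leLHS]mul1r ler_pdivrMr//.
apply: (le_trans h1); rewrite -mulrA [leRHS]mulrC; apply: (@le_trans _ _ (4 * (ker g * (C2 * om g ^+ 2)))).
  by rewrite ler_pM2l// ler_pM2l.
have : 0 <= ker g * (C1 * om g ^+ 2) by rewrite !mulr_ge0 ?ltW.
have -> : ker g * ((C1 + 4 * C2) * om g ^+ 2) =
  ker g * (C1 * om g ^+ 2) + 4 * (ker g * (C2 * om g ^+ 2)) by ring.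
lra.
Qed.

(** A finite subset of [cellset] is covered by finitely many cells, so the partial sums over cells
    control the unordered sum. *)
Let esum_le (tau : R[i] -> R) (S : R) : (forall j g, g \in c j -> 0 <= tau g) ->
  (forall N, \sum_(j < N) \sum_(g <- c j) tau g <= S) ->
  (\esum_(l in cellset) (tau l)%:E <= S%:E)%E.
Proof.
move=> t0 H; apply: ge_ereal_sup => _ [X [finX XG] <-].
rewrite fsbig_finite//= sumEFin lee_fin.
have sX l : l \in finmap.enum_fset (fset_set X) -> exists j, l \in c j.
  by move=> lX; apply: XG; move: lX; rewrite in_fset_set// inE.
have uX := finmap.fset_uniq (fset_set X).
move: sX uX; move: (finmap.enum_fset (fset_set X)) => s sX us {finX XG X}.
have [N HN] : exists N, forall l, l \in s -> exists2 j, (j < N)%N & l \in c j.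
  elim: s sX {us} => [|l s IH] sX; first by exists 0%N.
  have [|N HN] := IH; first by move=> l' l's; apply: sX; rewrite inE l's orbT.
  have [j lj] := sX l (mem_head _ _); exists (maxn N j.+1) => l'.
  rewrite inE => /orP[/eqP ->|/HN[j' j'N l'j']].
    by exists j => //; rewrite leq_max leqnn orbT.
  by exists j' => //; rewrite leq_max j'N.
apply: le_trans (H N).
pose t := flatten [seq c j | j <- index_iota 0 N].
have tE : \sum_(j < N) \sum_(g <- c j) tau g = \sum_(g <- t) tau g.
  by rewrite /t big_flatten big_map big_mkord.
have ut : uniq t by rewrite /t /index_iota subn0; exact: (flat_uniq q_ge4 c_shell c_uniq N).
have st : {subset s <= t}.
  move=> l /HN[j jN lj]; apply/flatten_mapP; exists j => //.
  by rewrite mem_index_iota.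
rewrite tE [leRHS](bigID (mem s)) /= -[leLHS]addr0; apply: lerD.
  rewrite -[leRHS]big_filter; suff h : perm_eq s [seq i <- t | i \in s] by rewrite (perm_big _ h).
  apply: uniq_perm => //; first exact: filter_uniq.
  by move=> l; rewrite mem_filter; case ls: (l \in s) => //=; rewrite st.
rewrite big_seq_cond; apply: sumr_ge0 => l /andP[lt _].
by move: lt => /flatten_mapP[j _ lj]; exact: t0 lj.
Qed.

Let esum_ge_cells (tau : R[i] -> R) N : (forall j g, g \in c j -> 0 <= tau g) ->
  ((\sum_(j < N) \sum_(g <- c j) tau g)%:E <= \esum_(l in cellset) (tau l)%:E)%E.
Proof.
move=> t0; pose t := flatten [seq c j | j <- index_iota 0 N].
have tE : \sum_(j < N) \sum_(g <- c j) tau g = \sum_(g <- t) tau g.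
  by rewrite /t big_flatten big_map big_mkord.
have ut : uniq t by rewrite /t /index_iota subn0; exact: (flat_uniq q_ge4 c_shell c_uniq N).
apply: esum_ge; exists [set` t].
  split; first exact: finite_seq.
  by move=> l /= /flatten_mapP[j _ lj]; exists j.
by rewrite tE -fsbig_seq//= sumEFin.
Qed.

Lemma complete_interpolating_two : complete_interpolating alpha exp_two cellset.
Proof.
have [C1 C10 H1] := interp_l2; have [C2 C20 H2] := carleson.
have [C3 C30 H3] := ker_bounds.
pose tau v l := cabs (v l) ^+ 2 / ker l.
have tau0 v j g : g \in c j -> 0 <= tau v g.
  by move=> /H3[k0 _ _]; rewrite divr_ge0 ?sqr_ge0// ltW.
have up v N (S : R) : (\sum_(j < N) \sum_(g <- c j) (cabs (v g) * om g) ^+ 2 <= S) ->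
    \sum_(j < N) \sum_(g <- c j) tau v g <= C3 * S.
  move=> h; apply: (le_trans _ (ler_wpM2l (ltW C30) h)).
  rewrite mulr_sumr; apply: ler_sum => j _; rewrite mulr_sumr big_seq [leRHS]big_seq.
  apply: ler_sum => g gc; have [_ _ h2] := H3 j g gc.
  rewrite /tau exprMn; have -> x y : C3 * (x * y) = x * (C3 * y) by ring.
  by rewrite ler_wpM2l ?sqr_ge0.
have down v N (S : R) : \sum_(j < N) \sum_(g <- c j) tau v g <= S ->
    \sum_(j < N) \sum_(g <- c j) (cabs (v g) * om g) ^+ 2 <= C3 * S.
  move=> h; apply: (le_trans _ (ler_wpM2l (ltW C30) h)).
  rewrite mulr_sumr; apply: ler_sum => j _; rewrite mulr_sumr big_seq [leRHS]big_seq.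
  apply: ler_sum => g gc; have [_ h2 _] := H3 j g gc.
  rewrite /tau exprMn; have -> x y : C3 * (x / y) = x * (C3 / y) by rewrite mulrCA.
  by rewrite ler_wpM2l ?sqr_ge0.
pose E v := (\esum_(l in cellset) (tau v l)%:E)%E.
have E0 v : (0 <= E v)%E.
  by have := esum_ge_cells 0 (tau0 v); rewrite big_ord0.
split; first exact: cellset_countable.
- pose A := C3 * C2 + C1 * C3; have A0 : 0 < A by rewrite addr_gt0// mulr_gt0.
  exists (Num.sqrt A); first by rewrite sqrtr_gt0.
  move=> f /fock2P Hf; have [fd _] := Hf; set n := nrm alpha f.
  have n0 : 0 <= n := nrm_ge0 alpha f.
  have fE : fint alpha f = n%:E := fintE Hf.
  have EU : (E f <= (C3 * C2 * n)%:E)%E.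
    apply: esum_le; first exact: tau0.
    by move=> N; rewrite -mulrA; apply: up; rewrite -lee_fin EFinM -fE; exact: H2.
  have Er : E f = (fine (E f))%:E.
    by rewrite fineK// ge0_fin_numE ?E0// (le_lt_trans EU) ?ltry.
  set e := fine (E f) in Er; have e0 : 0 <= e by rewrite fine_ge0// E0.
  have eU : e <= C3 * C2 * n by rewrite -lee_fin -Er.
  (* The function interpolating the samples of [f] has norm controlled by them and coincides with
     [f] by uniqueness, both being bounded when weighted by [om]. *)
  have nU : n <= C1 * (C3 * e).
    have [||g [Hg gf gb]] := H1 f (C3 * e); first by rewrite mulr_ge0// ltW.
      by move=> N; apply: down; rewrite -lee_fin -Er; apply: esum_ge_cells; exact: tau0.
    suff fg : f = g by rewrite -lee_fin -fE {1}fg.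
    have [C4 C40 H4] := fock_point alpha_gt0.
    have omb h : fock2 alpha h -> forall z, om z * cabs (h z) <= Num.sqrt (C4 * nrm alpha h).
      move=> Hh z; rewrite -[leLHS]ger0_norm ?mulr_ge0 ?cabs_ge0 ?(ltW (om_gt0 z))//.
      rewrite -sqrtr_sqr ler_sqrt ?mulr_ge0 ?nrm_ge0 ?(ltW C40)//.
      by rewrite exprMn om2 mulrC mulrA; exact: H4.
    have [gd _] := Hg.
    apply: (unique (A := Num.sqrt (C4 * nrm alpha f) + Num.sqrt (C4 * nrm alpha g))) => //.
      by move=> j l lc; rewrite (gf j).
    move=> z; apply: (@le_trans _ _ (om z * (cabs (f z) + cabs (g z)))).
      by rewrite ler_wpM2l ?(ltW (om_gt0 z))// cabsB.
    by rewrite mulrDr lerD// omb.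
  have sE : seq_norm alpha exp_two cellset f = (Num.sqrt e)%:E.
    by rewrite /seq_norm -[(\esum_(l in _) _)%E]/(E f) Er.
  have fnE : fock_norm alpha exp_two f = (Num.sqrt n)%:E by rewrite fock_normE fE.
  rewrite sE fnE -!EFinM !lee_fin; split.
    rewrite ler_pdivrMl ?sqrtr_gt0// -sqrtrM ?(ltW A0)// ler_sqrt ?mulr_ge0 ?(ltW A0)//.
    apply: (le_trans nU); rewrite mulrA ler_wpM2r// lerDr mulr_ge0// ltW//.
  rewrite -sqrtrM ?(ltW A0)// ler_sqrt ?mulr_ge0 ?(ltW A0)//.
  by apply: (le_trans eU); rewrite ler_wpM2r// lerDl mulr_ge0// ltW.
move=> v hv; have Er : E v = (fine (E v))%:E.
  move: hv; rewrite /seq_norm -[(\esum_(l in _) _)%E]/(E v).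
  by have := E0 v; case: (E v).
set e := fine (E v) in Er; have e0 : 0 <= e by rewrite fine_ge0// E0.
have [||f [Hf fv _]] := H1 v (C3 * e); first by rewrite mulr_ge0// ltW.
  by move=> N; apply: down; rewrite -lee_fin -Er; apply: esum_ge_cells; exact: tau0.
by exists f; [exact/fock2P|move=> l [j lc]; rewrite (fv j)].
Qed.

End SquareIntegrable.

End CompleteInterpolating.

(* While [0 < I k] the potential [I k + beta * max (D k + P + 1, 0)] does not
   increase. *)
Lemma control_bound (R : realType) (I D : nat -> R) (T P u X : R) :
  0 < T -> 0 < u ->
  (forall k, I k.+1 <= I k + T * (D k + P)) ->
  (forall k, 0 < I k -> D k.+1 <= Num.max (- (P + 1)) (D k - u)) ->
  (forall k, D k <= X) ->
  exists B, forall k, I k <= B.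
Proof.
move=> T0 u0 HI HD HX.
pose Z : R := Num.max (X + P + 1) 1; have Z1 : 1 <= Z by rewrite le_max lexx orbT.
pose x k : R := Num.max (D k + P + 1) 0.
have x0 k : 0 <= x k by rewrite le_max lexx orbT.
have xD k : D k + P + 1 <= x k by rewrite le_max lexx.
have xZ k : x k <= Z.
  by rewrite ge_max; apply/andP; split; [rewrite le_max !lerD2r HX|rewrite (le_trans _ Z1)].
(* [beta * u] exceeds [T * Z], the largest possible increase of [I] in one step, so a decrease of
   [x] by [u] compensates it; when [x] drops to 0, [beta >= T] is enough. *)
pose beta := T + T * Z / u.
have beta0 : 0 <= beta by rewrite addr_ge0 ?divr_ge0 ?mulr_ge0 ?(ltW T0) ?(ltW u0)// (le_trans _ Z1).
pose V k := I k + beta * x k.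
have VI k : I k <= V k by rewrite lerDl mulr_ge0.
exists (Num.max (V 0%N) (T * Z + beta * Z)) => k; apply: (le_trans (VI k)).
elim: k => [|k IH]; first by rewrite le_max lexx.
have HIk : I k.+1 <= I k + T * (x k - 1).
  apply: (le_trans (HI k)); rewrite lerD2l ler_pM2l//.
  by have := xD k; lra.
have [I0|I0] := ltP 0 (I k); last first.
  rewrite le_max; apply/orP; right; apply: lerD; last by rewrite ler_wpM2l.
  apply: (le_trans HIk); rewrite -[leRHS]add0r; apply: lerD => //.
  by rewrite ler_pM2l//; have := xZ k; lra.
apply: (le_trans _ IH); rewrite /V.
have hx : x k.+1 <= Num.max (x k - u) 0.
  have h := HD k I0; rewrite ge_max le_max [X in _ && X]le_max lexx orbT andbT.
  move: h; rewrite le_max => /orP[h|h]; apply/orP; [right|left]; first by lra.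
  by have := xD k; lra.
have [ux|xu] := leP u (x k).
  have hx' : x k.+1 <= x k - u by apply: (le_trans hx); rewrite ge_max lexx subr_ge0.
  have : beta * x k.+1 <= beta * (x k - u) by rewrite ler_wpM2l.
  have bu : beta * u = T * u + T * Z by rewrite /beta mulrDl divfK// gt_eqF.
  have : T * (x k - 1) <= T * Z by rewrite ler_pM2l//; have := xZ k; lra.
  have : 0 < T * u by rewrite mulr_gt0.
  move: HIk bu; clear; nra.
have hx' : x k.+1 <= 0 by apply: (le_trans hx); rewrite ge_max lexx andbT subr_le0 ltW.
have : beta * x k.+1 <= 0 by rewrite mulr_ge0_le0.
have : T * (x k - 1) <= beta * x k.
  apply: (@le_trans _ _ (T * x k)); first by rewrite ler_pM2l// lerBlDr lerDl.
  apply: ler_wpM2r => //; rewrite lerDl divr_ge0 ?mulr_ge0 ?(ltW T0) ?(ltW u0)//.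
  exact: le_trans Z1.
move: HIk; clear; lra.
Qed.

(** * The feedback rule that selects the points shell by shell *)

Section Control.
Variables (R : realType) (alpha kap T : R) (M : nat) (FF AA : nat -> seq R[i]).
Hypothesis alpha_gt0 : 0 < alpha.
Hypothesis T_gt0 : 0 < T.
Hypothesis AA_shell : forall j g, g \in AA j -> in_shell (expR T) j g.
Hypothesis AA_size : forall j, (size (AA j) <= M)%N.
Hypothesis FF_shell : forall j g, g \in FF j -> in_shell (expR T) j g.
Hypothesis FF_size : forall j, (size (FF j) <= M)%N.
Variables (eps : R) (k0 : nat).
Hypothesis eps_gt0 : 0 < eps.
Hypothesis FF_sparse : forall k, (k0 <= k)%N -> (size (FF k))%:R <= (2 * alpha - eps) * T.
Hypothesis AA_dense : forall k, (k0 <= k)%N -> (2 * alpha + eps) * T <= (size (AA k))%:R.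

Let s : R := kap - 1 / 2.
Let P : R := M%:R + alpha * T.
Let Q : R := M%:R + 2 * alpha * T.
(** [P] bounds the noise in the deviation divided by [T], and [Q] one step of the excess. The term
    [P + Q + 1] ensures that an excess beyond the threshold still outweighs the noise after one
    adverse step; [k0] times [Q], with the initial value [s], covers the shells where nothing is
    known about the density. *)
Let K : R := P + Q + 1 + `|s| + k0%:R * Q.

Let P_ge0 : 0 <= P. Proof. by rewrite addr_ge0// mulr_ge0 ?ltW. Qed.
Let Q_ge0 : 0 <= Q. Proof. by rewrite addr_ge0// !mulr_ge0 ?ltW. Qed.

(* The state records the excess number of points in the first [k] shells and
   the deviation, at radius [q ^+ k], of the logarithm of the partial product. *)
Definition use_sparse (st : R * R) :=
  ((0 < st.2) && (- K < st.1)) || (K < st.1).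

Definition choose k st := if use_sparse st then FF k else AA k.

(** The excess is the slope in [ln rho] of the deviation at the inner radius of the shell. It starts
    at [s] because the target contributes [- s * ln rho] to the exponent while the empty product
    contributes nothing. *)
Fixpoint state k : R * R := if k is k'.+1 then
    let: st := state k' in let: l := choose k' st in
    (st.1 + (size l)%:R - 2 * alpha * T,
     st.2 + T * st.1 + \sum_(g <- l) (k'.+1%:R * T - ln (mx g)) - alpha * T ^+ 2)
  else (s, 0).

Definition cells k := choose k (state k).

Lemma cells_or k : cells k = FF k \/ cells k = AA k.
Proof. by rewrite /cells /choose; case: ifP; [left|right]. Qed.

Local Notation D k := (state k).1.
Local Notation I k := (state k).2.

Let DS k : D k.+1 = D k + (size (cells k))%:R - 2 * alpha * T. Proof. by []. Qed.
Let IS k : I k.+1 = I k + T * D k +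
  \sum_(g <- cells k) (k.+1%:R * T - ln (mx g)) - alpha * T ^+ 2. Proof. by []. Qed.

Let cells_size k : (size (cells k))%:R <= M%:R :> R.
Proof. by rewrite ler_nat; case: (cells_or k) => ->. Qed.

Let D_step k : `|D k.+1 - D k| <= Q.
Proof.
rewrite DS ler_norml /Q; have := cells_size k.
have : 0 <= (size (cells k))%:R :> R by [].
have : 0 <= 2 * alpha * T by rewrite !mulr_ge0 ?ltW.
move: (size _)%:R (M%:R : R) (D k) (2 * alpha * T) => a b d e.
by move=> *; apply/andP; split; lra.
Qed.

Let D_early k : (k <= k0)%N -> `|D k| <= K.
Proof.
move=> kk0; apply: (@le_trans _ _ (`|s| + k%:R * Q)); last first.
  rewrite /K; have : k%:R * Q <= k0%:R * Q by rewrite ler_wpM2r// ler_nat.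
  have := P_ge0; have := Q_ge0; move: (k%:R * Q) (k0%:R * Q) `|s| P Q => a b d e f; lra.
elim: k {kk0} => [|k IH]; first by rewrite mul0r addr0.
rewrite -(subrK (D k) (D k.+1)); apply: (le_trans (ler_normD _ _)).
by rewrite -natr1 mulrDl mul1r addrA [leRHS]addrC lerD// D_step.
Qed.

Let D_down k : (k0 <= k)%N -> use_sparse (state k) -> D k.+1 <= D k - eps * T.
Proof.
move=> kk h; rewrite DS /cells /choose h; have := FF_sparse kk.
move: (_%:R : R) (D k) => a d; lra.
Qed.

Let D_up k : (k0 <= k)%N -> ~~ use_sparse (state k) -> D k + eps * T <= D k.+1.
Proof.
move=> kk /negbTE h; rewrite DS /cells /choose h; have := AA_dense kk.
move: (_%:R : R) (D k) => a d; lra.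
Qed.

Let eT : 0 < eps * T. Proof. exact: mulr_gt0. Qed.

(** Above [K] the sparse family is used and the excess decreases, below [- K] the dense one and it
    increases; so the thresholds are overshot by one step at most. *)
Lemma excess_bound k : `|D k| <= K + Q.
Proof.
have [kk0|/ltnW] := leqP k k0; first by rewrite (le_trans (D_early kk0))// lerDl.
elim: k => [|k IH]; first by rewrite leqn0 => /eqP h; rewrite (le_trans (D_early _)) ?lerDl ?h.
rewrite leq_eqVlt => /orP[/eqP h|]; first by rewrite (le_trans (D_early _)) ?lerDl ?h.
rewrite ltnS => kk; have {IH} := IH kk; have := D_step k; have := eT.
have := D_up kk; have := D_down kk; rewrite /use_sparse.
have : 0 <= K.
  exact: le_trans (normr_ge0 _) (D_early (leq0n _)).
move: (D k.+1) (D k) (I k) K Q (eps * T) => d' d i k1 q e.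
rewrite !ler_norml => k10 h1 h2 e0 /andP[a1 a2] /andP[a3 a4].
move: h1 h2; have [h|h] /= := ltP k1 d.
  by rewrite orbT => /(_ isT) h1 _; apply/andP; split; lra.
rewrite orbF; case: (ltP (- k1) d) => /= h'.
  by move=> _ _; apply/andP; split; lra.
by rewrite andbF => _ /(_ isT) h2; apply/andP; split; lra.
Qed.

Let I_step k : `|I k.+1 - I k - T * D k| <= T * P.
Proof.
have -> : I k.+1 - I k - T * D k =
  \sum_(g <- cells k) (k.+1%:R * T - ln (mx g)) - alpha * T ^+ 2 by rewrite IS; ring.
have bnd g : g \in cells k -> 0 <= k.+1%:R * T - ln (mx g) <= T.
  move=> gc; have : in_shell (expR T) k g.
    by move: gc; case: (cells_or k) => -> => [/FF_shell|/AA_shell].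
  move=> /andP[]; rewrite -!expRM_natl => h1 h2.
  have {}h1 : k%:R * T <= ln (mx g) by rewrite -ler_expR lnK// posrE mx_gt0.
  have {}h2 : ln (mx g) < k.+1%:R * T by rewrite -ltr_expR lnK// posrE mx_gt0.
  by move: h2; rewrite -natr1 mulrDl mul1r => h2; apply/andP; split; lra.
have l0 : 0 <= \sum_(g <- cells k) (k.+1%:R * T - ln (mx g)).
  by rewrite big_seq; apply: sumr_ge0 => g /bnd/andP[].
have l1 : \sum_(g <- cells k) (k.+1%:R * T - ln (mx g)) <= M%:R * T.
  apply: (@le_trans _ _ (\sum_(g <- cells k) T)).
    by rewrite big_seq [leRHS]big_seq; apply: ler_sum => g /bnd/andP[].
  by rewrite big_const_seq count_predT iter_addr_0 -[leLHS]mulr_natl ler_wpM2r// ltW.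
rewrite ler_norml /P; have : 0 <= alpha * T ^+ 2 by rewrite mulr_ge0 ?sqr_ge0 ?ltW.
have : 0 <= M%:R * T by rewrite mulr_ge0// ltW.
have -> : T * (M%:R + alpha * T) = M%:R * T + alpha * T ^+ 2 by ring.
move: l0 l1; move: (\sum_(g <- _) _) (M%:R * T) (alpha * T ^+ 2) => a b d.
by move=> *; apply/andP; split; lra.
Qed.

(** [control_bound] is applied to the deviation and to its opposite. While the deviation is
    positive, either the sparse family lowers the excess by [eps * T], or the excess is already at
    most [- K] and stays below [- (P + 1)] after the next step. *)
Lemma deviation_bound : exists B, forall k, `|I k| <= B.
Proof.
have KP : Q - K <= - (P + 1).
  rewrite /K; have : 0 <= k0%:R * Q by rewrite mulr_ge0.
  have : 0 <= `|s| by []; move: (k0%:R * Q) `|s| P Q => a b d e; lra.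
have step k : `|D k.+1 - D k| <= Q := D_step k.
have [B1 H1] : exists B, forall k, I (k0 + k) <= B.
  apply: (@control_bound R (fun k => I (k0 + k)) (fun k => D (k0 + k)) T P (eps * T) (K + Q)) => //.
  - move=> k; rewrite addnS [T * (_ + _)]mulrDr.
    have := I_step (k0 + k); rewrite ler_norml => /andP[_].
    by move: (I _) (I _) (T * D _) (T * P) => *; lra.
  - move=> k I0; rewrite addnS le_max.
    have [u|u] := boolP (use_sparse (state (k0 + k))).
      by apply/orP; right; exact: (D_down (leq_addr _ _) u).
    apply/orP; left; move: u; rewrite /use_sparse I0 /= negb_or -leNgt => /andP[h _].
    have := step (k0 + k)%N; rewrite ler_norml => /andP[_].
    move=> h'; apply: (le_trans _ KP); rewrite addrC -[leLHS](subrK (D (k0 + k))) addrC.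
    exact: lerD.
  - by move=> k; have := excess_bound (k0 + k); rewrite ler_norml => /andP[].
have [B2 H2] : exists B, forall k, - I (k0 + k) <= B.
  apply: (@control_bound R (fun k => - I (k0 + k)) (fun k => - D (k0 + k)) T P (eps * T) (K + Q)) => //.
  - move=> k; rewrite addnS [T * (_ + _)]mulrDr mulrN.
    have := I_step (k0 + k); rewrite ler_norml => /andP[+ _].
    by move: (I _) (I _) (T * D _) (T * P) => *; lra.
  - move=> k I0; rewrite addnS le_max.
    have [u|u] := boolP (use_sparse (state (k0 + k))); last first.
      by apply/orP; right; have := D_up (leq_addr _ _) u; rewrite -opprD lerN2.
    apply/orP; left; move: u I0; rewrite /use_sparse oppr_gt0 => /orP[/andP[h _] /(lt_trans h)|h _].
      by rewrite ltxx.
    have := step (k0 + k)%N; rewrite ler_norml => /andP[+ _].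
    move=> h'; apply: (le_trans _ KP); rewrite -[Q]opprK -opprD lerN2.
    by rewrite -[leRHS](subrK (D (k0 + k))) lerD// ltW.
  - by move=> k; have := excess_bound (k0 + k); rewrite ler_norml => /andP[]; lra.
exists (\sum_(j < k0) `|I j| + `|B1| + `|B2|) => k.
have [kk|kk] := ltnP k k0.
  rewrite (bigD1 (Ordinal kk))//= -!addrA lerDl !addr_ge0//.
  by apply: sumr_ge0.
apply: (@le_trans _ _ (`|B1| + `|B2|)); last by rewrite -addrA lerDr; apply: sumr_ge0.
have := H1 (k - k0)%N; have := H2 (k - k0)%N; rewrite subnKC// ler_norml.
have := ler_norm B1; have := ler_norm B2; have := normr_ge0 B1; have := normr_ge0 B2.
by move: (I k) `|B1| `|B2| => *; apply/andP; split; lra.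
Qed.

(** An exact identity: the exponent is the target plus the deviation expanded to second order at the
    inner radius of shell [k]. Within the shell the expansion differs from the deviation by a
    bounded amount, once the excess is bounded. *)
Let cellprod_state k (x : R) : cellprod cells k (expR x) =
  expR (alpha * x ^+ 2 - s * x + (I k + D k * (x - k%:R * T) - alpha * (x - k%:R * T) ^+ 2)).
Proof.
elim: k => [|k IH].
  by rewrite /cellprod big_ord0 -[LHS]expR0; congr expR; rewrite /= mul0r subr0; ring.
have cell : \prod_(g <- cells k) (expR x / mx g) =
    expR (\sum_(g <- cells k) (x - ln (mx g))).
  elim: (cells k) => [|g l IHl]; first by rewrite !big_nil expR0.
  by rewrite !big_cons IHl expRD expRB lnK// posrE mx_gt0.
rewrite /cellprod big_ord_recr /= -/(cellprod cells k (expR x)) IH cell -expRD.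
congr expR; rewrite -/(cells k).
have E (y : R) : \sum_(g <- cells k) (y - ln (mx g)) =
    (size (cells k))%:R * y - \sum_(g <- cells k) ln (mx g).
  by rewrite sumrB big_const_seq count_predT iter_addr_0 mulr_natl.
rewrite !E -natr1; ring.
Qed.

Lemma cellprod_cells : exists2 C : R, 0 < C & forall k rho,
  expR T ^+ k <= rho <= expR T ^+ k.+1 ->
  C^-1 * wfun alpha kap rho <= cellprod cells k rho <= C * wfun alpha kap rho.
Proof.
have [B HB] := deviation_bound.
pose A := B + (K + Q) * T + alpha * T ^+ 2.
exists (expR A); first exact: expR_gt0.
move=> k rho; rewrite -!expRM_natl => /andP[h1 h2].
have r0 : 0 < rho by apply: lt_le_trans h1; exact: expR_gt0.
have [x rx] : exists x, rho = expR x by exists (ln rho); rewrite lnK.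
move: h1 h2; rewrite rx !ler_expR /wfun expRK => h1 h2.
rewrite cellprod_state -expRN -!expRD !ler_expR -/s.
set y := x - k%:R * T; have y0 : 0 <= y by rewrite subr_ge0.
have yT : y <= T by rewrite lerBlDl -[_ + T]/(_ + T) -{2}(mul1r T) -mulrDl natr1.
have : `|I k + D k * y - alpha * y ^+ 2| <= A.
  apply: (le_trans (ler_normB _ _)); apply: lerD.
    apply: (le_trans (ler_normD _ _)); apply: lerD; first exact: HB.
    by rewrite normrM; apply: ler_pM => //; [exact: excess_bound|rewrite ger0_norm].
  rewrite ger0_norm ?mulr_ge0 ?sqr_ge0 ?(ltW alpha_gt0)//.
  by rewrite ler_pM2l// lerXn2r// nnegrE ltW.
rewrite ler_norml => /andP[]; move: (I k + _ - _) => z.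
by move=> *; apply/andP; split; lra.
Qed.

End Control.

(** * Separation in relative distance and packing of shells *)

Section Separation.
Variable R : realType.
Implicit Types (z w : R[i]) (A : set R[i]).

Definition separated (delta : R) A := forall z w, A z -> A w -> z != w ->
  delta * mx z <= cabs (z - w).

Lemma mx_lip z w : mx z <= mx w + cabs (z - w).
Proof.
rewrite /mx ge_max; apply/andP; split.
  by rewrite (le_trans (mx_ge1 w))// lerDl cabs_ge0.
rewrite addrC -{1}(subrK w z) (le_trans (cabsD _ _))// lerD2l.
exact: cabs_le_mx.
Qed.

(** Up to constants [d_rho] is the distance divided by 1 plus the smaller modulus. As [mx z] is at
    most [1 + m] plus the distance, either the moduli are comparable or the distance dominates; the
    constant [h / (1 + h)] covers both and is at most 1. *)
Lemma d_rho_separated_mx (alpha : R) A : 0 < alpha -> d_rho_separated alpha A ->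
  exists2 delta : R, 0 < delta <= 1 & separated delta A.
Proof.
move=> a0; rewrite /d_rho_separated; set S := [set x | _]; move=> S0.
have [e e0 He] : exists2 e : R, 0 < e & (e%:E <= ereal_inf S)%E.
  move: S0; case: (ereal_inf S) => [r|_|//].
    by rewrite lte_fin => r0; exists r.
  (* With at most one point the infimum is infinite and any positive [e] serves. *)
  by exists 1; rewrite ?leey.
pose b := Num.sqrt (2 * alpha); have b0 : 0 < b by rewrite sqrtr_gt0 mulr_gt0.
pose b1 := Num.min b 1; have b10 : 0 < b1 by rewrite lt_min b0 ltr01.
pose h := e / b * b1; have h0 : 0 < h by rewrite mulr_gt0 ?divr_gt0.
exists (h / (1 + h)).
  by rewrite divr_gt0 ?addr_gt0//= ler_pdivrMr ?addr_gt0// mul1r lerDr.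
move=> z w Az Aw zw; set m := Num.min (cabs z) (cabs w).
have m0 : 0 <= m by rewrite le_min !cabs_ge0.
have : e <= d_rho alpha z w.
  by rewrite -lee_fin (le_trans He)//; apply: ereal_inf_lbound; exists z, w.
rewrite /d_rho -/b -/m mulrA ler_pdivlMr ?ltr_pwDl// => h1.
have h2 : h * (1 + m) <= cabs (z - w).
  have h3 : b1 * (1 + m) <= b + m.
    have : b1 <= b by rewrite ge_min lexx.
    have : b1 <= 1 by rewrite ge_min lexx orbT.
    by move: m0; clear; nra.
  rewrite -(ler_pM2l b0); apply: (le_trans _ h1).
  rewrite (_ : b * (h * (1 + m)) = e * (b1 * (1 + m))); first by rewrite ler_pM2l.
  by rewrite /h; field; rewrite gt_eqF.
have h3 : mx z <= 1 + m + cabs (z - w).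
  rewrite ge_max -addrA lerDl addr_ge0 ?cabs_ge0//=.
  rewrite (@le_trans _ _ (m + cabs (z - w)))//; last by rewrite lerDr.
  rewrite /m; case: (leP (cabs z) (cabs w)) => _; first by rewrite lerDl cabs_ge0.
  by rewrite addrC -{1}(subrK w z) cabsD.
rewrite mulrAC ler_pdivrMr ?addr_gt0//.
by move: h0 h2 h3; clear; nra.
Qed.

(** A grid of mesh [delta * q ^+ k / 2] covers the shell with [n] cells in each direction and holds
    at most one point per cell. As mesh and shell scale together, [n] is independent of [k]. *)
Lemma shell_packing (delta q : R) : 0 < delta -> 1 < q ->
  exists M, forall A k (s : seq R[i]), separated delta A -> uniq s ->
    (forall z, z \in s -> A z /\ in_shell q k z) -> (size s <= M)%N.
Proof.
move=> d0 q1; pose n := (Num.truncn (4 * q / delta)).+1; exists (n * n)%N.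
move=> A k s sepA us sP; have q0 : 0 < q := lt_trans ltr01 q1.
pose L := q ^+ k.+1; pose h := delta * q ^+ k / 2.
have qk0 : 0 < q ^+ k by rewrite exprn_gt0.
have h0 : 0 < h by rewrite divr_gt0 ?mulr_gt0.
pose t (x : R) := Num.truncn ((x + L) / h).
pose F z := (t (Re z), t (Im z)).
have bnd z : z \in s -> `|Re z| <= L /\ `|Im z| <= L.
  move=> /sP[_ /andP[_ /ltW zL]].
  by split; [apply: le_trans (Re_le_cabs z) _|apply: le_trans (Im_le_cabs z) _];
    exact: le_trans (cabs_le_mx z) zL.
have pos x : `|x| <= L -> 0 <= (x + L) / h.
  by rewrite ler_norml => /andP[x1 x2]; rewrite divr_ge0 ?(ltW h0)// -lerBlDr sub0r.
have tn x : `|x| <= L -> (t x < n)%N.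
  move=> xL; rewrite ltnS; apply: le_truncn.
  have -> : 4 * q / delta = (2 * L) / h.
    by rewrite /h /L exprS; field; rewrite !gt_eqF.
  rewrite ler_pM2r ?invr_gt0//; move: xL; rewrite ler_norml => /andP[_ h2].
  by rewrite -[2]/(1 + 1) mulrDl mul1r lerD2r.
have tt x y : `|x| <= L -> `|y| <= L -> t x = t y -> `|x - y| < h.
  move=> /pos x0 /pos y0 e; have := truncn_itv x0; have := truncn_itv y0.
  rewrite -/(t x) -/(t y) e !ler_pdivlMr// !ltr_pdivrMr// -natr1 mulrDl mul1r.
  move=> /andP[a1 a2] /andP[b1 b2].
  rewrite ltr_norml; apply/andP; split; move: a1 a2 b1 b2; clear; lra.
have inj : {in s &, injective F}.
  move=> z w zs ws [e1 e2]; apply/eqP/negPn/negP => zw.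
  have [[z1 z2] [w1 w2]] := (bnd _ zs, bnd _ ws).
  have [Az /andP[zk _]] := sP _ zs; have [Aw _] := sP _ ws.
  have := sepA z w Az Aw zw; rewrite leNgt => /negP; apply.
  apply: (le_lt_trans (cabs_le_ReIm _)); rewrite cReB cImB.
  have := ltrD (tt _ _ z1 w1 e1) (tt _ _ z2 w2 e2) => /lt_le_trans; apply.
  have -> : h + h = delta * q ^+ k by rewrite /h; field.
  by rewrite ler_pM2l.
rewrite -(size_map F s).
have -> : (n * n = size (allpairs pair (iota 0 n) (iota 0 n)))%N.
  by rewrite size_allpairs !size_iota.
apply: uniq_leq_size; first by rewrite map_inj_in_uniq.
move=> _ /mapP[z zs ->]; have [z1 z2] := bnd _ zs.
by apply: allpairs_f; rewrite mem_iota /= tn.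
Qed.

Definition shell_part A q k : set R[i] := A `&` [set z | in_shell q k z].

Definition shell_seq A q k : seq R[i] := finmap.enum_fset (fset_set (shell_part A q k)).

Lemma shell_part_finite A (delta q : R) k : 0 < delta -> 1 < q -> separated delta A ->
  finite_set (shell_part A q k).
Proof.
move=> d0 q1 sepA; have [M HM] := shell_packing d0 q1.
apply: contrapT => /(infinite_set_fset M.+1)[B BA].
rewrite leqNgt ltnS => /negP; apply.
by apply: (HM A k _ sepA (finmap.fset_uniq B)) => z /BA[].
Qed.

Lemma mem_shell_seq A q k z : finite_set (shell_part A q k) ->
  z \in shell_seq A q k <-> A z /\ in_shell q k z.
Proof. by move=> fA; rewrite /shell_seq in_fset_set// inE. Qed.

Lemma shell_seq_uniq A q k : uniq (shell_seq A q k).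
Proof. exact: finmap.fset_uniq. Qed.

Lemma shell_part_annulus A (q : R) k : 1 < q -> (0 < k)%N ->
  shell_part A q k = A `&` annulus (q ^+ k) (q * q ^+ k).
Proof.
move=> q1 k0; have qk : 1 < q ^+ k by rewrite exprn_egt1// -lt0n.
have qk' : 1 < q ^+ k.+1 by rewrite exprn_egt1.
have E z : in_shell q k z = (q ^+ k <= cabs z < q * q ^+ k).
  by rewrite /in_shell /mx le_max gt_max qk' -exprS [q ^+ k <= 1]leNgt qk.
by apply/seteqP; split => z [Az h]; split => //; move: h; rewrite /annulus /= E.
Qed.

Lemma annulus_ratio_shell A (delta q : R) k : 0 < delta -> 1 < q -> separated delta A ->
  (0 < k)%N ->
  annulus_ratio A q (q ^+ k) = ((size (shell_seq A q k))%:R / ln q)%:E.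
Proof.
move=> d0 q1 sepA k0; have fA := shell_part_finite k d0 q1 sepA.
by rewrite /annulus_ratio -shell_part_annulus// /counting asboolT// EFinM.
Qed.

End Separation.

(** * From densities to counts in geometric shells *)

Section Densities.
Variable R : realType.

Lemma limf_esup_pinfty_lt (f : R -> \bar R) (a : R) :
  (limf_esup f (pinfty_nbhs R) < a%:E)%E ->
  exists2 b, b < a & exists S, forall x, S < x -> (f x < b%:E)%E.
Proof.
move=> h; have [b ba hb] : exists2 b, b < a & (limf_esup f (pinfty_nbhs R) < b%:E)%E.
  move: h; case: (limf_esup _ _) => [r| |].
  - by rewrite lte_fin => ra; exists ((r + a) / 2); rewrite ?lte_fin; lra.
  - by rewrite ltNge leey.
  - by move=> _; exists (a - 1); rewrite ?ltNyr// ltrBlDr ltrDl.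
exists b => //; have /ereal_inf_lt[_ [V [S [_ HS]] <-] Vb] := hb.
exists S => x Sx; apply: le_lt_trans Vb.
by apply: ereal_sup_ubound; exists x => //; exact: HS.
Qed.

Lemma limf_einf_pinfty_gt (f : R -> \bar R) (a : R) :
  (a%:E < limf_einf f (pinfty_nbhs R))%E ->
  exists2 b, a < b & exists S, forall x, S < x -> (b%:E < f x)%E.
Proof.
rewrite /limf_einf lteNr -EFinN => /limf_esup_pinfty_lt[b ba [S HS]].
by exists (- b); [rewrite ltrNr|exists S => x /HS; rewrite lteNl EFinN].
Qed.

Variables (A : set R[i]) (delta a : R).
Hypothesis delta_gt0 : 0 < delta.
Hypothesis sepA : separated delta A.

Let radius (S : R) : exists2 q, 4 <= q & S < q.
Proof.
exists (Num.max 4 (S + 1)); first by rewrite le_max lexx.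
by rewrite lt_max [X in _ || X]ltrDl ltr01 orbT.
Qed.

Let power (q r : R) : 4 <= q -> exists k0, forall k, (k0 <= k)%N -> (0 < k)%N /\ r < q ^+ k.
Proof.
move=> q4; have q1 : 1 < q by apply: lt_le_trans q4; rewrite ltr1n.
have [n Hn] := expn_gt_real r q1; exists n.+1 => k nk; split; first exact: leq_trans nk.
by apply: (lt_le_trans Hn); rewrite ler_eXn2l// ltnW.
Qed.

(** The outer limit allows the ratio [q] to be taken large; for that fixed [q] the inner limit is
    read along the radii [q ^+ k], whose annuli are exactly the shells. The bound [b] strictly below
    [a] leaves the margin that the feedback consumes. *)
Lemma upper_density_shell : (upper_density A < a%:E)%E ->
  exists2 q, 4 <= q & exists2 b, b < a & exists k0, forall k, (k0 <= k)%N ->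
    (size (shell_seq A q k))%:R <= b * ln q.
Proof.
move=> /limf_esup_pinfty_lt[b ba [S HS]]; have [q q4 Sq] := radius S.
have q1 : 1 < q by apply: lt_le_trans q4; rewrite ltr1n.
exists q => //; exists b => //.
have [b' b'b [r Hr]] := limf_esup_pinfty_lt (HS q Sq).
have [k0 Hk0] := power r q4; exists k0 => k /Hk0[k1 rk].
have := Hr _ rk; rewrite (annulus_ratio_shell delta_gt0)// lte_fin => /ltW h.
by rewrite -ler_pdivrMr ?ln_gt0// (le_trans h)// ltW.
Qed.

Lemma lower_density_shell : (a%:E < lower_density A)%E ->
  exists2 q, 4 <= q & exists2 b, a < b & exists k0, forall k, (k0 <= k)%N ->
    b * ln q <= (size (shell_seq A q k))%:R.
Proof.
move=> /limf_einf_pinfty_gt[b ba [S HS]]; have [q q4 Sq] := radius S.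
have q1 : 1 < q by apply: lt_le_trans q4; rewrite ltr1n.
exists q => //; exists b => //.
have [b' b'b [r Hr]] := limf_einf_pinfty_gt (HS q Sq).
have [k0 Hk0] := power r q4; exists k0 => k /Hk0[k1 rk].
have := Hr _ rk; rewrite (annulus_ratio_shell delta_gt0)// lte_fin => /ltW h.
by rewrite -ler_pdivlMr ?ln_gt0// (le_trans _ h)// ltW.
Qed.

End Densities.

(** Shell condition, cardinality and separation pass from [AA] to every selection because [FF] is
    contained in it; the exponent [p] only decides the value of [kap]. *)
Lemma complete_selection (R : realType) (alpha q delta eps : R) (p : exponent)
    (M k0 : nat) (FF AA : nat -> seq R[i]) :
  0 < alpha -> 4 <= q -> 0 < delta -> delta <= 1 -> 0 < eps ->
  (forall k, {subset FF k <= AA k}) -> (forall k, uniq (FF k)) ->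
  (forall k, uniq (AA k)) -> (forall k, (size (AA k) <= M)%N) ->
  (forall k g, g \in AA k -> in_shell q k g) ->
  (forall i j g h, g \in AA i -> h \in AA j -> g != h -> delta * mx g <= cabs (g - h)) ->
  (forall k, (k0 <= k)%N -> (size (FF k))%:R <= (2 * alpha - eps) * ln q) ->
  (forall k, (k0 <= k)%N -> (2 * alpha + eps) * ln q <= (size (AA k))%:R) ->
  exists2 c : nat -> seq R[i], (forall k, c k = FF k \/ c k = AA k) &
    complete_interpolating alpha p (cellset c).
Proof.
move=> a0 q4 d0 d1 e0 FA uF uA AM As sepA Fsp Ads.
have q0 : 0 < q by apply: lt_le_trans q4.
have q1 : 1 < q by apply: lt_le_trans q4; rewrite ltr1n.
have qT : expR (ln q) = q by rewrite lnK.
have AsT k g : g \in AA k -> in_shell (expR (ln q)) k g by rewrite qT; exact: As.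
have FsT k g : g \in FF k -> in_shell (expR (ln q)) k g by move=> /FA; exact: AsT.
have FM k : (size (FF k) <= M)%N by apply: leq_trans (AM k); exact: uniq_leq_size (uF k) (FA k).
have T0 : 0 < ln q by exact: ln_gt0.
have [kap [kap0 kap2 kapi]] : exists kap : R,
    [/\ 0 <= kap, p = exp_two -> kap = 1 & p = exp_infty -> kap = 0].
  by case: p; [exists 1|exists 0].
pose c := cells alpha kap (ln q) M FF AA k0.
have [C C0 HC] := cellprod_cells kap a0 T0 AsT AM FsT FM e0 Fsp Ads.
rewrite qT -/c in HC.
have cor k : c k = FF k \/ c k = AA k by exact: cells_or.
have cA k : {subset c k <= AA k} by move=> g; case: (cor k) => -> // /FA.
have c_shell k g : g \in c k -> in_shell q k g by move=> /cA; exact: As.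
have c_size k : (size (c k) <= M)%N by case: (cor k) => ->.
have c_uniq k : uniq (c k) by case: (cor k) => ->.
have c_sep i j g h : g \in c i -> h \in c j -> g != h -> delta * mx g <= cabs (g - h).
  by move=> /cA gi /cA hj; exact: (sepA i j).
exists c => //; case: p kap2 kapi => [kap2 _|_ kap0'].
  exact: (complete_interpolating_two a0 kap0 q4 d0 d1 c_shell c_size c_uniq c_sep C0 HC (kap2 erefl)).
exact: (complete_interpolating_infty a0 kap0 q4 d0 d1 c_shell c_size c_uniq c_sep C0 HC (kap0' erefl)).
Qed.

(** * Enlarging a separated set by points of a geometric progression *)

Section Supplement.
Variables (R : realType) (A : set R[i]) (q delta : R) (M J : nat).
Hypothesis q_ge4 : 4 <= q.
Hypothesis delta_gt0 : 0 < delta.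
Hypothesis delta_le1 : delta <= 1.
Hypothesis sepA : separated delta A.
Hypothesis shellM : forall k, (size (shell_seq A q k) <= M)%N.
Hypothesis J_gt0 : (0 < J)%N.
Implicit Types (z w : R[i]).

Let q_gt1 : 1 < q. Proof. by apply: lt_le_trans q_ge4; rewrite ltr1n. Qed.
Let q_gt0 : 0 < q. Proof. exact: lt_trans q_gt1. Qed.

Let eta : R := ln q / J%:R.

Let eta_gt0 : 0 < eta. Proof. by rewrite divr_gt0 ?ln_gt0// ltr0n. Qed.

(** A geometric progression on the positive real axis, with ratio chosen so that each shell receives
    exactly [J] terms. *)
Definition ray (i : nat) : R[i] := (expR (i%:R * eta))%:C.

Let mx_ray i : mx (ray i) = expR (i%:R * eta).
Proof.
rewrite /mx /ray cabsR ger0_norm ?expR_ge0// max_r//.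
by rewrite -expR0 ler_expR mulr_ge0// ltW.
Qed.

Let gap : R := 1 - expR (- eta).

Let gap_gt0 : 0 < gap. Proof. by rewrite subr_gt0 -expR0 ltr_expR oppr_lt0. Qed.
Let gap_lt1 : gap < 1. Proof. by rewrite gtrDl oppr_lt0 expR_gt0. Qed.

Lemma ray_sep i j : i != j -> gap * mx (ray i) <= cabs (ray i - ray j).
Proof.
have lem (a b : nat) : (a < b)%N -> gap * expR (b%:R * eta) <= expR (b%:R * eta) - expR (a%:R * eta).
  move=> ab; rewrite /gap mulrBl mul1r lerD2l lerN2 -expRD ler_expR.
  rewrite addrC -mulN1r -mulrDl ler_pM2r// lerBrDr natr1 ler_nat//.
rewrite mx_ray /ray -rmorphB /= cabsR neq_ltn => /orP[ij|ji].
  rewrite distrC; apply: le_trans (ler_norm _); apply: le_trans (lem _ _ ij).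
  by rewrite ler_pM2l// ler_expR ler_pM2r// ler_nat ltnW.
by apply: le_trans (ler_norm _); exact: lem.
Qed.

(** Closeness relative to either modulus, so that a kept point and a point of [A] satisfy the
    separation inequality in both orders. The quarter of [gap], the relative spacing of the ray,
    prevents one point of [A] from killing two points of the ray. *)
Let kill z w := cabs (z - w) < gap / 4 * mx w \/ cabs (z - w) < gap / 4 * mx z.

Let kill_near z w : kill z w -> cabs (z - w) < gap / 2 * mx z.
Proof.
have := mx_lip w z; rewrite cabsC; have := mx_gt0 z; have := mx_gt0 w.
move: gap_gt0 gap_lt1; rewrite /kill; move: gap (mx z) (mx w) (cabs (z - w)) => g a b d g0 g1 b0 a0 bad.
have h : g * a > 0 by rewrite mulr_gt0.
by case=> h'; [nra|lra].
Qed.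

Definition clear_of z := `[< forall w, A w -> ~ kill z w >].

Definition ray_cell k : seq R[i] := [seq ray (k * J + i) | i <- iota 0 J].

Let ray_cellP k z : z \in ray_cell k -> exists i, z = ray i.
Proof. by rewrite /ray_cell => /mapP[i _ ->]; exists (k * J + i)%N. Qed.

Let ray_inj : injective ray.
Proof.
move=> i j /eqP ij; apply/eqP/negPn/negP => h; have := ray_sep h.
by rewrite (eqP ij) subrr cabs0 leNgt mulr_gt0// mx_gt0.
Qed.

Let ray_shell k z : z \in ray_cell k -> in_shell q k z.
Proof.
rewrite /ray_cell => /mapP[i iJ ->]; rewrite mem_iota add0n /= in iJ.
rewrite /in_shell mx_ray.
have E n : q ^+ n = expR ((n * J)%N%:R * eta).
  rewrite (_ : _ * eta = n%:R * ln q) ?expRM_natl ?lnK//.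
  by rewrite natrM /eta; field; rewrite pnatr_eq0 -lt0n.
rewrite !E ler_expR ltr_expR ler_pM2r// ltr_pM2r// ler_nat ltr_nat leq_addr /=.
by rewrite mulSn addnC ltn_add2r.
Qed.

Definition kept_cell k := [seq z <- ray_cell k | clear_of z].

Definition full_cell k := shell_seq A q k ++ kept_cell k.

Let finA k : finite_set (shell_part A q k).
Proof. exact: (shell_part_finite k delta_gt0 q_gt1 sepA). Qed.

Let keptP k z : z \in kept_cell k -> [/\ exists i, z = ray i, in_shell q k z &
  forall w, A w -> gap / 4 * mx w <= cabs (z - w) /\ gap / 4 * mx z <= cabs (z - w)].
Proof.
rewrite mem_filter => /andP[/asboolP zA zk]; split.
- exact: ray_cellP zk.
- exact: ray_shell.
- move=> w /zA h; split; rewrite leNgt; apply/negP => h'; apply: h; [left|right]; exact: h'.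
Qed.

Lemma full_cell_uniq k : uniq (full_cell k).
Proof.
rewrite cat_uniq shell_seq_uniq/=; apply/andP; split.
  apply/hasPn => z /keptP[_ _ zA]; apply/negP => /(mem_shell_seq z (finA k))[/zA[h _] _].
  by move: h; rewrite subrr cabs0 leNgt mulr_gt0 ?divr_gt0// mx_gt0.
by rewrite filter_uniq// map_inj_uniq ?iota_uniq// => i j /ray_inj/addnI.
Qed.

Lemma full_cell_size k : (size (full_cell k) <= M + J)%N.
Proof.
rewrite size_cat leq_add// (leq_trans (_ : _ <= size (ray_cell k))%N)//.
  by rewrite size_filter count_size.
by rewrite size_map size_iota.
Qed.

Lemma full_cell_shell k z : z \in full_cell k -> in_shell q k z.
Proof. by rewrite mem_cat => /orP[/(mem_shell_seq z (finA k))[]|/keptP[]]. Qed.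

Lemma full_cell_sep : exists2 d : R, 0 < d <= 1 & forall i j g h,
  g \in full_cell i -> h \in full_cell j -> g != h -> d * mx g <= cabs (g - h).
Proof.
exists (Num.min delta (gap / 4)).
  by rewrite lt_min delta_gt0 divr_gt0//= ge_min delta_le1.
move=> i j g h.
have le1 x (a : R) : delta * mx x <= a -> Num.min delta (gap / 4) * mx x <= a.
  by apply: le_trans; rewrite ler_pM2r ?mx_gt0// ge_min lexx.
have le2 x (a : R) : gap / 4 * mx x <= a -> Num.min delta (gap / 4) * mx x <= a.
  by apply: le_trans; rewrite ler_pM2r ?mx_gt0// ge_min lexx orbT.
rewrite !mem_cat => /orP[/(mem_shell_seq g (finA i))[Ag _]|/keptP[[a ga] _ gA]];
  move=> /orP[/(mem_shell_seq h (finA j))[Ah _]|/keptP[[b hb] _ hA]] gh.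
- exact/le1/sepA.
- by apply: le2; rewrite cabsC; exact: (hA g Ag).1.
- by apply: le2; exact: (gA h Ah).2.
- apply: le2; rewrite ga hb; apply: le_trans (ray_sep _); last first.
    by apply: contraNneq gh => ab; rewrite ga hb ab.
  rewrite ler_pM2r ?mx_gt0// ler_pdivrMr// ler_pMr//.
  by rewrite ler1n.
Qed.

(* A point of [A] within a small relative distance of a point of the ray lies in
   the same shell or in an adjacent one, and is close to no other point of the
   ray. *)
Lemma full_cell_large k : (J <= size (full_cell k) + 3 * M)%N.
Proof.
have killed z : ~~ clear_of z -> exists w, A w /\ kill z w.
  move/asboolPn => /existsNP[w /not_implyP[Aw /contrapT h]]; by exists w.
pose near z := xget 0 [set w | A w /\ kill z w].
have nearP z : ~~ clear_of z -> A (near z) /\ kill z (near z).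
  move=> /killed h; have := xgetPex 0 h; exact.
pose bad := [seq z <- ray_cell k | predC clear_of z].
have badJ : (size bad + size (kept_cell k) = J)%N.
  by rewrite addnC !size_filter count_predC size_map size_iota.
(* For [k = 0] the predecessor is 0 again and shell 0 is listed twice, which only loosens the
   count. *)
pose nbr := shell_seq A q k.-1 ++ shell_seq A q k ++ shell_seq A q k.+1.
have nbrM : (size nbr <= 3 * M)%N.
  by rewrite !size_cat mulSn mul2n -addnn !leq_add.
suff : (size bad <= size nbr)%N.
  by rewrite /full_cell size_cat; move: badJ nbrM; clear; lia.
have badP z : z \in bad -> ~~ clear_of z /\ z \in ray_cell k.
  by rewrite mem_filter => /andP.
have inj : {in bad &, injective near}.
  move=> z w /badP[/nearP[_ z1] /ray_cellP[i zi]] /badP[/nearP[_ w1] /ray_cellP[j wj]] e.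
  rewrite -e in w1; have z2 := kill_near z1; have w2 := kill_near w1.
  apply/eqP/negPn/negP => zw.
  have ij : i != j by apply: contraNneq zw => ij; rewrite zi wj ij.
  have := ray_sep ij; rewrite -zi -wj => s1.
  have := ray_sep (_ : j != i); rewrite eq_sym -zi -wj cabsC => /(_ ij) s2.
  have := cabsB (z - near z) (w - near z).
  rewrite (_ : _ - _ = z - w); last by ring.
  by move: z2 w2 s1 s2; lra.
rewrite -(size_map near bad); apply: uniq_leq_size.
  rewrite map_inj_in_uniq// filter_uniq// map_inj_uniq ?iota_uniq//.
  by move=> i j /ray_inj/addnI.
move=> _ /mapP[z /badP[/nearP[An /kill_near h] /ray_shell zk] ->].
move: An h; move: (near z) => w Aw h.
have h1 : mx w < 2 * mx z.
  have := mx_lip w z; rewrite cabsC; have := mx_gt0 z; have := gap_lt1; nra.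
have h2 : mx z < 2 * mx w.
  have := mx_lip z w; have := mx_gt0 z; have := gap_lt1; nra.
have [j wj] := shell_exists_gen w q_gt1.
have : w \in shell_seq A q j by apply/mem_shell_seq.
rewrite /nbr !mem_cat; suff : [|| j == k.-1, j == k | j == k.+1].
  by move=> /or3P[] /eqP -> ->; rewrite ?orbT.
move: zk wj => /andP[z1 z2] /andP[w1 w2].
(* As [q] exceeds 2, moduli within a factor 2 of each other lie in the same or adjacent shells. *)
have pw a b : q ^+ a < 2 * q ^+ b -> (a <= b)%N.
  move=> hab; rewrite leqNgt; apply/negP => ba; move: hab; rewrite ltNge => /negP; apply.
  apply: (@le_trans _ _ (q ^+ b.+1)); last by rewrite ler_eXn2l.
  by rewrite exprS ler_pM2r ?exprn_gt0//; have := q_ge4; lra.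
have jk : (j <= k.+1)%N.
  by apply: pw; apply: (le_lt_trans w1); apply: (lt_trans h1); rewrite ltr_pM2l.
have kj : (k <= j.+1)%N.
  by apply: pw; apply: (le_lt_trans z1); apply: (lt_trans h2); rewrite ltr_pM2l.
by move: jk kj; clear; lia.
Qed.

End Supplement.

(** * The two inclusions *)

Unset Implicit Arguments.

Theorem theorem1p3 (R : realType) (alpha : R) (p : exponent)
    (Lambda : set R[i]) (alpha_gt0 : 0 < alpha)
    (countable_Lambda : countable Lambda)
    (separated_Lambda : d_rho_separated alpha Lambda) :
  ((upper_density Lambda < (2 * alpha)%:E)%E ->
     exists Gamma : set R[i],
       Lambda `<=` Gamma /\ complete_interpolating alpha p Gamma) /\
  (((2 * alpha)%:E < lower_density Lambda)%E ->
     exists Gamma : set R[i],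
       Gamma `<=` Lambda /\ complete_interpolating alpha p Gamma).
Proof.
have [delta /andP[d0 d1] sepL] := d_rho_separated_mx alpha_gt0 separated_Lambda.
have packing q : 4 <= q -> exists M, forall k, (size (shell_seq Lambda q k) <= M)%N.
  move=> q4; have q1 : 1 < q by apply: lt_le_trans q4; rewrite ltr1n.
  have [M HM] := shell_packing d0 q1; exists M => k.
  apply: (HM Lambda k _ sepL (shell_seq_uniq _ _ _)) => z zL.
  by apply/mem_shell_seq => //; exact: shell_part_finite d0 q1 sepL.
split=> [/(upper_density_shell d0 sepL)|/(lower_density_shell d0 sepL)] [q q4 [b ab [k0 Hb]]];
  have [M HM] := packing q q4; have q1 : 1 < q by [apply: lt_le_trans q4; rewrite ltr1n];
  have finL k := shell_part_finite k d0 q1 sepL.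
- have e0 : 0 < 2 * alpha - b by rewrite subr_gt0.
  (* Discarding ray points close to Lambda costs at most [3 * M] per shell; [J] is taken so large
     that the remaining points still exceed the density [2 * alpha] by the margin
     [2 * alpha - b]. *)
  pose y : R := (3 * M)%:R + (2 * alpha + (2 * alpha - b)) * ln q.
  pose J := (Num.truncn y).+1; have HJ : y < J%:R by exact: truncnS_gt.
  have J0 : (0 < J)%N by [].
  have [d /andP[d0' d1'] sepJ] := full_cell_sep q4 d0 d1 sepL J0.
  have [|||c cor cis] := @complete_selection R alpha q d _ p (M + J) k0
    (shell_seq Lambda q) (full_cell Lambda q J) alpha_gt0 q4 d0' d1' e0 _
    (shell_seq_uniq _ _) (full_cell_uniq q4 d0 sepL J0) (full_cell_size J HM)
    (fun k g => @full_cell_shell R Lambda q delta J q4 d0 sepL J0 k g) sepJ.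
  - by move=> k z; rewrite mem_cat => ->.
  - by move=> k /Hb; rewrite opprB addrCA subrr addr0.
  - move=> k _; have := full_cell_large q4 d0 sepL HM J0 k.
    rewrite -(ler_nat R) natrD => /(lt_le_trans HJ); rewrite /y addrC ltrD2r => /ltW; exact.
  exists (cellset c); split => // z Lz; have [k zk] := shell_exists_gen z q1.
  have zL : z \in shell_seq Lambda q k by apply/mem_shell_seq.
  by exists k; case: (cor k) => ->; rewrite ?mem_cat zL.
(* The cap [2 * alpha] keeps [(2 * alpha - e) * ln q] nonnegative, as the empty sparse family
   requires. *)
- pose e := Num.min (b - 2 * alpha) (2 * alpha).
  have e0 : 0 < e by rewrite lt_min subr_gt0 ab mulr_gt0.
  have [||||||||c cor cis] := @complete_selection R alpha q delta e p M k0
    (fun=> [::]) (shell_seq Lambda q) alpha_gt0 q4 d0 d1 e0.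
  - by [].
  - by [].
  - by move=> k; exact: shell_seq_uniq.
  - exact: HM.
  - by move=> k g /(mem_shell_seq g (finL k))[].
  - move=> i j g h /(mem_shell_seq g (finL i))[Lg _] /(mem_shell_seq h (finL j))[Lh _].
    exact: sepL.
  - by move=> k _; rewrite mulr_ge0 ?ln_ge0 ?(ltW q1)// subr_ge0 ge_min lexx orbT.
  - move=> k /Hb; apply: le_trans; rewrite ler_pM2r ?ln_gt0//.
    by rewrite -lerBrDl ge_min lexx.
  exists (cellset c); split => // z [k]; case: (cor k) => -> //.
  by move/(mem_shell_seq z (finL k)) => [].
Qed.
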